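(* Let $\mathcal{T}_{s,2^\infty}$ denote the standard embedding $2^\infty$ TUHF algebra. Then the following statements hold. (1) The meet in $\text{C}^*\text{-Lat}(\mathcal{T}_{s,2^\infty})$ of all residually finite-dimensional $\mathrm{C}^*$-covers for $\mathcal{T}_{s,2^\infty}$ is $M_{2^\infty}$ (with the canonical embedding $\mathcal{T}_{s,2^\infty}\subset M_{2^\infty}$), the UHF algebra of type $2^\infty$. (2) The set of residually finite-dimensional $\mathrm{C}^*$-covers for $\mathcal{T}_{s,2^\infty}$ does not have a minimal element, i.e. there is no RFD $\mathrm{C}^*$-cover $[\mathcal{R},\upsilon]$ of $\mathcal{T}_{s,2^\infty}$ with $[\mathcal{R},\upsilon]\preceq[\mathcal{B},\iota]$ for every RFD $\mathrm{C}^*$-cover $[\mathcal{B},\iota]$ of $\mathcal{T}_{s,2^\infty}$.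
   Context: **The algebra.** $T_n\subset M_n$ denotes the upper triangular matrices. The standard embedding $M_n\to M_{kn}$ is $A\mapsto A\oplus\cdots\oplus A=I_k\otimes A$ (block diagonal with $k$ copies of $A$). $\mathcal{T}_{s,2^\infty}$ is the (norm-closed) direct limit of $T_{2^n}$, $n\ge1$, along the standard embeddings $T_{2^n}\to T_{2^{n+1}}$; it sits canonically in the direct limit $M_{2^\infty}=\varinjlim M_{2^n}$ along the standard embeddings. **$\mathrm{C}^*$-covers.** Let $\mathcal{A}$ be an operator algebra. A $\mathrm{C}^*$-cover of $\mathcal{A}$ is a pair $(\mathcal{B},\iota)$ with $\mathcal{B}$ a $\mathrm{C}^*$-algebra and $\iota:\mathcal{A}\to\mathcal{B}$ a completely isometric homomorphism with $\mathrm{C}^*(\iota(\mathcal{A}))=\mathcal{B}$. A morphism $\pi:(\mathcal{D},j)\to(\mathcal{B},\iota)$ is a $*$-homomorphism with $\pi j=\iota$; write $(\mathcal{B},\iota)\preceq(\mathcal{D},j)$ if one exists. Two covers are equivalent if each is $\preceq$ the other; $[\mathcal{B},\iota]$ denotes the equivalence class. The set $\text{C}^*\text{-Lat}(\mathcal{A})$ of equivalence classes is a complete lattice under $\preceq$. The meet of a nonempty family $\{[\mathcal{B}_i,\iota_i]\}$ is its greatest lower bound, represented by $[\mathrm{C}^*_{\max}(\mathcal{A})/\mathcal{J},q\mu]$, where $(\mathrm{C}^*_{\max}(\mathcal{A}),\mu)$ is the maximal $\mathrm{C}^*$-cover, $\mathcal{J}=\overline{\sum_i\ker\pi_i}$ for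 the unique morphisms $\pi_i:(\mathrm{C}^*_{\max}(\mathcal{A}),\mu)\to(\mathcal{B}_i,\iota_i)$, and $q$ is the quotient map. **RFD.** A $\mathrm{C}^*$-algebra is residually finite-dimensional (RFD) if it embeds by an injective $*$-homomorphism into some product $\prod_\lambda M_{r_\lambda}$ of matrix algebras. A $\mathrm{C}^*$-cover $[\mathcal{B},\iota]$ is RFD if $\mathcal{B}$ is RFD. *)

(* Defs.v *)
From HB Require Import structures.
From mathcomp Require Import all_boot all_order all_algebra.
From mathcomp Require Import complex.
From mathcomp Require Import all_classical all_reals all_analysis.

Set Implicit Arguments.
Unset Strict Implicit.
Unset Printing Implicit Defensive.

Import Order.TTheory GRing.Theory Num.Theory.
Import numFieldNormedType.Exports.

Local Open Scope classical_set_scope.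
Local Open Scope ring_scope.
Local Open Scope complex_scope.

(* Complex *-algebras, not necessarily unital (hence not MathComp's algType). *)
HB.mixin Record Lmodule_isStarAlgebra (R : realType) V of GRing.Lmodule R[i] V := {
  smul : V -> V -> V;
  star : V -> V;
  smulA : associative smul;
  smulDl : left_distributive smul +%R;
  smulDr : right_distributive smul +%R;
  smulZl : forall (a : R[i]) x y, smul (a *: x) y = a *: smul x y;
  smulZr : forall (a : R[i]) x y, smul x (a *: y) = a *: smul x y;
  starK : involutive star;
  starD : {morph star : x y / x + y};
  starZ : forall (a : R[i]) x, star (a *: x) = (Num.conj a) *: star x;
  starM : forall x y, star (smul x y) = smul (star y) (star x)
}.

#[short(type="starAlgType")]
HB.structure Definition StarAlgebra (R : realType) :=
  {V of Lmodule_isStarAlgebra R V & GRing.Lmodule R[i] V}.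

Notation "x ** y" := (smul x y) (at level 40, left associativity) : ring_scope.

HB.mixin Record StarAlgebra_isCStar (R : realType) V
    of StarAlgebra R V & CompleteNormedModule R[i] V := {
  normM_le : forall x y : V, `|x ** y| <= `|x| * `|y|;
  norm_starM : forall x : V, `|star x ** x| = `|x| ^+ 2
}.

#[short(type="cstarAlgType")]
HB.structure Definition CStarAlgebra (R : realType) :=
  {V of StarAlgebra_isCStar R V & StarAlgebra R V & CompleteNormedModule R[i] V}.

Definition star_hom (R : realType) (V W : starAlgType R) (f : V -> W) : Prop :=
  [/\ linear f, {morph f : x y / x ** y} & {morph f : x / star x}].

(* The *-algebra M_n of complex matrices. *)
Section ScalarMatrices.
Variables (R : realType) (n : nat).
Implicit Types A B : 'M[R[i]]_n.

Definition adjmx A : 'M[R[i]]_n := map_mx Num.conj A^T.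

Lemma adjmxK : involutive adjmx.
Proof. by move=> A; apply/matrixP => i j; rewrite !mxE conjCK. Qed.

Lemma adjmxD : {morph adjmx : A B / A + B}.
Proof. by move=> A B; apply/matrixP => i j; rewrite !mxE rmorphD. Qed.

Lemma adjmxZ a A : adjmx (a *: A) = (Num.conj a) *: adjmx A.
Proof. by apply/matrixP => i j; rewrite !mxE rmorphM. Qed.

Lemma adjmxM A B : adjmx (A *m B) = adjmx B *m adjmx A.
Proof. by rewrite /adjmx trmx_mul map_mxM. Qed.

Lemma mulmxZl a A B : (a *: A) *m B = a *: (A *m B).
Proof. by rewrite scalemxAl. Qed.

Lemma mulmxZr a A B : A *m (a *: B) = a *: (A *m B).
Proof. by rewrite scalemxAr. Qed.

HB.instance Definition _ := @Lmodule_isStarAlgebra.Build R 'M[R[i]]_n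
  (@mulmx _ n n n) adjmx (@mulmxA _ n n n n) (@mulmxDl _ n n n)
  (@mulmxDr _ n n n) mulmxZl mulmxZr adjmxK adjmxD adjmxZ adjmxM.
End ScalarMatrices.

(* The *-algebra M_n(V) over a *-algebra V.  The alias keeps it apart from the
   matrix structures of the library, which need entries in a (unital) ring. *)
Definition matrix_over (n : nat) (V : Type) := 'M[V]_n.

Section MatricesOverStarAlgebra.
Variables (R : realType) (n : nat) (V : starAlgType R).

HB.instance Definition _ := GRing.Zmodule.copy (matrix_over n V) 'M[V]_n.

Implicit Types X Y Z : matrix_over n V.

Definition mo_scale (a : R[i]) X : matrix_over n V := \matrix_(i, j) (a *: X i j).
Definition mo_mul X Y : matrix_over n V := \matrix_(i, j) \sum_k X i k ** Y k j.
Definition mo_star X : matrix_over n V := \matrix_(i, j) star (X j i).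

Lemma mo_scaleA a b X : mo_scale a (mo_scale b X) = mo_scale (a * b) X.
Proof. by apply/matrixP => i j; rewrite !mxE scalerA. Qed.

Lemma mo_scale1 : left_id 1 mo_scale.
Proof. by move=> X; apply/matrixP => i j; rewrite !mxE scale1r. Qed.

Lemma mo_scaleDr : right_distributive mo_scale +%R.
Proof. by move=> a X Y; apply/matrixP => i j; rewrite !mxE scalerDr. Qed.

Lemma mo_scaleDl X : {morph mo_scale^~ X : a b / a + b}.
Proof. by move=> a b; apply/matrixP => i j; rewrite !mxE scalerDl. Qed.

HB.instance Definition _ := GRing.Zmodule_isLmodule.Build R[i]
  (matrix_over n V) mo_scaleA mo_scale1 mo_scaleDr mo_scaleDl.

Lemma smul0l (x : V) : 0 ** x = 0.
Proof. by have := smulZl 0 0 x; rewrite !scale0r. Qed.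

Lemma smul0r (x : V) : x ** 0 = 0.
Proof. by have := smulZr 0 x 0; rewrite !scale0r. Qed.

Lemma star0 : star (0 : V) = 0.
Proof. by have := starZ 0 (0 : V); rewrite conjC0 !scale0r. Qed.

Lemma smul_suml (F : 'I_n -> V) x : (\sum_i F i) ** x = \sum_i F i ** x.
Proof.
apply: (big_morph (fun y => y ** x)); last exact: smul0l.
by move=> y z; rewrite smulDl.
Qed.

Lemma smul_sumr (F : 'I_n -> V) x : x ** (\sum_i F i) = \sum_i x ** F i.
Proof.
apply: (big_morph (fun y => x ** y)); last exact: smul0r.
by move=> y z; rewrite smulDr.
Qed.

Lemma star_sum (F : 'I_n -> V) : star (\sum_i F i) = \sum_i star (F i).
Proof. by apply: big_morph; [exact: starD | exact: star0]. Qed.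

Lemma mo_mulA : associative mo_mul.
Proof.
move=> X Y Z; apply/matrixP => i j; rewrite !mxE.
under eq_bigr => k _ do rewrite mxE smul_sumr.
under [RHS]eq_bigr => k _ do rewrite mxE smul_suml.
rewrite exchange_big; apply: eq_bigr => k _; apply: eq_bigr => l _.
exact: smulA.
Qed.

Lemma mo_mulDl : left_distributive mo_mul +%R.
Proof.
move=> X Y Z; apply/matrixP => i j; rewrite !mxE -big_split.
by apply: eq_bigr => k _; rewrite mxE smulDl.
Qed.

Lemma mo_mulDr : right_distributive mo_mul +%R.
Proof.
move=> X Y Z; apply/matrixP => i j; rewrite !mxE -big_split.
by apply: eq_bigr => k _; rewrite mxE smulDr.
Qed.

Lemma mo_mulZl (a : R[i]) X Y : mo_mul (a *: X) Y = a *: mo_mul X Y.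
Proof.
apply/matrixP => i j; rewrite !mxE scaler_sumr.
by apply: eq_bigr => k _; rewrite mxE smulZl.
Qed.

Lemma mo_mulZr (a : R[i]) X Y : mo_mul X (a *: Y) = a *: mo_mul X Y.
Proof.
apply/matrixP => i j; rewrite !mxE scaler_sumr.
by apply: eq_bigr => k _; rewrite mxE smulZr.
Qed.

Lemma mo_starK : involutive mo_star.
Proof. by move=> X; apply/matrixP => i j; rewrite !mxE starK. Qed.

Lemma mo_starD : {morph mo_star : X Y / X + Y}.
Proof. by move=> X Y; apply/matrixP => i j; rewrite !mxE starD. Qed.

Lemma mo_starZ (a : R[i]) X : mo_star (a *: X) = (Num.conj a) *: mo_star X.
Proof. by apply/matrixP => i j; rewrite !mxE starZ. Qed.

Lemma mo_starM X Y : mo_star (mo_mul X Y) = mo_mul (mo_star Y) (mo_star X).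
Proof.
apply/matrixP => i j; rewrite !mxE star_sum.
by apply: eq_bigr => k _; rewrite !mxE starM.
Qed.

HB.instance Definition _ := @Lmodule_isStarAlgebra.Build R (matrix_over n V)
  mo_mul mo_star mo_mulA mo_mulDl mo_mulDr mo_mulZl mo_mulZr
  mo_starK mo_starD mo_starZ mo_starM.
End MatricesOverStarAlgebra.

(* For V = M_n(B) with B a C*-algebra there is exactly one such N (an injective
   *-homomorphism from a C*-algebra into the completion of (V, N) is isometric),
   so completeness need not be required.  Norms take values in R[i], as
   everywhere in the library for modules over R[i]. *)
Record is_cstar_norm (R : realType) (V : starAlgType R) (N : V -> R[i]) : Prop := {
  cstar_normD : forall x y, N (x + y) <= N x + N y;
  cstar_normZ : forall (a : R[i]) x, N (a *: x) = `|a| * N x;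
  cstar_norm_eq0 : forall x, N x = 0 -> x = 0;
  cstar_normM : forall x y, N (x ** y) <= N x * N y;
  cstar_norm_starM : forall x, N (star x ** x) = N x ^+ 2
}.

(* A C*-algebra is RFD if it embeds into the l^oo-product of some family
   (M_(r l))_l of full matrix algebras. *)
Definition rfd (R : realType) (B : cstarAlgType R) : Prop :=
  exists (L : Type) (r : L -> nat) (pi : B -> forall l, 'M[R[i]]_(r l)),
    [/\ forall l, (0 < r l)%N,
        exists N : forall l, 'M[R[i]]_(r l) -> R[i],
          (forall l, is_cstar_norm (N l)) /\
          (forall b, exists c : R[i], forall l, N l (pi b l) <= c),
        forall l, star_hom (fun b => pi b l)
      & injective pi].

Section OperatorAlgebras.
Variables (R : realType) (M : cstarAlgType R).

(* An operator algebra is given as a (closed) subalgebra A of a C*-algebra M; a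
   map on A is represented by a total function on M, of which only the
   restriction to A is ever used. *)
Variable A : set M.

Section Maps.
Variables (B : cstarAlgType R) (iota : M -> B).

Definition alg_hom_on : Prop :=
  [/\ forall (a : R[i]) x y, A x -> A y -> iota (a *: x + y) = a *: iota x + iota y
    & forall x y, A x -> A y -> iota (x ** y) = iota x ** iota y].

(* M_n(A) carries the restriction of the C*-norm of M_n(M). *)
Definition completely_isometric_on : Prop :=
  forall n, exists (NM : matrix_over n M -> R[i]) (NB : matrix_over n B -> R[i]),
    [/\ is_cstar_norm NM, is_cstar_norm NB
      & forall X : matrix_over n M, (forall i j, A (X i j)) ->
          NB (map_mx iota X) = NM X].
End Maps.

Definition cstar_subalgebra (B : cstarAlgType R) (S : set B) : Prop :=
  [/\ S 0, forall (a : R[i]) x y, S x -> S y -> S (a *: x + y),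
      forall x y, S x -> S y -> S (x ** y), forall x, S x -> S (star x)
    & closed S].

Definition cstar_cover (B : cstarAlgType R) (iota : M -> B) : Prop :=
  [/\ alg_hom_on iota, completely_isometric_on iota
    & smallest (@cstar_subalgebra B) (iota @` A) = setT].

Definition rfd_cover (B : cstarAlgType R) (iota : M -> B) : Prop :=
  cstar_cover iota /\ rfd B.

Definition cover_le (B D : cstarAlgType R) (iota : M -> B) (j : M -> D) : Prop :=
  exists pi : D -> B, star_hom pi /\ forall x, A x -> pi (j x) = iota x.

(* The class of (B, iota) is the meet in C*-Lat(A) of the classes of the covers
   in F.  The order on classes is induced by the preorder cover_le, so greatest
   lower bounds may be computed on representatives. *)
Definition is_cover_meet
    (F : forall D : cstarAlgType R, (M -> D) -> Prop)
    (B : cstarAlgType R) (iota : M -> B) : Prop :=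
  [/\ cstar_cover iota,
      forall (D : cstarAlgType R) (j : M -> D), F D j -> cover_le iota j
    & forall (E : cstarAlgType R) (k : M -> E), cstar_cover k ->
        (forall (D : cstarAlgType R) (j : M -> D), F D j -> cover_le k j) ->
        cover_le k iota].
End OperatorAlgebras.

Lemma expn2SD n : (2 ^ n + 2 ^ n = 2 ^ n.+1)%N.
Proof. by rewrite expnS mul2n addnn. Qed.

Definition standard_embedding (R : realType) (n : nat) (A : 'M[R[i]]_(2 ^ n)) :
    'M[R[i]]_(2 ^ n.+1) :=
  castmx (expn2SD n, expn2SD n) (block_mx A 0 0 A).

(* M, with the maps phi n : M_(2^(n+1)) -> M, is the C*-algebraic direct limit
   of M_2 -> M_4 -> M_8 -> ... along the standard embeddings; since these are
   injective, so are the canonical maps into the limit. *)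
Record is_uhf2 (R : realType) (M : cstarAlgType R)
    (phi : forall n, 'M[R[i]]_(2 ^ n.+1) -> M) : Prop := {
  uhf2_hom : forall n, star_hom (phi n);
  uhf2_inj : forall n, injective (phi n);
  uhf2_compat : forall n A, phi n.+1 (standard_embedding A) = phi n A;
  uhf2_dense : closure (\bigcup_n range (phi n)) = setT
}.

Definition upper_triangular (R : realType) (n : nat) : set 'M[R[i]]_n :=
  [set A | forall i j : 'I_n, (j < i)%N -> A i j = 0].

Definition tuhf2 (R : realType) (M : cstarAlgType R)
    (phi : forall n, 'M[R[i]]_(2 ^ n.+1) -> M) : set M :=
  closure (\bigcup_n (phi n @` @upper_triangular R (2 ^ n.+1))).

(* Main.v *)
Require Import Defs.
From HB Require Import structures.
From mathcomp Require Import all_boot all_order all_algebra.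
From mathcomp Require Import complex.
From mathcomp Require Import all_classical all_reals all_analysis.
From mathcomp Require Import mxtens ring lra.
Import Order.TTheory GRing.Theory Num.Theory.
Import numFieldNormedType.Exports.

Set Implicit Arguments.
Unset Strict Implicit.
Unset Printing Implicit Defensive.

Local Open Scope classical_set_scope.
Local Open Scope ring_scope.
Local Open Scope complex_scope.

(** The algebra A is the closed union of the triangular algebras T_(2^n) in the
    UHF algebra M.

    Lower bound. Let D be an RFD cover of A. The matrix unit in the upper right
    corner of T_(2^n) has an image of norm 1 in D, which nearly preserves the
    norm of a unit vector in some finite-dimensional representation of D. This
    image factors through those of the other upper triangular matrix units,
    which are contractions; hence the images of that vector behave almost like
    the standard basis of C^(2^n) ([good_exists]), and the entries of a matrix that
    is a star polynomial in triangular matrices are bounded by the norm of the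
    same star polynomial evaluated in D ([acts_entry]). Since C*-norms satisfy
    |x^* x| = |x|^2, an estimate up to a constant improves to constant 1
    ([csn_le_rel]). This gives a star homomorphism from D to M that fixes A
    ([rfd_cover_ge_id]).

    Greatest lower bound. Passing to the upper left block is a homomorphism on
    block upper triangular matrices, and a left inverse of the standard
    embedding. So there are compressions rho n from M to M_(2^(n+1)) that are
    multiplicative on A and converge to the identity. For every m the tail
    (rho n)_(n >= m) defines an RFD cover of A ([comp_rfd_cover]). In the m-th
    of these covers the matrix units of level m remain true matrix units,
    because they are fixed by all the compressions involved ([const_emb]).
    Whatever lies below all tail covers therefore contains compatible images of
    all M_(2^n), that is, an image of M ([lower_bound_le_id]).

    No minimum. A least RFD cover would lie below M by the previous part, and M
    would have a nonzero finite-dimensional representation, which is impossible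
    because M contains unital matrix algebras of arbitrary size
    ([matrix_rep_size]).

    Two general facts support this. First, every C*-norm on a C*-algebra equals
    the given norm ([cstar_norm_unique]); this makes the norms on matrices and
    the norms in representations comparable with the norms of the covers. Its
    proof uses only an iteration for square roots ([sqrt_one_sub]). Secondly, the
    norms of matrices over M are obtained from an embedding of M_k(M) into M
    ([Psi]), which commutes with the compressions, so that complete isometry of
    the tail covers follows from isometry. *)

(** * Real-valued norms *)

(** Norms take values in R[i]; real values give access to the tactics for
    ordered fields. *)
Definition rnorm (R : realType) (V : normedModType R[i]) (x : V) : R :=
  complex.Re `|x|.

Definition cabs (R : realType) (a : R[i]) : R := complex.Re `|a|.

Section Rnorm.
Variables (R : realType).

Lemma nneg_realE (c : R[i]) : 0 <= c -> c = (complex.Re c)%:C.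
Proof. by case: c => a b /=; rewrite lecE /= => /andP[/eqP-> _]. Qed.

Lemma rcD (a b : R) : (a + b)%:C = a%:C + b%:C :> R[i].
Proof. exact: rmorphD. Qed.

Lemma rcM (a b : R) : (a * b)%:C = a%:C * b%:C :> R[i].
Proof. exact: rmorphM. Qed.

Lemma cabsE (a : R[i]) : `|a| = (cabs a)%:C.
Proof. exact: nneg_realE. Qed.

Lemma cabs_ge0 (a : R[i]) : 0 <= cabs a.
Proof. by rewrite -lecR -cabsE; apply: normr_ge0. Qed.

Lemma cabsM (a b : R[i]) : cabs (a * b) = cabs a * cabs b.
Proof. by apply: complexI; rewrite rcM -!cabsE normrM. Qed.

Lemma cabsD (a b : R[i]) : cabs (a + b) <= cabs a + cabs b.
Proof. by rewrite -lecR rcD -!cabsE ler_normD. Qed.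

Lemma cabs_real (r : R) : cabs r%:C = `|r|.
Proof. by rewrite /cabs normc_def /= expr0n addr0 sqrtr_sqr. Qed.

Lemma cabs_i : cabs ('i%C : R[i]) = 1.
Proof. by rewrite /cabs normc_def /= expr0n add0r expr1n sqrtr1. Qed.

Lemma cabsN (a : R[i]) : cabs (- a) = cabs a.
Proof. by rewrite /cabs normrN. Qed.

Section V.
Variables (V : normedModType R[i]).
Implicit Types x y : V.

Lemma rnormE x : `|x| = (rnorm x)%:C.
Proof. exact: nneg_realE. Qed.

Lemma rnorm_ge0 x : 0 <= rnorm x.
Proof. by rewrite -lecR -rnormE; apply: normr_ge0. Qed.

Lemma rnormD x y : rnorm (x + y) <= rnorm x + rnorm y.
Proof. by rewrite -lecR rcD -!rnormE; apply: ler_normD. Qed.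

Lemma rnormZ (a : R[i]) x : rnorm (a *: x) = cabs a * rnorm x.
Proof. by apply: complexI; rewrite rcM -!rnormE -cabsE normrZ. Qed.

Lemma rnorm0 : rnorm (0 : V) = 0.
Proof. by apply: complexI; rewrite -rnormE normr0. Qed.

Lemma rnorm0_eq0 x : rnorm x = 0 -> x = 0.
Proof. by move=> h; apply/normr0_eq0; rewrite rnormE h. Qed.

Lemma rnormN x : rnorm (- x) = rnorm x.
Proof. by rewrite /rnorm normrN. Qed.

Lemma rnormB x y : rnorm (x - y) = rnorm (y - x).
Proof. by rewrite /rnorm distrC. Qed.

Lemma closureE (S : set V) x :
  closure S x <-> forall e : R, 0 < e -> exists2 y, S y & rnorm (x - y) < e.
Proof.
split=> [clx e e0|h B /nbhs_ballP[e /= e0 eB]].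
  have [|y [Sy]] := clx (ball x e%:C); first by apply: nbhsx_ballx; rewrite ltcR.
  by rewrite -ball_normE /= rnormE ltcR => ?; exists y.
have ee : e = (complex.Re e)%:C by apply: nneg_realE; apply: ltW.
have [|y Sy xy] := h (complex.Re e); first by rewrite -ltcR -ee.
by exists y; split=> //; apply: eB; rewrite -ball_normE /= rnormE ee ltcR.
Qed.

Lemma closedP (S : set V) :
  closed S <-> forall x, (forall e : R, 0 < e -> exists2 y, S y & rnorm (x - y) < e) -> S x.
Proof.
split=> [cS x h|h x /closureE]; last exact: h.
by apply: cS; apply/closureE.
Qed.

Lemma ltr_eps (a b : R) : (forall e : R, 0 < e -> a <= b + e) -> a <= b.
Proof. by move=> h; apply/ler_addgt0Pr. Qed.

Lemma rnorm_eq0_eps x : (forall e : R, 0 < e -> rnorm x <= e) -> x = 0.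
Proof.
move=> h; apply: rnorm0_eq0; apply/eqP; rewrite eq_le rnorm_ge0 andbT.
by apply: ltr_eps => e e0; rewrite add0r h.
Qed.
End V.

Lemma complete_seq (V : completeNormedModType R[i]) (u : nat -> V) :
  (forall e : R, 0 < e -> exists N, forall m n, (N <= m)%N -> (N <= n)%N ->
     rnorm (u m - u n) < e) ->
  exists l, forall e : R, 0 < e -> exists N, forall n, (N <= n)%N -> rnorm (l - u n) < e.
Proof.
move=> hu.
have /cauchy_cvg ul : cauchy (u @ \oo).
  apply/cauchyP => e e0.
  have ee : e = (complex.Re e)%:C by apply: nneg_realE; apply: ltW.
  have [|N hN] := hu (complex.Re e); first by rewrite -ltcR -ee.
  exists (u N); exists N => // n /= Nn.
  by rewrite -ball_normE /= rnormE ee ltcR; apply: hN.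
exists (lim (u @ \oo)) => e e0.
have /fcvgrPdist_lt := ul; move=> /(_ e%:C).
rewrite ltcR => /(_ e0)[N _ hN]; exists N => n Nn.
by have := hN n Nn; rewrite /= rnormE ltcR.
Qed.
End Rnorm.

(** * Linear identities in modules *)

(** The square-zero extension of K by V is a commutative ring that contains the
    module V, so that [ring] decides identities between linear combinations. *)
Definition sqz (K : comNzRingType) (V : lmodType K) : Type := (K * V)%type.

Section SquareZero.
Variables (K : comNzRingType) (V : lmodType K).
HB.instance Definition _ := GRing.Zmodule.copy (sqz V) (K * V)%type.
Implicit Types x y z : sqz V.
Definition sqz_one : sqz V := (1, 0).
Definition sqz_mul x y : sqz V := (x.1 * y.1, x.1 *: y.2 + y.1 *: x.2).
Lemma sqz_mulA : associative sqz_mul.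
Proof.
move=> [a x] [b y] [c z]; congr pair; rewrite /= ?mulrA //.
by rewrite !scalerDr !scalerA -addrA (mulrC a c) (mulrC b c).
Qed.
Lemma sqz_mulC : commutative sqz_mul.
Proof. by move=> [a x] [b y]; congr pair; rewrite /= 1?mulrC // addrC. Qed.
Lemma sqz_mul1 : left_id sqz_one sqz_mul.
Proof. by move=> [a x]; congr pair; rewrite /= ?mul1r // scale1r scaler0 addr0. Qed.
Lemma sqz_mulD : left_distributive sqz_mul +%R.
Proof.
move=> [a x] [b y] [c z]; congr pair; rewrite /= ?mulrDl //.
by rewrite scalerDl scalerDr addrACA.
Qed.
Lemma sqz_one_neq0 : sqz_one != 0.
Proof. by apply/eqP => -[/eqP]; rewrite oner_eq0. Qed.
HB.instance Definition _ := GRing.Zmodule_isComNzRing.Build (sqz V)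
  sqz_mulA sqz_mulC sqz_mul1 sqz_mulD sqz_one_neq0.
Definition sqz_in (v : V) : sqz V := (0, v).
Definition sqz_scal (a : K) : sqz V := (a, 0).
Lemma sqz_inj v w : sqz_in v = sqz_in w -> v = w. Proof. by case. Qed.
Lemma sqz_in0 : sqz_in 0 = 0. Proof. by []. Qed.
Lemma sqz_inD v w : sqz_in (v + w) = sqz_in v + sqz_in w.
Proof. by congr pair; rewrite /= addr0. Qed.
Lemma sqz_inN v : sqz_in (- v) = - sqz_in v.
Proof. by congr pair; rewrite /= oppr0. Qed.
Lemma sqz_inZ a v : sqz_in (a *: v) = sqz_scal a * sqz_in v.
Proof. by congr pair; rewrite /= ?mulr0 // scale0r addr0. Qed.
Lemma sqz_scal1 : sqz_scal 1 = 1. Proof. by []. Qed.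
Lemma sqz_scalN a : sqz_scal (- a) = - sqz_scal a.
Proof. by congr pair; rewrite /= oppr0. Qed.
Lemma sqz_scalD a b : sqz_scal (a + b) = sqz_scal a + sqz_scal b.
Proof. by congr pair; rewrite /= addr0. Qed.
Lemma sqz_scalM a b : sqz_scal (a * b) = sqz_scal a * sqz_scal b.
Proof. by congr pair; rewrite /= !scaler0 addr0. Qed.
Definition sqzE := (sqz_inD, sqz_inN, sqz_inZ, sqz_in0, sqz_scalM, sqz_scalN, sqz_scalD, sqz_scal1).
End SquareZero.

Ltac linear_identity := apply: sqz_inj; rewrite ?sqzE; ring.

(** * C*-seminorms *)

Section StarAlgebraTheory.
Variables (R : realType) (V : starAlgType R).
Implicit Types x y z : V.

Lemma smulNl x y : (- x) ** y = - (x ** y).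
Proof. by rewrite -scaleN1r smulZl scaleN1r. Qed.
Lemma smulNr x y : x ** (- y) = - (x ** y).
Proof. by rewrite -scaleN1r smulZr scaleN1r. Qed.
Lemma smulBl x y z : (x - y) ** z = x ** z - y ** z.
Proof. by rewrite smulDl smulNl. Qed.
Lemma smulBr x y z : z ** (x - y) = z ** x - z ** y.
Proof. by rewrite smulDr smulNr. Qed.
Lemma starN x : star (- x) = - star x.
Proof. by rewrite -scaleN1r starZ rmorphN1 scaleN1r. Qed.
Lemma starB x y : star (x - y) = star x - star y.
Proof. by rewrite starD starN. Qed.
Definition smulE := (@smulDl R V, @smulDr R V, smulBl, smulBr, smulNl, smulNr,
  @smulZl R V, @smulZr R V).
End StarAlgebraTheory.

(** Seminorms, rather than norms, form a class that is stable under pull-back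
    along star homomorphisms. *)
Record cstar_seminorm (R : realType) (V : starAlgType R) (p : V -> R) : Prop := {
  csnD : forall x y, p (x + y) <= p x + p y;
  csnZ : forall (a : R[i]) x, p (a *: x) = cabs a * p x;
  csnM : forall x y, p (x ** y) <= p x * p y;
  csnC : forall x, p (star x ** x) = p x ^+ 2
}.

Section Seminorm.
Variables (R : realType) (V : starAlgType R) (p : V -> R).
Hypothesis pP : cstar_seminorm p.
Implicit Types x y z : V.

Lemma csnN x : p (- x) = p x.
Proof. by rewrite -scaleN1r (csnZ pP) /cabs normrN1 /= mul1r. Qed.
Lemma csn0 : p 0 = 0.
Proof. by rewrite -(scale0r (0 : V)) (csnZ pP) /cabs normr0 mul0r. Qed.
Lemma csn_ge0 x : 0 <= p x.
Proof. by have := csnD pP x (- x); rewrite subrr csn0 csnN; lra. Qed.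
Lemma csnB x y : p (x - y) <= p x + p y.
Proof. by rewrite -(csnN y) (csnD pP). Qed.

Lemma csn_star x : p (star x) = p x.
Proof.
have le z : p z <= p (star z).
  have [->|z0] := eqVneq (p z) 0; first exact: csn_ge0.
  have z1 : 0 < p z by rewrite lt_def z0 csn_ge0.
  by rewrite -(ler_pM2r z1) -expr2 -(csnC pP) (csnM pP).
by apply/eqP; rewrite eq_le le andbT; have := le (star x); rewrite starK.
Qed.

Lemma csn_sa x : star x = x -> p (x ** x) = p x ^+ 2.
Proof. by move=> xs; rewrite -{1}xs (csnC pP). Qed.

(** The powers x^(2^k) are the ones whose norm the C*-identity computes. *)
Fixpoint sqpow x k : V := if k is k'.+1 then sqpow x k' ** sqpow x k' else x.

Lemma star_sqpow x k : star x = x -> star (sqpow x k) = sqpow x k.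
Proof. by move=> xs; elim: k => //= k IH; rewrite starM IH. Qed.

Lemma csn_sqpow x k : star x = x -> p (sqpow x k) = p x ^+ (2 ^ k).
Proof.
move=> xs; elim: k => [|k IH]/=; first by rewrite expr1.
by rewrite csn_sa ?star_sqpow// IH -exprM expnS mulnC.
Qed.

Lemma csn_csn_norm : (forall x, p x = 0 -> x = 0) -> is_cstar_norm (fun x => (p x)%:C).
Proof.
move=> p0; split.
- by move=> x y; rewrite -rcD lecR (csnD pP).
- by move=> a x; rewrite (csnZ pP) rcM cabsE.
- by move=> x /complexI; apply: p0.
- by move=> x y; rewrite -rcM lecR (csnM pP).
- by move=> x; rewrite (csnC pP) expr2 rcM -expr2.
Qed.
End Seminorm.

Lemma is_cstar_norm_real (R : realType) (V : starAlgType R) (N : V -> R[i]) :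
  is_cstar_norm N -> forall x, N x = (complex.Re (N x))%:C.
Proof.
move=> hN x; apply: nneg_realE.
have N0 : N 0 = 0 by rewrite -(scale0r (0 : V)) (cstar_normZ hN) normr0 mul0r.
have := cstar_normD hN x (- x).
rewrite subrr N0 -scaleN1r (cstar_normZ hN) normrN1 mul1r -mulr2n.
by rewrite pmulrn_lge0.
Qed.

Lemma is_cstar_norm_csn (R : realType) (V : starAlgType R) (N : V -> R[i]) :
  is_cstar_norm N -> cstar_seminorm (fun x => complex.Re (N x)).
Proof.
move=> hN; have NE := is_cstar_norm_real hN; split.
- by move=> x y; rewrite -lecR rcD -!NE (cstar_normD hN).
- by move=> a x; apply: complexI; rewrite rcM -!NE -cabsE (cstar_normZ hN).
- by move=> x y; rewrite -lecR rcM -!NE (cstar_normM hN).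
- by move=> x; apply: complexI; rewrite expr2 rcM -!NE -expr2 (cstar_norm_starM hN).
Qed.

Lemma rnorm_csn (R : realType) (D : cstarAlgType R) : cstar_seminorm (@rnorm R D).
Proof.
split.
- exact: rnormD.
- exact: rnormZ.
- by move=> x y; rewrite -lecR rcM -!rnormE normM_le.
- by move=> x; apply: complexI; rewrite expr2 rcM -!rnormE -expr2 norm_starM.
Qed.

Lemma csn_comp (R : realType) (V W : starAlgType R) (f : V -> W) (p : W -> R) :
  star_hom f -> cstar_seminorm p -> cstar_seminorm (p \o f).
Proof.
move=> [lf fM fS] pP; split => /=.
- by move=> x y; have := lf 1 x y; rewrite !scale1r => ->; apply: (csnD pP).
- move=> a x; have f0 : f 0 = 0.
    by have := lf (-1) 0 0; rewrite scaler0 addr0 scaleN1r addNr.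
  by have := lf a x 0; rewrite f0 !addr0 => ->; apply: (csnZ pP).
- by move=> x y; rewrite fM; apply: (csnM pP).
- by move=> x; rewrite fM fS; apply: (csnC pP).
Qed.

(** Multiplicative constants disappear under 2^k-th roots. *)
Lemma ler_root_bound (R : realType) (a b C : R) : 0 <= a -> 0 <= b ->
  (forall k, a ^+ (2 ^ k) <= C * b ^+ (2 ^ k)) -> a <= b.
Proof.
move=> a0 b0 h; rewrite leNgt; apply/negP => ba.
have a1 : 0 < a by apply: le_lt_trans ba.
have C0 : 0 <= C.
  rewrite leNgt; apply/negP => C0; have := h 0%N; rewrite expn0 !expr1.
  have : C * b <= 0 by rewrite nmulr_rle0.
  lra.
(* Bernoulli's inequality turns a / b > 1 into unbounded growth *)
have bern n (t : R) : 0 <= t -> 1 + n%:R * t <= (1 + t) ^+ n.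
  move=> t0; elim: n => [|n IH]; first by rewrite mul0r addr0 expr0.
  rewrite exprS -natr1.
  have : (1 + t) * (1 + n%:R * t) <= (1 + t) * (1 + t) ^+ n by rewrite ler_pM2l//; lra.
  have : 0 <= n%:R * t * t by rewrite !mulr_ge0.
  by nra.
have [b00|bn0] := eqVneq b 0.
  have := h 0%N; rewrite expn0 !expr1 b00 mulr0; lra.
have b1 : 0 < b by rewrite lt_def bn0 b0.
pose t := a / b - 1.
have t0 : 0 < t by rewrite subr_gt0 ltr_pdivlMr// mul1r.
have Ck k : k%:R * t <= C.
  apply: (@le_trans _ _ ((1 + t) ^+ (2 ^ k))).
    apply: le_trans (bern _ _ (ltW t0)).
    have : k%:R <= (2 ^ k)%:R :> R by rewrite ler_nat ltnW// ltn_expl.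
    nra.
  have -> : 1 + t = a / b by rewrite /t; lra.
  by rewrite expr_div_n ler_pdivrMr ?exprn_gt0// h.
have := Ck (Num.bound (C / t)).
have : C / t < (Num.bound (C / t))%:R by apply: archi_boundP; rewrite divr_ge0// ltW.
rewrite ltr_pdivrMr//; lra.
Qed.

(** A bound up to a constant improves to the constant 1, by applying it to the
    powers of star v ** v. The statement is about a relation because it serves
    to construct a map from W to V. *)
Lemma csn_le_rel (R : realType) (V W : starAlgType R) (p : V -> R) (q : W -> R)
    (G : V -> W -> Prop) (C : R) :
  cstar_seminorm p -> cstar_seminorm q ->
  (forall v w v' w', G v w -> G v' w' -> G (v ** v') (w ** w')) ->
  (forall v w, G v w -> G (star v) (star w)) ->
  (forall v w, G v w -> p v <= C * q w) ->
  forall v w, G v w -> p v <= q w.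
Proof.
move=> pP qP GM GS h v w Gvw.
have le_sq a b : 0 <= a -> 0 <= b -> a ^+ 2 <= b ^+ 2 -> a <= b :> R.
  by move=> a0 b0; rewrite ler_pXn2r.
apply: le_sq; [exact: csn_ge0 pP _|exact: csn_ge0 qP _|].
rewrite -(csnC pP) -(csnC qP).
apply: (@ler_root_bound _ _ _ C); [exact: csn_ge0 pP _|exact: csn_ge0 qP _|].
move=> k; rewrite -(csn_sqpow pP) ?starM ?starK// -(csn_sqpow qP) ?starM ?starK//.
apply: h; elim: k => /= [|k IH]; last exact: GM.
by apply: GM => //; apply: GS.
Qed.

Lemma csn_le (R : realType) (V : starAlgType R) (p q : V -> R) (C : R) :
  cstar_seminorm p -> cstar_seminorm q ->
  (forall v, p v <= C * q v) -> forall v, p v <= q v.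
Proof.
move=> pP qP h v.
by apply: (@csn_le_rel _ _ _ p q eq C) => // [? ? ? ? -> ->|? ? ->|? ? <-].
Qed.

Section Sup.
Variables (R : realType) (V : starAlgType R) (I : Type) (i0 : I) (p : I -> V -> R).
Hypothesis pP : forall i, cstar_seminorm (p i).
Hypothesis pb : forall x, exists c : R, forall i, p i x <= c.

Definition csn_sup x : R := sup (range (p^~ x)).

Lemma le_csn_sup x i : p i x <= csn_sup x.
Proof.
apply: ub_le_sup; last by exists i.
by have [c hc] := pb x; exists c => _ [k _ <-].
Qed.

Lemma csn_sup_le x (c : R) : (forall i, p i x <= c) -> csn_sup x <= c.
Proof.
move=> h; apply: ge_sup => [|_ [n _ <-]]; last exact: h.
by exists (p i0 x), i0.
Qed.

Lemma csn_supP : cstar_seminorm csn_sup.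
Proof.
have pge0 i x : 0 <= p i x by apply: csn_ge0 (pP i) _.
have ge0 x : 0 <= csn_sup x by apply: le_trans (le_csn_sup x i0); apply: pge0.
split=> [x y|a x|x y|x].
- apply: csn_sup_le => n; apply: le_trans (csnD (pP n) _ _) _.
  by apply: lerD; apply: le_csn_sup.
- have le (b : R[i]) z : csn_sup (b *: z) <= cabs b * csn_sup z.
    apply: csn_sup_le => n; rewrite (csnZ (pP n)).
    by rewrite ler_wpM2l ?cabs_ge0// le_csn_sup.
  apply/eqP; rewrite eq_le le /=.
  have [->|a0] := eqVneq a 0; first by rewrite /cabs normr0 mul0r ge0.
  have aa : cabs a^-1 * cabs a = 1.
    by rewrite -cabsM mulVf// /cabs normr1.
  have a1 : 0 <= cabs a by apply: cabs_ge0.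
  have := le a^-1 (a *: x); rewrite scalerA mulVf// scale1r => h.
  have := ler_wpM2l a1 h; rewrite mulrA [cabs a * cabs a^-1]mulrC aa mul1r; apply.
- apply: csn_sup_le => n; apply: le_trans (csnM (pP n) _ _) _.
  by apply: ler_pM; rewrite ?pge0// le_csn_sup.
- apply/eqP; rewrite eq_le; apply/andP; split.
    apply: csn_sup_le => n; rewrite (csnC (pP n)).
    by rewrite ler_pXn2r// ?nnegrE ?pge0// le_csn_sup.
  have := ge0 (star x ** x) => g0.
  rewrite -(sqr_sqrtr g0) ler_pXn2r// ?nnegrE ?sqrtr_ge0//.
  apply: csn_sup_le => n; rewrite -[p n x]ger0_norm ?pge0// -sqrtr_sqr.
  by rewrite ler_wsqrtr// -(csnC (pP n)) (le_csn_sup (star x ** x)).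
Qed.

Lemma csn_sup_eq0 x : csn_sup x = 0 -> forall i, p i x = 0.
Proof.
by move=> x0 i; apply/eqP; rewrite eq_le (csn_ge0 (pP i)) andbT -x0 le_csn_sup.
Qed.
End Sup.

(** * Square roots of 1 - x *)

Section SqrtIteration.
Variables (R : realType).

Definition chalf : R[i] := (2^-1)%:C.

Lemma halfD : chalf + chalf = 1.
Proof. by rewrite /chalf -rcD; have -> : 2^-1 + 2^-1 = 1 :> R by lra. Qed.

Lemma conj_half : Num.conj chalf = chalf.
Proof. exact: conjc_real. Qed.

Lemma cabs_half : cabs chalf = 2^-1.
Proof. by rewrite /chalf cabs_real ger0_norm// invr_ge0. Qed.

Lemma scale_half2 (V : lmodType R[i]) (x : V) : chalf *: (x + x) = x.
Proof. by rewrite scalerDr -scalerDl halfD scale1r. Qed.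

(** If the iteration converges to y, then (1 - y)^2 = 1 - x. *)
Fixpoint sqrt_iter (V : starAlgType R) (x : V) k : V :=
  if k is k'.+1 then chalf *: (x + sqrt_iter x k' ** sqrt_iter x k') else 0.

(** The case x = 1 in the field of scalars, which dominates all others. *)
Fixpoint sqrt_iter1 k : R :=
  if k is k'.+1 then 2^-1 * (1 + sqrt_iter1 k' ^+ 2) else 0.

Lemma sqrt_iter1_ge0 k : 0 <= sqrt_iter1 k.
Proof. by case: k => //= k; rewrite mulr_ge0 ?invr_ge0// addr_ge0 ?sqr_ge0. Qed.

Lemma sqrt_iter1_le1 k : sqrt_iter1 k <= 1.
Proof.
elim: k => //= k IH; have := sqrt_iter1_ge0 k.
set s := sqrt_iter1 k in IH *; nra.
Qed.

Definition rate k : R := 2 / k.+2%:R.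

Lemma sqrt_iter1_rate k : 1 - sqrt_iter1 k <= rate k.
Proof.
rewrite /rate; elim: k => [|k IH] /=; first by rewrite subr0 divff.
have s0 := sqrt_iter1_ge0 k; have s1 := sqrt_iter1_le1 k.
set s := sqrt_iter1 k in IH s0 s1 *.
pose n : R := k.+2%:R; have n2 : 2 <= n by rewrite ler_nat.
have -> : k.+3%:R = n + 1 by rewrite /n natr1.
rewrite -/n in IH.
rewrite ler_pdivlMr; last lra.
rewrite ler_pdivlMr in IH; last lra.
(* in terms of the defect d = 1 - s the iteration reads d - d^2 / 2 *)
pose d := 1 - s.
have -> : 1 - 2^-1 * (1 + s ^+ 2) = d - d ^+ 2 / 2 by rewrite /d; lra.
rewrite -/d in IH; have d0 : 0 <= d by rewrite /d; lra.
have d1 : d <= 1 by rewrite /d; lra.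
nra.
Qed.

Section Algebra.
Variable V : starAlgType R.
Implicit Types x y z : V.

Lemma star_sqrt_iter x k : star x = x -> star (sqrt_iter x k) = sqrt_iter x k.
Proof.
move=> xs; elim: k => /= [|k IH]; first exact: star0.
by rewrite starZ starD starM xs IH conj_half.
Qed.

Lemma sqrt_iter_comm x z k : z ** x = x ** z ->
  z ** sqrt_iter x k = sqrt_iter x k ** z.
Proof.
move=> zx; elim: k => /= [|k IH]; first by rewrite smul0l smul0r.
by rewrite smulZl smulZr smulDl smulDr zx smulA IH -smulA IH smulA.
Qed.

Lemma sqrt_iter_le (p : V -> R) x k : cstar_seminorm p -> p x <= 1 ->
  p (sqrt_iter x k) <= sqrt_iter1 k.
Proof.
move=> pP px; elim: k => /= [|k IH]; first by rewrite csn0.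
rewrite (csnZ pP) cabs_half ler_pM2l ?invr_gt0//.
apply: le_trans (csnD pP _ _) _; apply: lerD => //.
apply: le_trans (csnM pP _ _) _; rewrite -expr2.
by rewrite ler_pXn2r// ?nnegrE ?(csn_ge0 pP) ?sqrt_iter1_ge0.
Qed.

Lemma sqrB y z : y ** y - z ** z = y ** (y - z) + (y - z) ** z.
Proof. by rewrite !smulE; linear_identity. Qed.

Lemma csn_sqrB (p : V -> R) y z : cstar_seminorm p ->
  p (y ** y - z ** z) <= (p y + p z) * p (y - z).
Proof.
move=> pP; rewrite sqrB mulrDl; apply: le_trans (csnD pP _ _) _.
by apply: lerD; rewrite ?[p z * _]mulrC; apply: (csnM pP).
Qed.

(** The iterates are polynomials in x with nonnegative coefficients, so their
    increments are largest at x = 1. *)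
Lemma sqrt_iter_step (p : V -> R) x k : cstar_seminorm p -> p x <= 1 ->
  p (sqrt_iter x k.+1 - sqrt_iter x k) <= sqrt_iter1 k.+1 - sqrt_iter1 k.
Proof.
move=> pP px; elim: k => [|k IH].
  rewrite /= !subr0 smul0r addr0 expr0n addr0 mulr1 (csnZ pP) cabs_half.
  by rewrite ler_piMr// invr_ge0.
rewrite [sqrt_iter x k.+2]/= [X in _ - X]/= -scalerBr [x + _]addrC addrKA.
rewrite (csnZ pP) cabs_half.
have := csn_sqrB (sqrt_iter x k.+1) (sqrt_iter x k) pP.
have := sqrt_iter_le k pP px; have := sqrt_iter_le k.+1 pP px.
have -> : sqrt_iter1 k.+2 - sqrt_iter1 k.+1 =
   2^-1 * ((sqrt_iter1 k.+1 + sqrt_iter1 k) * (sqrt_iter1 k.+1 - sqrt_iter1 k)).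
  have : sqrt_iter1 k.+1 = 2^-1 * (1 + sqrt_iter1 k ^+ 2) by [].
  have : sqrt_iter1 k.+2 = 2^-1 * (1 + sqrt_iter1 k.+1 ^+ 2) by [].
  by move: (sqrt_iter1 k.+2) (sqrt_iter1 k.+1) => a b -> ->; field.
have := csn_ge0 pP (sqrt_iter x k.+1 - sqrt_iter x k).
move=> h0 h1 h2 h3; rewrite ler_pM2l ?invr_gt0//; apply: le_trans h3 _.
apply: ler_pM => //; first by rewrite addr_ge0// (csn_ge0 pP).
exact: lerD.
Qed.

Lemma sqrt_iter_cauchy (p : V -> R) x m n : cstar_seminorm p -> p x <= 1 ->
  p (sqrt_iter x (m + n) - sqrt_iter x m) <= 1 - sqrt_iter1 m.
Proof.
move=> pP px; apply: (@le_trans _ _ (sqrt_iter1 (m + n) - sqrt_iter1 m)); last first.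
  by rewrite lerB// sqrt_iter1_le1.
elim: n => [|n IH]; first by rewrite addn0 !subrr csn0.
rewrite addnS -(subrKA (sqrt_iter x (m + n))) -(subrKA (sqrt_iter1 (m + n)) (sqrt_iter1 _)).
by apply: le_trans (csnD pP _ _) _; apply: lerD => //; apply: sqrt_iter_step.
Qed.
End Algebra.
End SqrtIteration.

Lemma smul_closeness (R : realType) (D : cstarAlgType R) (y z y' z' : D) :
  rnorm (y ** z - y' ** z') <= rnorm y * rnorm (z - z') + rnorm (y - y') * rnorm z'.
Proof.
have -> : y ** z - y' ** z' = y ** (z - z') + (y - y') ** z'.
  by rewrite !smulE; linear_identity.
have P := rnorm_csn D.
by apply: le_trans (csnD P _ _) _; apply: lerD; apply: (csnM P).
Qed.

Lemma rate_small (R : realType) (e : R) : 0 < e -> exists k, rate R k < e.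
Proof.
rewrite /rate => e0; exists (Num.bound (2 / e)).
have : 2 / e < (Num.bound (2 / e))%:R by apply: archi_boundP; rewrite divr_ge0// ltW.
rewrite ltr_pdivrMr// => h; rewrite ltr_pdivrMr ?ltr0n//.
by apply: lt_trans h _; rewrite mulrC ltr_pM2l// ltr_nat ltnS leqnSn.
Qed.

Section CStar.
Variables (R : realType) (D : cstarAlgType R).
Implicit Types x y z d : D.
Let P := rnorm_csn D.

(** The formal element 1 - y is a square root of 1 - x; it is represented by y
    because D need not have a unit. The rate of convergence is part of the
    statement because [no_small_square] compares the iteration in two norms. *)
Lemma sqrt_one_sub x : star x = x -> rnorm x <= 1 ->
  exists y, [/\ star y = y, rnorm y <= 1, y + y - y ** y = x,
    forall z, z ** x = x ** z -> z ** y = y ** z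
  & forall k, rnorm (y - sqrt_iter x k) <= rate R k].
Proof.
move=> xs x1; pose u := sqrt_iter x.
have uc k n : rnorm (u (k + n)%N - u k) <= rate R k.
  by apply: le_trans (sqrt_iter1_rate R k); apply: sqrt_iter_cauchy.
have [|y yl] := @complete_seq R D u.
  move=> e e0; have [|N hN] := @rate_small R (e / 2); first by rewrite divr_gt0.
  exists N => m n Nm Nn; rewrite -(subrKA (u N)).
  apply: le_lt_trans (rnormD _ _) _; rewrite (rnormB (u N)).
  have := uc N (m - N)%N; have := uc N (n - N)%N; rewrite !subnKC//; lra.
have yk k : rnorm (y - u k) <= rate R k.
  apply: ltr_eps => e /yl[N hN].
  rewrite -(subrKA (u (k + N)%N)); apply: le_trans (rnormD _ _) _.
  by rewrite addrC; apply: lerD; [apply: uc|apply/ltW/hN; rewrite leq_addl].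
have y1 : rnorm y <= 1.
  apply: ltr_eps => e /yl[N /(_ N (leqnn N)) hN].
  rewrite -(subrK (u N) y); apply: le_trans (rnormD _ _) _.
  have := sqrt_iter_le N P x1; have := sqrt_iter1_le1 R N; rewrite -/(u N); lra.
have u1 k : rnorm (u k) <= 1.
  by apply: le_trans (sqrt_iter_le k P x1) _; apply: sqrt_iter1_le1.
exists y; split => //.
- apply/subr0_eq/rnorm_eq0_eps => e e0.
  have [|N hN] := yl (e / 2); first by rewrite divr_gt0.
  have -> : star y - y = star (y - u N) - (y - u N).
    by rewrite starB (star_sqrt_iter N xs); linear_identity.
  apply: le_trans (csnB P _ _) _; rewrite (csn_star P).
  by have := hN _ (leqnn N); lra.
- apply/subr0_eq/rnorm_eq0_eps => e e0.
  have [|N hN] := yl (e / 4); first by rewrite divr_gt0.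
  have h1 := hN _ (leqnn N); have h2 := hN _ (leqnSn N).
  have uS : u N.+1 + u N.+1 = x + u N ** u N.
    by rewrite /u /= -scalerDl halfD scale1r.
  have -> : y + y - y ** y - x = (y - u N.+1) + (y - u N.+1) - (y ** y - u N ** u N).
    have -> : x = u N.+1 + u N.+1 - u N ** u N by rewrite uS addrK.
    by linear_identity.
  apply: le_trans (csnB P _ _) _.
  have := rnormD (y - u N.+1) (y - u N.+1).
  have := csn_sqrB y (u N) P; have := u1 N.
  have := rnorm_ge0 (y - u N); nra.
- move=> z zx; apply/subr0_eq/rnorm_eq0_eps => e e0.
  have z0 := rnorm_ge0 z.
  have [|N hN] := yl (e / (2 * (rnorm z + 1))).
    by rewrite divr_gt0// mulr_gt0//; lra.
  have zu := sqrt_iter_comm N zx.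
  have -> : z ** y - y ** z = z ** (y - u N) - (y - u N) ** z.
    by rewrite !smulE -/(u N) zu; linear_identity.
  apply: le_trans (csnB P _ _) _.
  have := csnM P z (y - u N); have := csnM P (y - u N) z.
  have := hN _ (leqnn N); rewrite ltr_pdivlMr; last by rewrite mulr_gt0//; lra.
  have := rnorm_ge0 (y - u N); nra.
Qed.

(** The pair (W, W') stands for a unitary multiplier and its adjoint, so that
    unitaries can be used in an algebra without unit. *)
Lemma csn_unitary (p : D -> R) (W W' : D -> D) : cstar_seminorm p ->
  (forall d e, star (W d) ** e = star d ** W' e) -> (forall d, W' (W d) = d) ->
  forall d, p (W d) = p d.
Proof.
move=> pP adj WW d.
have : p (W d) ^+ 2 = p d ^+ 2 by rewrite -!(csnC pP) adj WW.
by move=> /eqP; rewrite eqrXn2 ?(csn_ge0 pP)// => /eqP.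
Qed.
End CStar.

(** * Uniqueness of the C*-norm *)

Section Unitary.
Variables (R : realType) (D : cstarAlgType R).
Implicit Types x y z d : D.
Let P := rnorm_csn D.

Definition imC : R[i] := 'i%C.

Lemma imC_sqr : imC * imC = -1.
Proof. by rewrite -expr2; apply: sqr_i. Qed.

Lemma conj_imC : Num.conj imC = - imC.
Proof. by apply/eqP; rewrite eq_complex /= oppr0 !eqxx. Qed.

(** The multiplier k + a (1 - y). It is unitary if a = i or a = -i and
    (1 - y)^2 = 1 - k^2. *)
Definition unitary_mult (a : R[i]) (k y d : D) : D := k ** d + a *: (d - y ** d).

Lemma unitary_mult_adj a k y d e : star k = k -> star y = y -> Num.conj a = - a ->
  star (unitary_mult a k y d) ** e = star d ** unitary_mult (- a) k y e.
Proof.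
move=> ks ys aC; rewrite /unitary_mult starD starZ starB !starM ks ys aC.
by rewrite !smulE !smulA; linear_identity.
Qed.

Lemma unitary_multK a k y d : a * a = -1 -> k ** y = y ** k ->
  y + y - y ** y = k ** k -> unitary_mult (- a) k y (unitary_mult a k y d) = d.
Proof.
move=> aa ky yy; rewrite /unitary_mult !smulE !smulA -ky.
have -> : k ** k ** d = y ** d + y ** d - y ** y ** d by rewrite -yy !smulE.
rewrite [LHS](_ : _ = y ** d + y ** d - y ** y ** d -
   (a * a) *: (d - y ** d - y ** d + y ** y ** d)); last by linear_identity.
by rewrite aa; linear_identity.
Qed.

Lemma unitary_of_sa k : star k = k -> rnorm k <= 1 ->
  exists y, [/\ star y = y, k ** y = y ** k, y + y - y ** y = k ** k
    & forall (p : D -> R) a d, cstar_seminorm p -> a = imC \/ a = - imC -> p (unitary_mult a k y d) = p d].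
Proof.
move=> ks k1.
have [||y [ys y1 yy yc _]] := @sqrt_one_sub R D (k ** k).
- by rewrite starM ks.
- rewrite (csn_sa P)// expr2; have := rnorm_ge0 k; nra.
exists y; have ky : k ** y = y ** k by apply: yc; rewrite smulA.
split=> // p a d pP aE.
have aC : Num.conj a = - a by case: aE => ->; rewrite ?rmorphN /= conj_imC.
have aa : a * a = -1 by case: aE => ->; rewrite ?mulrNN imC_sqr.
apply: (@csn_unitary _ _ p (unitary_mult a k y) (unitary_mult (- a) k y)) => // [d' e|d'].
  exact: unitary_mult_adj.
exact: unitary_multK.
Qed.

(** A self-adjoint contraction k is the real part of the unitary
    k + i sqrt(1 - k^2), and unitaries are isometric for p. *)
Lemma csn_contractive (p : D -> R) : cstar_seminorm p -> forall x, p x <= rnorm x.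
Proof.
move=> pP.
have sa1 k : star k = k -> rnorm k <= 1 -> p k <= 1.
  move=> ks k1; have [y [ys ky yy yp]] := unitary_of_sa ks k1.
  have : p (k ** k) <= p k.
    have kE : k ** k = (chalf R) *: (unitary_mult imC k y k + unitary_mult (- imC) k y k).
      rewrite /unitary_mult -[LHS]scale_half2; congr (_ *: _); linear_identity.
    rewrite kE (csnZ pP) cabs_half.
    have := csnD pP (unitary_mult imC k y k) (unitary_mult (- imC) k y k).
    by rewrite !yp; tauto || lra.
  rewrite (csn_sa pP)// expr2; have := csn_ge0 pP k.
  rewrite le_eqVlt => /orP[/eqP <- //|k0].
  by rewrite ger_pMr.
have sa k : star k = k -> p k <= rnorm k.
  move=> ks; have [k0|k0] := eqVneq (rnorm k) 0.
    by rewrite k0 (rnorm0_eq0 k0) (csn0 pP).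
  have kp : 0 < rnorm k by rewrite lt_def k0 rnorm_ge0.
  have cE : cabs ((rnorm k)^-1)%:C = (rnorm k)^-1.
    by rewrite cabs_real ger0_norm// invr_ge0 ltW.
  have := sa1 (((rnorm k)^-1)%:C *: k).
  rewrite (csnZ pP) rnormZ cE mulVf// starZ ks mulrC ler_pdivrMr// mul1r; apply => //.
  by congr (_ *: _); apply: conjc_real.
move=> x; rewrite -(@ler_pXn2r _ 2)// ?nnegrE ?rnorm_ge0 ?(csn_ge0 pP)//.
by rewrite -(csnC pP) -(csnC P); apply: sa; rewrite starM starK.
Qed.

(** Let u = 2 k^2, so that q u <= 1, and v = 2 k sqrt(1 - k^2), so that v^2 =
    1 - (1 - u)^2. Since v is the imaginary part of the square of a unitary,
    the square root iteration at v^2 converges in D to some z with |z| <= 1.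
    As u is another fixed point of the iteration and q u <= 1, the iterates
    also converge to u with respect to q. Hence u = z, which contradicts |u| =
    2. In terms of functions, 1 - z is the absolute value |1 - u|. *)
Lemma no_small_square (q : D -> R) k : cstar_seminorm q -> (forall x, q x = 0 -> x = 0) ->
  star k = k -> rnorm k = 1 -> q k <= 2^-1 -> False.
Proof.
move=> qP q0 ks k1 qk.
have [|y [ys ky yy yp]] := unitary_of_sa ks; first by rewrite k1.
(* y is 1 - sqrt(1 - k^2), so v is 2 k sqrt(1 - k^2) *)
pose w := k - k ** y; pose v := w + w.
have ws : star w = w by rewrite /w starB starM ks ys ky.
have vs : star v = v by rewrite /v starD ws.
(* v is the imaginary part of the square of the unitary k + i sqrt(1 - k^2) *)
have vd d : rnorm (v ** d) <= rnorm d.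
  have vE : (imC + imC) *: (v ** d) = unitary_mult imC k y (unitary_mult imC k y d) - unitary_mult (- imC) k y (unitary_mult (- imC) k y d).
    by rewrite /unitary_mult /v /w !smulE !smulA -ky; linear_identity.
  have := csnB P (unitary_mult imC k y (unitary_mult imC k y d)) (unitary_mult (- imC) k y (unitary_mult (- imC) k y d)).
  rewrite -vE !yp//; try tauto.
  rewrite rnormZ -mulr2n -mulr_natl cabsM cabs_i.
  have -> : cabs (2%:R : R[i]) = 2 by rewrite -(rmorph_nat (real_complex R)) cabs_real ger0_norm.
  rewrite mulr1; lra.
have v1 : rnorm v <= 1.
  have := vd v; rewrite (csn_sa P)// expr2.
  have := rnorm_ge0 v; rewrite le_eqVlt => /orP[/eqP <- //|v0].
  by rewrite ger_pMr.
pose u := k ** k + k ** k.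
have qu : q u <= 1.
  apply: le_trans (csnD qP _ _) _; rewrite (csn_sa qP)//.
  have := csn_ge0 qP k; nra.
have x1 : rnorm (v ** v) <= 1.
  rewrite (csn_sa P)// expr2; have := rnorm_ge0 v; nra.
have vvE : v ** v = u + u - u ** u.
  have ww : w ** w = k ** k - k ** k ** (k ** k).
    have kyk : k ** y ** k = k ** k ** y by rewrite -smulA -ky smulA.
    have -> : k ** k ** (k ** k) = k ** k ** (y + y - y ** y) by rewrite yy.
    by rewrite /w !smulE !smulA !kyk; linear_identity.
  have sq2 (a : D) : (a + a) ** (a + a) = (a ** a + a ** a) + (a ** a + a ** a).
    by rewrite !smulE.
  by rewrite /v /u !sq2 ww; linear_identity.
have [||z [zs z1 _ _ zk]] := @sqrt_one_sub R D (v ** v) => //.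
  by rewrite starM vs.
have uz : u = z.
  apply/subr0_eq/q0/eqP; rewrite eq_le (csn_ge0 qP) andbT.
  apply: ltr_eps => e e0; rewrite add0r.
  have [|N hN] := @rate_small R (e / 2); first by rewrite divr_gt0.
  have h1 : q (z - sqrt_iter (v ** v) N) <= rate R N.
    by apply: le_trans (zk N); apply: csn_contractive.
  (* the error satisfies the same recursion as the defect 1 - sqrt_iter1 *)
  have h2 n : q (u - sqrt_iter (v ** v) n) <= 1 - sqrt_iter1 R n.
    elim: n => [|n IH] /=; first by rewrite !subr0.
    have -> : u - (chalf R) *: (v ** v + sqrt_iter (v ** v) n ** sqrt_iter (v ** v) n) =
       (chalf R) *: (u ** u - sqrt_iter (v ** v) n ** sqrt_iter (v ** v) n).
      rewrite {1}vvE -{1}[u]scale_half2; linear_identity.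
    rewrite (csnZ qP) cabs_half.
    have := csn_sqrB u (sqrt_iter (v ** v) n) qP.
    have xq : q (v ** v) <= 1 by apply: le_trans x1; apply: csn_contractive.
    have := sqrt_iter_le n qP xq; have := sqrt_iter1_le1 R n.
    have := csn_ge0 qP (u - sqrt_iter (v ** v) n); have := sqrt_iter1_ge0 R n.
    move: IH; set de := q (u - _); set t := q (sqrt_iter _ _); set s := sqrt_iter1 R n.
    move=> IH s0 de0 s1 ts h3.
    have : (q u + t) * de <= (1 + s) * (1 - s).
      by apply: ler_pM => //; [rewrite addr_ge0// (csn_ge0 qP)|apply: lerD].
    nra.
  have -> : u - z = (u - sqrt_iter (v ** v) N) - (z - sqrt_iter (v ** v) N).
    by linear_identity.
  apply: le_trans (csnB qP _ _) _; have := h2 N; have := sqrt_iter1_rate R N; lra.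
have : rnorm u = 2.
  rewrite /u -mulr2n -scaler_nat rnormZ (csn_sa P)// k1 expr1n mulr1.
  by rewrite -(rmorph_nat (real_complex R)) cabs_real ger0_norm.
rewrite uz; lra.
Qed.

(** If q (star x ** x) were smaller than the norm, then a high power of star x
    ** x, normalized, would contradict [no_small_square]. *)
Lemma cstar_norm_unique (q : D -> R) : cstar_seminorm q -> (forall x, q x = 0 -> x = 0) ->
  forall x, q x = rnorm x.
Proof.
move=> qP q0 x; apply/eqP; rewrite eq_le csn_contractive//=.
rewrite -(@ler_pXn2r _ 2)// ?nnegrE ?rnorm_ge0 ?(csn_ge0 qP)//.
rewrite -(csnC qP) -(csnC P); set h := star x ** x.
have hs : star h = h by rewrite starM starK.
apply: (@ler_root_bound _ _ _ 2); rewrite ?rnorm_ge0 ?(csn_ge0 qP)// => n.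
rewrite -(csn_sqpow P)// -(csn_sqpow qP)// leNgt; apply/negP.
have := star_sqpow n hs; move: (sqpow h n) => g gs gq.
have gp : 0 < rnorm g by apply: le_lt_trans gq; rewrite mulr_ge0// (csn_ge0 qP).
have cE : cabs ((rnorm g)^-1)%:C = (rnorm g)^-1.
  by rewrite cabs_real ger0_norm// invr_ge0 ltW.
apply: (@no_small_square q (((rnorm g)^-1)%:C *: g)) => //.
- by rewrite starZ gs; congr (_ *: _); apply: conjc_real.
- by rewrite rnormZ cE mulVf// gt_eqF.
- by rewrite (csnZ qP) cE mulrC ler_pdivrMr//; lra.
Qed.
End Unitary.

Lemma star_hom_contractive (R : realType) (D E : cstarAlgType R) (f : D -> E) :
  star_hom f -> forall x, rnorm (f x) <= rnorm x.
Proof. by move=> fP; apply: csn_contractive (csn_comp fP (rnorm_csn E)). Qed.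

(** * Extension by continuity *)

Section Extension.
Variables (R : realType).

(** A bounded linear map defined on a subspace is extended by closing its
    graph. Algebraic properties of the graph pass to the closure. *)
Definition rel_closure (V W : normedModType R[i]) (G : V -> W -> Prop) (d : V) (e : W) :=
  forall r : R, 0 < r -> exists d' e', [/\ G d' e', rnorm (d - d') < r & rnorm (e - e') < r].

Definition rel_linear (V W : lmodType R[i]) (G : V -> W -> Prop) :=
  forall (a : R[i]) d e d' e', G d e -> G d' e' -> G (a *: d + d') (a *: e + e').

Lemma rate_le m n : (m <= n)%N -> rate R n <= rate R m.
Proof. by move=> mn; rewrite /rate ler_pM2l// lef_pV2 ?posrE// ler_nat !ltnS. Qed.

Lemma rate_gt0 n : 0 < rate R n.
Proof. by rewrite divr_gt0. Qed.

Lemma linear_cont (V : normedModType R[i]) (a : R[i]) (r : R) : 0 < r ->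
  exists2 s : R, 0 < s & forall x x' y y' : V,
  rnorm (x - x') < s -> rnorm (y - y') < s -> rnorm ((a *: x + y) - (a *: x' + y')) < r.
Proof.
move=> r0; have a0 := cabs_ge0 a; exists (r / (cabs a + 1)); first by rewrite divr_gt0//; lra.
move=> x x' y y' hx hy.
have -> : a *: x + y - (a *: x' + y') = a *: (x - x') + (y - y') by linear_identity.
apply: le_lt_trans (rnormD _ _) _; rewrite rnormZ.
have := rnorm_ge0 (x - x'); have := rnorm_ge0 (y - y').
move: (rnorm (x - x')) (rnorm (y - y')) hx hy => b c bt ct c0 b0.
have -> : r = (cabs a) * (r / (cabs a + 1)) + r / (cabs a + 1) by field; lra.
move: (r / _) bt ct => t bt ct; have : cabs a * b <= cabs a * t by rewrite ler_wpM2l// ltW.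
lra.
Qed.

Lemma smul_cont (D : cstarAlgType R) (x y : D) (r : R) : 0 < r ->
  exists2 s : R, 0 < s & forall x' y' : D,
  rnorm (x - x') < s -> rnorm (y - y') < s -> rnorm (x ** y - x' ** y') < r.
Proof.
move=> r0; have x0 := rnorm_ge0 x; have y0 := rnorm_ge0 y.
pose c := rnorm x + rnorm y + 2; have c0 : 0 < c by rewrite /c; lra.
exists (Num.min 1 (r / c)); first by rewrite lt_min ltr01 divr_gt0.
move=> x' y'; rewrite !lt_min => /andP[xx1 xxr] /andP[yy1 yyr].
apply: le_lt_trans (smul_closeness _ _ _ _) _.
have y'1 : rnorm y' <= rnorm y + 1.
  have -> : y' = y - (y - y') by linear_identity.
  by apply: le_trans (csnB (rnorm_csn D) _ _) _; lra.
have -> : r = c * (r / c) by field; lra.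
move: (r / c) (rnorm_ge0 (x - x')) (rnorm_ge0 (y - y')) (rnorm_ge0 y') xxr yyr.
move: (rnorm (x - x')) (rnorm (y - y')) (rnorm y') y'1 => a b z z1 t a0 b0 z0 at_ bt.
have : rnorm x * b <= rnorm x * t by rewrite ler_wpM2l// ltW.
have : a * z <= t * (rnorm y + 1) by apply: ler_pM => //; exact: ltW.
rewrite /c; nra.
Qed.

Section Linear.
Variables (V : normedModType R[i]) (W : completeNormedModType R[i]) (G : V -> W -> Prop).
Hypothesis Glin : rel_linear G.
Hypothesis Gle : forall d e, G d e -> rnorm e <= rnorm d.

Lemma rel_closure_linear : rel_linear (rel_closure G).
Proof.
move=> a d e d' e' h h' r r0.
have [s s0 sV] := @linear_cont V a r r0; have [t t0 tW] := @linear_cont W a r r0.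
have m0 : 0 < Num.min s t by rewrite lt_min s0.
have [d1 [e1 [G1 dd1 ee1]]] := h _ m0; have [d2 [e2 [G2 dd2 ee2]]] := h' _ m0.
move: dd1 ee1 dd2 ee2; rewrite !lt_min => /andP[? _] /andP[_ ?] /andP[? _] /andP[_ ?].
exists (a *: d1 + d2), (a *: e1 + e2); split; [exact: Glin|exact: sV|exact: tW].
Qed.

Lemma rel_closure_le d e : rel_closure G d e -> rnorm e <= rnorm d.
Proof.
move=> h; apply: ltr_eps => r r0; have [|d1 [e1 [G1 dd1 ee1]]] := h (r / 2).
  by rewrite divr_gt0.
have := rnormD (e - e1) e1; rewrite subrK.
have := rnormD (d1 - d) d; rewrite subrK (rnormB d1).
have := Gle G1; lra.
Qed.

Lemma rel_closure_fun d e e' : rel_closure G d e -> rel_closure G d e' -> e = e'.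
Proof.
move=> h h'; apply/subr0_eq/rnorm0_eq0/eqP; rewrite eq_le rnorm_ge0 andbT.
have := rel_closure_le (rel_closure_linear (-1) h' h).
by rewrite !scaleN1r addNr rnorm0 addrC.
Qed.

Lemma sub_rel_closure d e : G d e -> rel_closure G d e.
Proof. by move=> h r r0; exists d, e; rewrite !subrr !rnorm0. Qed.

Lemma rel_closure_closed (d : V) :
  (forall r : R, 0 < r -> exists d' e', rel_closure G d' e' /\ rnorm (d - d') < r) ->
  exists e, rel_closure G d e.
Proof.
move=> h.
have /choice[u hu] : forall n, exists u : V * W,
    rel_closure G u.1 u.2 /\ rnorm (d - u.1) < rate R n.
  by move=> n; have [d' [e' hde]] := h _ (rate_gt0 n); exists (d', e').
have [|e he] := @complete_seq R W (fun n => (u n).2).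
  move=> r r0; have [|N hN] := @rate_small R (r / 2); first by rewrite divr_gt0.
  exists N => m n /rate_le Nm /rate_le Nn.
  have [[um dm] [un dn]] := (hu m, hu n).
  have := rel_closure_le (rel_closure_linear (-1) un um).
  rewrite !scaleN1r (addrC _ (u m).2) (addrC _ (u m).1) => /le_lt_trans; apply.
  have -> : (u m).1 - (u n).1 = (d - (u n).1) + - (d - (u m).1) by linear_identity.
  by apply: le_lt_trans (rnormD _ _) _; rewrite rnormN; lra.
exists e => r r0.
have [|N hN] := he (r / 2); first by rewrite divr_gt0.
have [|N' hN'] := @rate_small R (r / 2); first by rewrite divr_gt0.
pose n := (N + N')%N; have [un dn] := hu n.
have [|d' [e' [Gd dd ee]]] := un (r / 2); first by rewrite divr_gt0.
have hn := hN n (leq_addr _ _); have rn := rate_le (leq_addl N N' : (N' <= n)%N).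
exists d', e'; split => //.
  by rewrite -(subrKA (u n).1); apply: le_lt_trans (rnormD _ _) _; lra.
by rewrite -(subrKA (u n).2); apply: le_lt_trans (rnormD _ _) _; lra.
Qed.

Lemma extend_linear : closure [set d | exists e, rel_closure G d e] = setT ->
  exists f : V -> W, linear f /\ forall d e, rel_closure G d e <-> f d = e.
Proof.
move=> dense.
have /choice[f hf] : forall d, exists e, rel_closure G d e.
  move=> d; apply: rel_closure_closed => r r0.
  have : closure [set d | exists e, rel_closure G d e] d by rewrite dense.
  by move=> /closureE /(_ _ r0)[d' [e' he] hr]; exists d', e'.
exists f; split => [a x y|d e].
  by apply: rel_closure_fun (hf _) _; apply: rel_closure_linear.
split=> [h|<- //]; exact: rel_closure_fun (hf d) h.
Qed.
End Linear.

Section Star.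
Variables (V W : cstarAlgType R) (G : V -> W -> Prop).

Lemma rel_closure_mul :
  (forall d e d' e', G d e -> G d' e' -> G (d ** d') (e ** e')) ->
  forall d e d' e', rel_closure G d e -> rel_closure G d' e' ->
    rel_closure G (d ** d') (e ** e').
Proof.
move=> GM d e d' e' h h' r r0.
have [s s0 sV] := @smul_cont V d d' r r0; have [t t0 tW] := @smul_cont W e e' r r0.
have m0 : 0 < Num.min s t by rewrite lt_min s0.
have [d1 [e1 [G1 dd1 ee1]]] := h _ m0; have [d2 [e2 [G2 dd2 ee2]]] := h' _ m0.
move: dd1 ee1 dd2 ee2; rewrite !lt_min => /andP[? _] /andP[_ ?] /andP[? _] /andP[_ ?].
exists (d1 ** d2), (e1 ** e2); split; [exact: GM|exact: sV|exact: tW].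
Qed.

Lemma rel_closure_star :
  (forall d e, G d e -> G (star d) (star e)) ->
  forall d e, rel_closure G d e -> rel_closure G (star d) (star e).
Proof.
move=> GS d e h r r0; have [d1 [e1 [G1 dd1 ee1]]] := h _ r0.
exists (star d1), (star e1); split; first exact: GS.
  by rewrite -starB (csn_star (rnorm_csn V)).
by rewrite -starB (csn_star (rnorm_csn W)).
Qed.
End Star.

Record star_rel (V W : starAlgType R) (G : V -> W -> Prop) : Prop := {
  star_rel_linear : rel_linear G;
  star_rel_mul : forall d e d' e', G d e -> G d' e' -> G (d ** d') (e ** e');
  star_rel_star : forall d e, G d e -> G (star d) (star e)
}.

Lemma extend_star_hom (V W : cstarAlgType R) (G : V -> W -> Prop) :
  star_rel G -> (forall d e, G d e -> rnorm e <= rnorm d) ->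
  closure [set d | exists e, rel_closure G d e] = setT ->
  exists f : V -> W, star_hom f /\ forall d e, rel_closure G d e <-> f d = e.
Proof.
move=> [lG mG sG] Gle /(extend_linear lG Gle)[f [lf fG]]; exists f; split => //.
split=> // [x y|x]; apply/fG.
  by apply: rel_closure_mul => //; apply/fG.
by apply: rel_closure_star => //; apply/fG.
Qed.
End Extension.

(** * Matrix algebras and their vectors *)

Lemma csn_sum (R : realType) (V : starAlgType R) (p : V -> R) (I : finType) (F : I -> V) :
  cstar_seminorm p -> p (\sum_i F i) <= \sum_i p (F i).
Proof.
move=> pP; elim/big_ind2: _ => [|x a y b xa yb|//]; first by rewrite csn0.
by apply: le_trans (csnD pP _ _) _; apply: lerD.
Qed.

Lemma star_mx (R : realType) n (A : 'M[R[i]]_n) i j : (star A) i j = Num.conj (A j i).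
Proof. by rewrite !mxE. Qed.

Lemma star_delta (R : realType) n (i j : 'I_n) :
  star (delta_mx i j : 'M[R[i]]_n) = delta_mx j i.
Proof.
apply/matrixP => k l; rewrite star_mx !mxE andbC.
by case: (_ && _); rewrite ?rmorph1 ?rmorph0.
Qed.

Lemma delta_mul (R : realType) n (i j k l : 'I_n) :
  (delta_mx i j : 'M[R[i]]_n) ** delta_mx k l = if j == k then delta_mx i l else 0.
Proof. by case: eqVneq => [->|jk]; [exact: mul_delta_mx|exact: mul_delta_mx_0]. Qed.

Lemma delta_corner (R : realType) n (A : 'M[R[i]]_n) i j k l :
  delta_mx k i ** A ** delta_mx j l = A i j *: delta_mx k l.
Proof.
apply/matrixP => a b; rewrite /smul /= !mxE (bigD1 j)//= big1 => [|c cj]; last first.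
  by rewrite [delta_mx j l _ _]mxE (negPf cj) mulr0.
rewrite !mxE (bigD1 i)//= big1 => [|c ci]; last by rewrite mxE (negPf ci) andbF mul0r.
rewrite !addr0 !mxE !eqxx andbT /=.
by case: (a == k); case: (b == l); rewrite /= ?(mul1r, mulr1, mul0r, mulr0).
Qed.

Section MatrixSeminorms.
Variables (R : realType) (n : nat).
Implicit Types (A : 'M[R[i]]_n) (p q : 'M[R[i]]_n -> R).

Lemma csn_mx_le_entries p A (b : R) : cstar_seminorm p ->
  (forall i j, cabs (A i j) <= b) -> p A <= (\sum_i \sum_j p (delta_mx i j)) * b.
Proof.
move=> pP Ab; rewrite {1}(matrix_sum_delta A).
apply: le_trans (csn_sum _ pP) _; rewrite mulr_suml; apply: ler_sum => i _.
apply: le_trans (csn_sum _ pP) _; rewrite mulr_suml; apply: ler_sum => j _.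
by rewrite (csnZ pP) mulrC ler_wpM2l ?(csn_ge0 pP).
Qed.

Lemma entries_le_csn q : cstar_seminorm q -> (forall A, q A = 0 -> A = 0) ->
  exists2 C : R, 0 <= C & forall A i j, cabs (A i j) <= C * q A.
Proof.
move=> qP q0.
pose c i j := q (delta_mx i i) * q (delta_mx j j) / q (delta_mx i j).
have c0 i j : 0 <= c i j by rewrite divr_ge0 ?mulr_ge0// (csn_ge0 qP).
exists (\sum_i \sum_j c i j); first by apply: sumr_ge0 => i _; apply: sumr_ge0.
move=> A i j; apply: (@le_trans _ _ (c i j * q A)); last first.
  apply: ler_wpM2r; first exact: csn_ge0 qP _.
  rewrite (bigD1 i)//= (bigD1 j)//= -addrA lerDl addr_ge0//.
    exact: sumr_ge0.
  by apply: sumr_ge0 => k _; apply: sumr_ge0.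
have qd : 0 < q (delta_mx i j).
  rewrite lt_def (csn_ge0 qP) andbT; apply/eqP => /q0 /matrixP /(_ i j).
  by rewrite !mxE !eqxx => /eqP; rewrite oner_eq0.
rewrite /c mulrAC ler_pdivlMr// -(csnZ qP) -delta_corner.
apply: le_trans (csnM qP _ _) _; rewrite mulrAC ler_wpM2r ?(csn_ge0 qP)//.
exact: csnM qP _ _.
Qed.

(** Both p and q are equivalent to the largest modulus of an entry, and the
    constant disappears by [csn_le]. *)
Lemma csn_mx_le p q : cstar_seminorm p -> cstar_seminorm q ->
  (forall A, q A = 0 -> A = 0) -> forall A, p A <= q A.
Proof.
move=> pP qP q0; have [C C0 hC] := entries_le_csn qP q0.
apply: (@csn_le _ _ _ _ ((\sum_i \sum_j p (delta_mx i j)) * C)) => // A.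
by rewrite -mulrA; apply: csn_mx_le_entries.
Qed.

Lemma csn_mx_eq p q : cstar_seminorm p -> cstar_seminorm q ->
  (forall A, p A = 0 -> A = 0) -> (forall A, q A = 0 -> A = 0) -> forall A, p A = q A.
Proof. by move=> pP qP p0 q0 A; apply/eqP; rewrite eq_le !csn_mx_le. Qed.
End MatrixSeminorms.

Lemma conj_sum (R : realType) (I : finType) (F : I -> R[i]) :
  Num.conj (\sum_i F i) = \sum_i Num.conj (F i).
Proof. exact: rmorph_sum. Qed.

Lemma conjM (R : realType) (a b : R[i]) : Num.conj (a * b) = Num.conj a * Num.conj b.
Proof. exact: rmorphM. Qed.

Lemma conjD (R : realType) (a b : R[i]) : Num.conj (a + b) = Num.conj a + Num.conj b.
Proof. exact: rmorphD. Qed.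

Section Hilbert.
Variables (R : realType) (n : nat).
Implicit Types (x y z : 'cV[R[i]]_n) (T : 'M[R[i]]_n).

Definition dotp x y : R[i] := \sum_i x i 0 * Num.conj (y i 0).
Definition nrm2 x : R := complex.Re (dotp x x).

Lemma dotpDl x y z : dotp (x + y) z = dotp x z + dotp y z.
Proof. by rewrite -big_split; apply: eq_bigr => i _; rewrite mxE mulrDl. Qed.
Lemma dotpZl (a : R[i]) x y : dotp (a *: x) y = a * dotp x y.
Proof. by rewrite mulr_sumr; apply: eq_bigr => i _; rewrite mxE mulrA. Qed.
Lemma dotpC x y : dotp y x = Num.conj (dotp x y).
Proof.
by rewrite conj_sum; apply: eq_bigr => i _; rewrite conjM conjCK mulrC.
Qed.
Lemma dotpDr x y z : dotp z (x + y) = dotp z x + dotp z y.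
Proof. by rewrite dotpC dotpDl conjD -!dotpC. Qed.
Lemma dotpZr (a : R[i]) x y : dotp x (a *: y) = Num.conj a * dotp x y.
Proof. by rewrite dotpC dotpZl conjM -dotpC. Qed.
Lemma dotpNl x y : dotp (- x) y = - dotp x y.
Proof. by rewrite -scaleN1r dotpZl mulN1r. Qed.
Lemma dotpNr x y : dotp x (- y) = - dotp x y.
Proof. by rewrite -scaleN1r dotpZr rmorphN1 mulN1r. Qed.

Lemma dotp_adj T x y : dotp (T *m x) y = dotp x (star T *m y).
Proof.
rewrite /dotp; under eq_bigr => i _ do rewrite mxE mulr_suml.
rewrite exchange_big; apply: eq_bigr => j _ /=.
rewrite mxE conj_sum mulr_sumr; apply: eq_bigr => i _.
by rewrite star_mx conjM conjCK; ring.
Qed.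

Lemma dotpp x : dotp x x = (nrm2 x)%:C.
Proof.
by apply: nneg_realE; apply: sumr_ge0 => i _; rewrite mul_conjC_ge0.
Qed.

Lemma nrm2_ge0 x : 0 <= nrm2 x.
Proof.
by rewrite -lecR -dotpp; apply: sumr_ge0 => i _; rewrite mul_conjC_ge0.
Qed.

Lemma nrm2_eq0 x : nrm2 x = 0 -> x = 0.
Proof.
move=> x0; have : dotp x x = 0 by rewrite dotpp x0.
move/eqP; rewrite psumr_eq0 => [/allP h|i _]; last by rewrite mul_conjC_ge0.
apply/matrixP => i j; rewrite ord1 mxE.
by have := h i (mem_index_enum i); rewrite /= mul_conjC_eq0 => /eqP.
Qed.

Lemma nrm2Z (a : R[i]) x : nrm2 (a *: x) = cabs a ^+ 2 * nrm2 x.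
Proof.
apply: complexI; rewrite -dotpp dotpZl dotpZr dotpp mulrA -normCK cabsE.
by rewrite !expr2 !rcM.
Qed.

Lemma nrm2N x : nrm2 (- x) = nrm2 x.
Proof. by apply: complexI; rewrite -!dotpp dotpNl dotpNr opprK. Qed.

Lemma nrm2D x y : nrm2 (x + y) = nrm2 x + nrm2 y + 2 * complex.Re (dotp x y).
Proof.
rewrite /nrm2 dotpDl !dotpDr (dotpC x y); case: (dotp x x) => a b.
by case: (dotp y y) => c d; case: (dotp x y) => e f /=; ring.
Qed.

Lemma nrm2B x y : nrm2 (x - y) = nrm2 x + nrm2 y - 2 * complex.Re (dotp x y).
Proof.
by rewrite nrm2D nrm2N dotpNr; case: (dotp x y) => e f /=; ring.
Qed.

Lemma cauchy_schwarz x y : cabs (dotp x y) ^+ 2 <= nrm2 x * nrm2 y.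
Proof.
have [y0|y0] := eqVneq (nrm2 y) 0.
  rewrite (nrm2_eq0 y0) -(scale0r y) dotpZr conjC0 mul0r.
  by rewrite (_ : cabs 0 = 0) ?expr0n ?mulr_ge0 ?nrm2_ge0// /cabs normr0.
have yp : 0 < nrm2 y by rewrite lt_def y0 nrm2_ge0.
(* this vector is <y,y> times the component of x orthogonal to y *)
have := nrm2_ge0 ((nrm2 y)%:C *: x - dotp x y *: y).
rewrite nrm2B !nrm2Z dotpZl dotpZr -normCKC cabsE.
have ReE (r s : R) : complex.Re (r%:C * s%:C ^+ 2) = r * s ^+ 2.
  by rewrite !expr2 -!rcM.
rewrite ReE cabs_real (ger0_norm (nrm2_ge0 y)).
set c := cabs _ => h.
have : 0 <= nrm2 y * (nrm2 x * nrm2 y - c ^+ 2) by nra.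
by rewrite pmulr_rge0// subr_ge0.
Qed.

Definition nrm x : R := Num.sqrt (nrm2 x).

Lemma nrm_ge0 x : 0 <= nrm x. Proof. exact: sqrtr_ge0. Qed.
Lemma nrm_sqr x : nrm x ^+ 2 = nrm2 x. Proof. by rewrite sqr_sqrtr// nrm2_ge0. Qed.

Lemma dotp_le x y : cabs (dotp x y) <= nrm x * nrm y.
Proof.
rewrite -(@ler_pXn2r _ 2)// ?nnegrE ?cabs_ge0 ?mulr_ge0 ?nrm_ge0//.
by rewrite exprMn !nrm_sqr cauchy_schwarz.
Qed.

Lemma Re_le_cabs (a : R[i]) : complex.Re a <= cabs a.
Proof.
case: a => a b; rewrite /cabs normc_def /=; apply: le_trans (ler_norm a) _.
by rewrite -sqrtr_sqr ler_wsqrtr// lerDl sqr_ge0.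
Qed.

Lemma nrmD x y : nrm (x + y) <= nrm x + nrm y.
Proof.
rewrite -(@ler_pXn2r _ 2)// ?nnegrE ?nrm_ge0 ?addr_ge0 ?nrm_ge0//.
rewrite sqrrD !nrm_sqr nrm2D.
have := le_trans (Re_le_cabs _) (dotp_le x y); lra.
Qed.

Lemma nrmZ (a : R[i]) x : nrm (a *: x) = cabs a * nrm x.
Proof. by rewrite /nrm nrm2Z sqrtrM ?sqr_ge0// sqrtr_sqr ger0_norm ?cabs_ge0. Qed.

Lemma nrm0 : nrm 0 = 0.
Proof. by rewrite -(scale0r (0 : 'cV_n)) nrmZ /cabs normr0 mul0r. Qed.

Lemma nrmN x : nrm (- x) = nrm x.
Proof. by rewrite /nrm nrm2N. Qed.

(** T is tested on the rank one operator x x^*, whose norm is |x|^2 for every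
    C*-norm. *)
Lemma csn_mx_nrm2 (q : 'M[R[i]]_n -> R) T x : cstar_seminorm q -> (forall A, q A = 0 -> A = 0) ->
  nrm2 (T *m x) <= q T ^+ 2 * nrm2 x.
Proof.
move=> qP q0.
have [->|x0] := eqVneq x 0; first by rewrite mulmx0 /nrm2 /dotp big1 ?mulr0// => i _; rewrite mxE mul0r.
have nx : 0 < nrm2 x by rewrite lt_def nrm2_ge0 andbT; apply: contra_neq x0; apply: nrm2_eq0.
pose r1 y : 'M[R[i]]_n := y *m (map_mx Num.conj x^T).
have r1S y : star (r1 y) ** r1 y = (nrm2 y)%:C *: r1 x.
  rewrite -dotpp; apply/matrixP => i j; rewrite /smul /= !mxE.
  under eq_bigr => k _.
    rewrite star_mx !mxE !big_ord1 !mxE conjM conjCK.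
    rewrite (_ : _ * _ = (y k 0 * Num.conj (y k 0)) * (x i 0 * Num.conj (x j 0))); last by ring.
  over.
  by rewrite -mulr_suml !big_ord1 !mxE.
have qr1 y : q (r1 y) ^+ 2 = nrm2 y * q (r1 x).
  by rewrite -(csnC qP) r1S (csnZ qP) cabs_real ger0_norm// nrm2_ge0.
have qx : q (r1 x) = nrm2 x.
  have : q (r1 x) * (q (r1 x) - nrm2 x) = 0 by rewrite mulrBr -expr2 qr1 mulrC subrr.
  move/eqP; rewrite mulf_eq0 subr_eq0 => /orP[/eqP/q0|/eqP//] r0.
  have := r1S x; rewrite r0 smul0r scaler0 => _.
  have : r1 x *m x = 0 by rewrite r0 mul0mx.
  rewrite /r1 -mulmxA (_ : _ *m x = (nrm2 x)%:C%:M); last first.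
    apply/matrixP => i j; rewrite !ord1 -dotpp !mxE eqxx mulr1n.
    by apply: eq_bigr => k _; rewrite !mxE mulrC.
  rewrite mul_mx_scalar => /eqP; rewrite scaler_eq0 (negPf x0) orbF => /eqP/complexI h.
  by rewrite h ltxx in nx.
have : q (T ** r1 x) ^+ 2 <= (q T * q (r1 x)) ^+ 2.
  by rewrite ler_pXn2r// ?nnegrE ?mulr_ge0 ?(csn_ge0 qP)// (csnM qP).
rewrite [T ** _](_ : _ = r1 (T *m x)); last by rewrite /r1 -mulmxA.
by rewrite qr1 qx exprMn [X in _ <= _ * X]expr2 mulrA ler_pM2r.
Qed.

Lemma csn_mx_nrm (q : 'M[R[i]]_n -> R) T x : cstar_seminorm q -> (forall A, q A = 0 -> A = 0) ->
  nrm (T *m x) <= q T * nrm x.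
Proof.
move=> qP q0; rewrite -(@ler_pXn2r _ 2)// ?nnegrE ?mulr_ge0 ?nrm_ge0 ?(csn_ge0 qP)//.
by rewrite exprMn !nrm_sqr; apply: csn_mx_nrm2.
Qed.

Lemma dotp_delta x (i : 'I_n) : dotp x (delta_mx i 0) = x i 0.
Proof.
rewrite /dotp (bigD1 i)//= big1 => [|j ji]; rewrite mxE andbT ?eqxx ?(negPf ji) conjC_nat.
  by rewrite mulr1 addr0.
by rewrite mulr0.
Qed.

Lemma nrm_delta (i : 'I_n) : nrm (delta_mx i 0) = 1.
Proof. by rewrite /nrm /nrm2 dotp_delta mxE !eqxx sqrtr1. Qed.

(** The entries of the powers of T^* T are at most the powers of c^2, so
    [ler_root_bound] applies to p (T^* T) and c^2. *)
Lemma nrm_csn_le (p : 'M[R[i]]_n -> R) T (c : R) : cstar_seminorm p -> 0 <= c ->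
  (forall x, nrm (T *m x) <= c * nrm x) -> p T <= c.
Proof.
move=> pP c0 Tc.
have Sc x : nrm (star T *m x) <= c * nrm x.
  have [s0|s0] := eqVneq (nrm (star T *m x)) 0; first by rewrite s0 mulr_ge0 ?nrm_ge0.
  have sp : 0 < nrm (star T *m x) by rewrite lt_def s0 nrm_ge0.
  rewrite -(ler_pM2r sp) -expr2 nrm_sqr.
  have : cabs (dotp (T *m (star T *m x)) x) <= c * nrm (star T *m x) * nrm x.
    by apply: le_trans (dotp_le _ _) _; rewrite ler_wpM2r ?nrm_ge0.
  by rewrite dotp_adj dotpp cabs_real ger0_norm ?nrm2_ge0// mulrAC.
rewrite -(@ler_pXn2r _ 2)// ?nnegrE ?(csn_ge0 pP)// -(csnC pP).
apply: (@ler_root_bound _ _ _ (\sum_i \sum_j p (delta_mx i j))).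
- exact: csn_ge0 pP _.
- exact: sqr_ge0.
move=> k; rewrite -(csn_sqpow pP) ?starM ?starK//; apply: csn_mx_le_entries => // i j.
set H := star T ** T.
have Hk l x : nrm (sqpow H l *m x) <= (c ^+ 2) ^+ (2 ^ l) * nrm x.
  elim: l x => [|l IH] x /=.
    rewrite expr1 /H -mulmxA; apply: le_trans (Sc _) _; rewrite expr2 -mulrA.
    by apply: ler_wpM2l.
  rewrite -mulmxA; apply: le_trans (IH _) _.
  by rewrite expnS mul2n -addnn exprD -mulrA ler_wpM2l// exprn_ge0 ?sqr_ge0.
have -> : sqpow H k i j = dotp (sqpow H k *m delta_mx j 0) (delta_mx i 0).
  rewrite dotp_delta mxE (bigD1 j)//= big1 => [|l lj].
    by rewrite mxE !eqxx mulr1 addr0.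
  by rewrite mxE (negPf lj) mulr0.
apply: le_trans (dotp_le _ _) _; rewrite nrm_delta mulr1.
by apply: le_trans (Hk _ _) _; rewrite nrm_delta mulr1.
Qed.
End Hilbert.

(** * Block doubling and corners *)

Section Doubling.
Variables (R : realType) (m N : nat) (e : (m + m)%N = N).
Implicit Types (A B : 'M[R[i]]_m) (Z : 'M[R[i]]_N).

(** The size N is kept abstract in this section so that the casts can be
    eliminated. *)
Definition dbl A : 'M[R[i]]_N := castmx (e, e) (block_mx A 0 0 A).
Definition up A : 'M[R[i]]_N := castmx (e, e) (block_mx A 0 0 0).
Definition down Z : 'M[R[i]]_m := ulsubmx (castmx (esym e, esym e) Z).

Lemma down_dbl A : down (dbl A) = A.
Proof. by rewrite /down /dbl; case: _ / e; rewrite !castmx_id block_mxKul. Qed.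

Lemma down_up A : down (up A) = A.
Proof. by rewrite /down /up; case: _ / e; rewrite !castmx_id block_mxKul. Qed.

Lemma down_linear (a : R[i]) Z Z' : down (a *: Z + Z') = a *: down Z + down Z'.
Proof.
by rewrite /down; case: _ / e Z Z' => Z Z'; rewrite !castmx_id; apply/matrixP => i j; rewrite !mxE.
Qed.

Lemma up_star_hom : star_hom up.
Proof.
rewrite /up; case: _ / e; split=> [a A B|A B|A]; rewrite !castmx_id.
- by rewrite scale_block_mx add_block_mx !scaler0 !addr0.
- by rewrite /smul /= mulmx_block !mulmx0 !mul0mx !addr0.
- by rewrite /star /= /adjmx tr_block_mx map_block_mx !trmx0 !raddf0.
Qed.

Lemma up_down Z : up (down Z) = up 1%:M ** Z ** up 1%:M.
Proof.
rewrite /up /down; case: _ / e Z => Z; rewrite !castmx_id /smul /= -{2}[Z]submxK.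
by rewrite mulmx_block !mul1mx !mul0mx !addr0 mulmx_block !mulmx1 !mulmx0 ?mul0mx !addr0.
Qed.

(** The lower left block of an upper triangular matrix vanishes, so passing to
    the upper left corner is multiplicative on upper triangular matrices. *)
Lemma down_mul_upper Z Z' : upper_triangular Z -> upper_triangular Z' ->
  down (Z ** Z') = down Z ** down Z'.
Proof.
rewrite /down; case: _ / e Z Z' => Z Z' ZT ZT'; rewrite !castmx_id /smul /=.
rewrite -{1}[Z]submxK -{1}[Z']submxK mulmx_block block_mxKul.
suff -> : dlsubmx Z' = 0 by rewrite mulmx0 addr0.
apply/matrixP => i j; rewrite !mxE; apply: ZT' => /=.
by apply: leq_trans (ltn_ord j) _; rewrite leq_addr.
Qed.

Lemma down_upper Z : upper_triangular Z -> upper_triangular (down Z).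
Proof.
rewrite /down; case: _ / e Z => Z ZT; rewrite !castmx_id => i j ji.
by rewrite !mxE; apply: ZT.
Qed.

Lemma dbl_upper A : upper_triangular A -> upper_triangular (dbl A).
Proof.
rewrite /dbl; case: _ / e => AT; rewrite castmx_id => i j.
rewrite !mxE; case: splitP => k ik; rewrite mxE; case: splitP => l jl; rewrite ?mxE // ik jl.
- exact: AT.
- by rewrite ltn_add2l; apply: AT.
Qed.
End Doubling.

Lemma upper_linear (R : realType) n (a : R[i]) (A B : 'M[R[i]]_n) :
  upper_triangular A -> upper_triangular B -> upper_triangular (a *: A + B).
Proof. by move=> AT BT i j ji; rewrite !mxE AT// BT// mulr0 addr0. Qed.

Lemma upper_mul (R : realType) n (A B : 'M[R[i]]_n) :
  upper_triangular A -> upper_triangular B -> upper_triangular (A ** B).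
Proof.
move=> AT BT i j ji; rewrite mxE big1// => k _.
have [ki|ik] := ltnP k i; first by rewrite AT// mul0r.
by rewrite BT ?mulr0//; apply: leq_trans ik.
Qed.

Lemma upper_delta (R : realType) n (i j : 'I_n) :
  (i <= j)%N -> @upper_triangular R n (delta_mx i j).
Proof.
move=> ij k l lk; rewrite mxE; case: eqVneq => //= ki; case: eqVneq => //= lj.
by move: lk; rewrite ki lj ltnNge ij.
Qed.

Lemma upper1 (R : realType) n : @upper_triangular R n 1%:M.
Proof. by move=> i j; rewrite mxE; case: eqVneq => // ->; rewrite ltnn. Qed.

Lemma linear_map0 (R : realType) (V W : lmodType R[i]) (f : V -> W) : linear f -> f 0 = 0.
Proof. by move=> lf; have := lf (-1) 0 0; rewrite scaler0 addr0 scaleN1r addNr. Qed.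

Lemma linear_mapE (R : realType) (V W : lmodType R[i]) (f : V -> W) : linear f ->
  [/\ {morph f : x y / x + y}, forall a x, f (a *: x) = a *: f x,
      {morph f : x / - x} & {morph f : x y / x - y}].
Proof.
move=> lf; have f0 := linear_map0 lf.
have fZ a x : f (a *: x) = a *: f x by have := lf a x 0; rewrite f0 !addr0.
have fD : {morph f : x y / x + y} by move=> x y; have := lf 1 x y; rewrite !scale1r.
have fN : {morph f : x / - x} by move=> x; rewrite -scaleN1r fZ scaleN1r.
by split=> // x y; rewrite fD fN.
Qed.

Lemma real_seq_cvg (R : realType) (u : nat -> R) :
  (forall e : R, 0 < e -> exists N, forall m n, (N <= m)%N -> (N <= n)%N -> `|u m - u n| < e) ->
  exists l, forall e : R, 0 < e -> exists N, forall n, (N <= n)%N -> `|l - u n| < e.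
Proof.
move=> hu.
have /cauchy_cvg ul : cauchy (u @ \oo).
  apply/cauchyP => e e0; have [N hN] := hu e e0.
  exists (u N); exists N => // n /= Nn.
  by rewrite -ball_normE /=; apply: hN.
exists (lim (u @ \oo)) => e e0.
have /fcvgrPdist_lt := ul; move=> /(_ e e0)[N _ hN].
by exists N => n Nn; apply: hN.
Qed.

Lemma complex_seq_cvg (R : realType) (u : nat -> R[i]) :
  (forall e : R, 0 < e -> exists N, forall m n, (N <= m)%N -> (N <= n)%N -> cabs (u m - u n) < e) ->
  exists l, forall e : R, 0 < e -> exists N, forall n, (N <= n)%N -> cabs (l - u n) < e.
Proof.
move=> hu.
have cabs_re (z : R[i]) : `|complex.Re z| <= cabs z.
  case: z => a b; rewrite /cabs normc_def /= -sqrtr_sqr ler_wsqrtr// lerDl sqr_ge0//.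
have cabs_im (z : R[i]) : `|complex.Im z| <= cabs z.
  case: z => a b; rewrite /cabs normc_def /= -sqrtr_sqr ler_wsqrtr// lerDr sqr_ge0//.
have cabs_sum (a b : R) : cabs (a +i* b) <= `|a| + `|b|.
  have -> : a +i* b = a%:C + 'i%C * b%:C 
    by apply/eqP; rewrite eq_complex /=; apply/andP; split; apply/eqP; ring.
  by apply: le_trans (cabsD _ _) _; rewrite cabsM cabs_i mul1r !cabs_real.
have [|x hx] := @real_seq_cvg R (fun n => complex.Re (u n)).
  move=> e /hu[N hN]; exists N => m n Nm Nn; apply: le_lt_trans (hN m n Nm Nn).
  apply: le_trans (cabs_re _); by case: (u m) => ? ?; case: (u n).
have [|y hy] := @real_seq_cvg R (fun n => complex.Im (u n)).
  move=> e /hu[N hN]; exists N => m n Nm Nn; apply: le_lt_trans (hN m n Nm Nn).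
  apply: le_trans (cabs_im _); by case: (u m) => ? ?; case: (u n).
exists (x +i* y) => e e0.
have [|N hN] := hx (e / 2); first by rewrite divr_gt0.
have [|N' hN'] := hy (e / 2); first by rewrite divr_gt0.
exists (N + N')%N => n Nn.
have := hN n (leq_trans (leq_addr _ _) Nn); have := hN' n (leq_trans (leq_addl _ _) Nn).
case: (u n) => a b /= h h'; apply: le_lt_trans (cabs_sum _ _) _; lra.
Qed.

(** * The UHF algebra and its compressions *)

Section Uhf.
Variables (R : realType) (M : cstarAlgType R).
Variable phi : forall n, 'M[R[i]]_(2 ^ n.+1) -> M.
Arguments phi : clear implicits.
Hypothesis hM : is_uhf2 phi.
Let P := rnorm_csn M.

Lemma phi_linear n : linear (@phi n). Proof. by have [] := uhf2_hom hM n. Qed.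
Lemma phiM n (A B : 'M[R[i]]_(2 ^ n.+1)) : phi n (A ** B) = phi n A ** phi n B.
Proof. by have [] := uhf2_hom hM n. Qed.
Lemma phi_star n (A : 'M[R[i]]_(2 ^ n.+1)) : phi n (star A) = star (phi n A).
Proof. by have [] := uhf2_hom hM n. Qed.
Lemma phi0 n : phi n 0 = 0. Proof. exact: linear_map0 (@phi_linear n). Qed.
Lemma phiD n (A B : 'M[R[i]]_(2 ^ n.+1)) : phi n (A + B) = phi n A + phi n B.
Proof. by have [] := linear_mapE (@phi_linear n). Qed.
Lemma phiB n (A B : 'M[R[i]]_(2 ^ n.+1)) : phi n (A - B) = phi n A - phi n B.
Proof. by have [] := linear_mapE (@phi_linear n). Qed.
Lemma phiZ n a (A : 'M[R[i]]_(2 ^ n.+1)) : phi n (a *: A) = a *: phi n A.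
Proof. by have [] := linear_mapE (@phi_linear n). Qed.

Lemma phi_csn n : cstar_seminorm (fun A : 'M[R[i]]_(2 ^ n.+1) => rnorm (phi n A)).
Proof. exact: csn_comp (uhf2_hom hM n) P. Qed.

Lemma phi_csn0 n (A : 'M[R[i]]_(2 ^ n.+1)) : rnorm (phi n A) = 0 -> A = 0.
Proof. by move=> /rnorm0_eq0; rewrite -(phi0 n) => /(uhf2_inj hM). Qed.

Notation e2 n := (expn2SD n.+1).

Lemma phi_dbl n (A : 'M[R[i]]_(2 ^ n.+1)) : phi n.+1 (dbl (e2 n) A) = phi n A.
Proof. exact: uhf2_compat hM n A. Qed.

Lemma dblM n (A B : 'M[R[i]]_(2 ^ n.+1)) : dbl (e2 n) (A ** B) = dbl (e2 n) A ** dbl (e2 n) B.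
Proof. by apply: (uhf2_inj hM (n := n.+1)); rewrite phiM !phi_dbl phiM. Qed.

Lemma dbl_linear n : linear (@dbl R _ _ (e2 n)).
Proof.
by move=> a A B; apply: (uhf2_inj hM (n := n.+1)); rewrite phiD phiZ !phi_dbl phiD phiZ.
Qed.

(** The embeddings of a matrix algebra by A (+) 0 and by A (+) A induce the
    same norm, because its C*-norm is unique. *)
Lemma phi_up n (A : 'M[R[i]]_(2 ^ n.+1)) : rnorm (phi n.+1 (up (e2 n) A)) = rnorm (phi n A).
Proof.
apply: (csn_mx_eq (p := fun A => rnorm (phi n.+1 (up (e2 n) A))) (q := fun A => rnorm (phi n A))).
- exact: csn_comp (up_star_hom R (e2 n)) (phi_csn n.+1).
- exact: phi_csn.
- move=> B /phi_csn0 uB; rewrite -(down_up (e2 n) B) uB -(down_up (e2 n) 0).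
  congr (down _ _); apply/esym/linear_map0.
  by have [] := up_star_hom R (e2 n).
- exact: phi_csn0.
Qed.

Lemma csn_proj (V : starAlgType R) (p : V -> R) (x : V) : cstar_seminorm p ->
  star x ** x = x -> p x <= 1.
Proof.
move=> pP xx; have := csnC pP x; rewrite xx => h.
have := csn_ge0 pP x; rewrite le_eqVlt => /orP[/eqP <- //|x0].
by rewrite -(ler_pM2l x0) -expr2 -h mulr1.
Qed.

(** The corner is the compression by a projection, up to the isometry of
    [phi_up]. *)
Lemma phi_down n Z : rnorm (phi n (down (e2 n) Z)) <= rnorm (phi n.+1 Z).
Proof.
rewrite -phi_up up_down !phiM; set f := phi _ (up _ _).
have f1 : rnorm f <= 1.
  apply: (csn_proj P); rewrite -phi_star -phiM.
  have [_ uM uS] := up_star_hom R (e2 n); rewrite -uS -uM; congr (phi _ (up _ _)).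
  apply/matrixP => i j; rewrite /smul /= mulmx1 star_mx !mxE eq_sym.
  by case: eqP => _; rewrite /= ?conjC1 ?conjC0.
apply: le_trans (csnM P _ _) _; apply: le_trans (_ : rnorm f * rnorm (phi n.+1 Z) * rnorm f <= _).
  by rewrite ler_wpM2r ?rnorm_ge0// (csnM P).
have mul3 (a b : R) : 0 <= a -> a <= 1 -> 0 <= b -> a * b * a <= b.
  move=> a0 a1 b0; have ab : a * b <= b by rewrite ler_piMl.
  by apply: le_trans ab; rewrite ler_piMr// mulr_ge0.
by apply: mul3 => //; apply: rnorm_ge0.
Qed.

Definition lev n : set M := range (@phi n).
Definition ulev n : set M := phi n @` @upper_triangular R (2 ^ n.+1).

Lemma lev_le m n x : (m <= n)%N -> lev m x -> lev n x.
Proof.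
move=> /subnK <-; elim: (n - m)%N => // k IH /IH[A _ <-].
by exists (dbl (e2 _) A) => //; apply: phi_dbl.
Qed.

Lemma ulev_le m n x : (m <= n)%N -> ulev m x -> ulev n x.
Proof.
move=> /subnK <-; elim: (n - m)%N => // k IH /IH[A AT <-].
by exists (dbl (e2 _) A); [apply: dbl_upper|apply: phi_dbl].
Qed.

Lemma lev_lin n a x y : lev n x -> lev n y -> lev n (a *: x + y).
Proof. by move=> [A _ <-] [B _ <-]; exists (a *: A + B) => //; apply: phi_linear. Qed.
Lemma ulev_lin n a x y : ulev n x -> ulev n y -> ulev n (a *: x + y).
Proof.
move=> [A AT <-] [B BT <-]; exists (a *: A + B); last exact: phi_linear.
exact: upper_linear.
Qed.
Lemma lev_mul n x y : lev n x -> lev n y -> lev n (x ** y).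
Proof. by move=> [A _ <-] [B _ <-]; exists (A ** B) => //; apply: phiM. Qed.
Lemma lev_star n x : lev n x -> lev n (star x).
Proof. by move=> [A _ <-]; exists (star A) => //; apply: phi_star. Qed.
Lemma ulev_mul n x y : ulev n x -> ulev n y -> ulev n (x ** y).
Proof.
by move=> [A AT <-] [B BT <-]; exists (A ** B); [apply: upper_mul|apply: phiM].
Qed.
Lemma ulev_lev n x : ulev n x -> lev n x.
Proof. by move=> [A _ <-]; exists A. Qed.

Lemma lev_dense x (r : R) : 0 < r -> exists n y, lev n y /\ rnorm (x - y) < r.
Proof.
move=> r0; have : closure (\bigcup_n range (@phi n)) x by rewrite (uhf2_dense hM).
by move=> /closureE /(_ r r0)[y [n _ yn] xy]; exists n, y.
Qed.

Let A := tuhf2 phi.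

Lemma ulev_dense x (r : R) : A x -> 0 < r -> exists n y, ulev n y /\ rnorm (x - y) < r.
Proof.
by move=> /closureE Ax r0; have [y [n _ yn] xy] := Ax r r0; exists n, y.
Qed.

Lemma tuhfE x : A x <-> forall r : R, 0 < r -> exists n y, ulev n y /\ rnorm (x - y) < r.
Proof.
split=> [Ax r r0|h]; first exact: ulev_dense.
by apply/closureE => r /h[n [y [yn xy]]]; exists y => //; exists n.
Qed.

Lemma ulev_tuhf n x : ulev n x -> A x.
Proof. by move=> xn; apply/tuhfE => r r0; exists n, x; rewrite subrr rnorm0. Qed.

Lemma tuhf_lin (a : R[i]) x y : A x -> A y -> A (a *: x + y).
Proof.
move=> Ax Ay; apply/tuhfE => r r0.
have [s s0 sV] := @linear_cont R M a r r0.
have [m [x' [xm xx]]] := ulev_dense Ax s0; have [n [y' [yn yy]]] := ulev_dense Ay s0.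
exists (m + n)%N, (a *: x' + y'); split; last exact: sV.
by apply: ulev_lin; [apply: ulev_le xm; rewrite leq_addr|apply: ulev_le yn; rewrite leq_addl].
Qed.

Lemma tuhf_mul x y : A x -> A y -> A (x ** y).
Proof.
move=> Ax Ay; apply/tuhfE => r r0.
have [s s0 sV] := @smul_cont R M x y r r0.
have [m [x' [xm xx]]] := ulev_dense Ax s0; have [n [y' [yn yy]]] := ulev_dense Ay s0.
exists (m + n)%N, (x' ** y'); split; last exact: sV.
by apply: ulev_mul; [apply: ulev_le xm; rewrite leq_addr|apply: ulev_le yn; rewrite leq_addl].
Qed.

Definition unit1 : M := phi 0 1%:M.

Lemma phi1 n : phi n 1%:M = unit1.
Proof.
elim: n => // n <-; rewrite -[RHS]phi_dbl; congr (phi _ _).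
by rewrite /dbl; case: _ / (e2 n); rewrite castmx_id -scalar_mx_block.
Qed.

Lemma unit1l x : unit1 ** x = x.
Proof.
apply/subr0_eq/rnorm_eq0_eps => r r0.
have [|s s0 sV] := @smul_cont R M unit1 x (r / 2); first by rewrite divr_gt0.
have [|n [y [[B _ By] xy]]] := @lev_dense x (Num.min s (r / 2)).
  by rewrite lt_min s0 divr_gt0.
move: xy; rewrite lt_min => /andP[xs xr].
have h := sV unit1 y; rewrite subrr rnorm0 in h; have {}h := h s0 xs.
have uy : unit1 ** y = y by rewrite -By -(phi1 n) -phiM /smul /= mul1mx.
rewrite -(subrKA (unit1 ** y)) {2}uy; apply: le_trans (rnormD _ _) _.
by rewrite (rnormB y); lra.
Qed.

Lemma unit1_ulev n : ulev n unit1.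
Proof. by exists 1%:M; [apply: upper1|apply: phi1]. Qed.

Lemma expn_gt0_succ n : (0 < 2 ^ n.+1)%N. Proof. by rewrite expn_gt0. Qed.

Lemma unit1_neq0 : unit1 <> 0.
Proof.
rewrite -(phi0 0) => /(uhf2_inj hM)/matrixP /(_ ord0 ord0); rewrite !mxE eqxx => /eqP.
by rewrite oner_eq0.
Qed.

Fixpoint downs n k : 'M[R[i]]_(2 ^ (k + n).+1) -> 'M[R[i]]_(2 ^ n.+1) :=
  match k with
  | 0 => fun Z => Z
  | k'.+1 => fun Z => downs (down (e2 (k' + n)) Z)
  end.

Lemma downs_linear n k : linear (@downs n k).
Proof.
by elim: k => // k IH a Z Z'; rewrite [LHS]/= down_linear IH.
Qed.

Lemma phi_downs n k Z : rnorm (phi n (@downs n k Z)) <= rnorm (phi (k + n) Z).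
Proof. by elim: k Z => // k IH Z; apply: le_trans (IH _) (phi_down _). Qed.

Lemma downs_mul n k Z Z' : upper_triangular Z -> upper_triangular Z' ->
  @downs n k (Z ** Z') = downs Z ** downs Z'.
Proof.
elim: k Z Z' => // k IH Z Z' ZT ZT'.
by rewrite [LHS]/= down_mul_upper// IH//; apply: down_upper.
Qed.

Lemma downs_lift n k k' Z : (k <= k')%N -> exists Z',
  phi (k' + n) Z' = phi (k + n) Z /\ @downs n k' Z' = @downs n k Z.
Proof.
move=> /subnK <-; elim: (k' - k)%N => [|j [Z' [h1 h2]]]; first by exists Z.
by exists (dbl (e2 _) Z'); rewrite -h1 -h2 /= down_dbl; split=> //; apply: phi_dbl.
Qed.

Definition rho_rel n (x y : M) := exists k Z, x = phi (k + n) Z /\ y = phi n (downs Z).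

(** Block doubling does not change the upper left corner, so the corners of
    the levels above n fit together to a contraction of M onto level n. *)
Lemma rho_exists n : exists f : M -> M, linear f /\ (forall x y, rel_closure (rho_rel n) x y <-> f x = y).
Proof.
apply: extend_linear.
- move=> a x y x' y' [k [Z [-> ->]]] [k' [Z' [-> ->]]].
  have [Z1 [<- <-]] := downs_lift Z (leq_addr k' k).
  have [Z2 [<- <-]] := downs_lift Z' (leq_addl k k').
  by exists (k + k')%N, (a *: Z1 + Z2); rewrite downs_linear !phi_linear.
- by move=> x y [k [Z [-> ->]]]; apply: phi_downs.
- rewrite -subTset => x _; apply/closureE => r r0.
  have [m [y [ym xy]]] := lev_dense x r0; exists y => //.
  have [Z _ Zy] := lev_le (leq_addr n m) ym.
  by exists (phi n (downs Z)); apply: sub_rel_closure; exists m, Z.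
Qed.

Definition rho n : M -> M := projT1 (cid (rho_exists n)).

Lemma rho_linear n : linear (rho n).
Proof. by rewrite /rho; case: cid => f []. Qed.

Lemma rhoE n x y : rel_closure (rho_rel n) x y <-> rho n x = y.
Proof. by rewrite /rho; case: cid => f []. Qed.

Lemma rho_phi n k Z : rho n (phi (k + n) Z) = phi n (downs Z).
Proof. by apply/rhoE/sub_rel_closure; exists k, Z. Qed.

Lemma rho_le n x : rnorm (rho n x) <= rnorm x.
Proof.
apply: (@rel_closure_le _ _ _ (rho_rel n)); last exact/rhoE.
by move=> d e [k [Z [-> ->]]]; apply: phi_downs.
Qed.

Lemma rhoB n x y : rho n (x - y) = rho n x - rho n y.
Proof. by have [] := linear_mapE (@rho_linear n). Qed.

Lemma rho_lev n x : lev n x -> rho n x = x.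
Proof. by move=> [Z _ <-]; rewrite -[phi n Z]/(phi (0 + n) Z) rho_phi. Qed.

(** The map rho n is the identity on level n, and the levels are dense. *)
Lemma rho_cvg x (r : R) : 0 < r -> exists N, forall n, (N <= n)%N -> rnorm (x - rho n x) < r.
Proof.
move=> r0; have [|m [y [ym xy]]] := @lev_dense x (r / 2); first by rewrite divr_gt0.
exists m => n mn; have yn := rho_lev (lev_le mn ym).
have -> : x - rho n x = (x - y) - rho n (x - y) by rewrite rhoB yn; linear_identity.
apply: le_lt_trans (csnB P _ _) _; have := rho_le n (x - y); lra.
Qed.

(** On triangular matrices the corner map is multiplicative by
    [down_mul_upper]; the rest is continuity. *)
Lemma rho_mul n x y : A x -> A y -> rho n (x ** y) = rho n x ** rho n y.
Proof.
move=> Ax Ay; apply/subr0_eq/rnorm_eq0_eps => r r0.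
have r2 : 0 < r / 2 by rewrite divr_gt0.
have [s s0 sV] := @smul_cont R M x y (r / 2) r2.
have [t t0 tV] := @smul_cont R M (rho n x) (rho n y) (r / 2) r2.
have m0 : 0 < Num.min s t by rewrite lt_min s0.
have [k [x' [xk]]] := ulev_dense Ax m0; have [l [y' [yl]]] := ulev_dense Ay m0.
rewrite !lt_min => /andP[ys yt] /andP[xs xt].
have [Z ZT Zx] : ulev (k + l + n)%N x'.
  by apply: ulev_le xk; rewrite -addnA leq_addr.
have [Z' ZT' Zy] : ulev (k + l + n)%N y'.
  by apply: ulev_le yl; rewrite addnAC leq_addl.
have h : rho n (x' ** y') = rho n x' ** rho n y'.
  by rewrite -Zx -Zy -phiM !rho_phi downs_mul// phiM.
have -> : rho n (x ** y) - rho n x ** rho n y =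
   rho n (x ** y - x' ** y') - (rho n x ** rho n y - rho n x' ** rho n y').
  by rewrite rhoB h; linear_identity.
apply: le_trans (csnB P _ _) _.
have := rho_le n (x ** y - x' ** y'); have := sV _ _ xs ys.
have rle a b : rnorm (rho n a - rho n b) <= rnorm (a - b) by rewrite -rhoB rho_le.
have := tV _ _ (le_lt_trans (rle _ _) xt) (le_lt_trans (rle _ _) yt).
lra.
Qed.

(** Finite-dimensional subspaces are closed: the matrix entries are bounded by
    the norm, hence converge. *)
Lemma lev_closed n x : (forall r : R, 0 < r -> exists2 y, lev n y & rnorm (x - y) < r) -> lev n x.
Proof.
move=> h.
have /choice[B hB] : forall k, exists B, rnorm (x - phi n B) < rate R k.
  by move=> k; have [y [B _ <-] xy] := h _ (rate_gt0 R k); exists B.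
have [C C0 hC] := entries_le_csn (phi_csn n) (@phi_csn0 n).
have /choice[L hL] : forall ij : 'I_(2 ^ n.+1) * 'I_(2 ^ n.+1), exists l, forall e : R, 0 < e ->
    exists N, forall k, (N <= k)%N -> cabs (l - B k ij.1 ij.2) < e.
  move=> [i j]; apply: (@complex_seq_cvg R (fun k => B k i j)) => e e0.
  have C1 : 0 < C + 1 by lra.
  have [|N hN] := @rate_small R (e / (2 * (C + 1))); first by rewrite divr_gt0// mulr_gt0.
  exists N => k l /(rate_le R) Nk /(rate_le R) Nl.
  have := hC (B k - B l) i j; rewrite !mxE => /le_lt_trans; apply.
  have : rnorm (phi n (B k - B l)) < 2 * rate R N.
    rewrite phiB (_ : _ - _ = (x - phi n (B l)) - (x - phi n (B k))); last by linear_identity.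
    apply: le_lt_trans (csnB P _ _) _; have := hB k; have := hB l; lra.
  move: hN; rewrite ltr_pdivlMr ?mulr_gt0//.
  have := rnorm_ge0 (phi n (B k - B l)).
  move: (rnorm _) (rate R N) => a b a0 hb ab; nra.
exists (\matrix_(i, j) L (i, j)) => //.
apply/esym/subr0_eq/rnorm_eq0_eps => r r0.
pose S := \sum_i \sum_j rnorm (phi n (delta_mx i j)).
have S0 : 0 <= S by apply: sumr_ge0 => i _; apply: sumr_ge0 => j _; apply: rnorm_ge0.
have [N1 hN1] : exists N, forall k, (N <= k)%N -> forall i j, cabs (L (i, j) - B k i j) < r / (2 * (S + 1)).
  have q0 : 0 < r / (2 * (S + 1)) by rewrite divr_gt0// mulr_gt0//; lra.
  have /choice[Nf hNf] : forall ij, exists N, forall k, (N <= k)%N -> cabs (L ij - B k ij.1 ij.2) < r / (2 * (S + 1)).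
    by move=> ij; apply: hL.
  exists (\sum_ij Nf ij)%N => k Nk i j; apply: (hNf (i, j)).
  by apply: leq_trans Nk; rewrite (bigD1 (i, j))//= leq_addr.
have [|N2 hN2] := @rate_small R (r / 2); first by rewrite divr_gt0.
pose k := (N1 + N2)%N.
rewrite -(subrKA (phi n (B k))) -phiB; apply: le_trans (rnormD _ _) _.
have h1 : rnorm (phi n (B k - \matrix_(i, j) L (i, j))) <= r / 2.
  apply: le_trans (csn_mx_le_entries (b := r / (2 * (S + 1))) (phi_csn n) _) _.
    by move=> i j; rewrite !mxE -cabsN opprB; apply/ltW/hN1; rewrite leq_addr.
  rewrite -/S mulrCA ler_pM2l// ler_pdivrMr; last by rewrite mulr_gt0//; lra.
  lra.
have := hB k; have := rate_le R (leq_addl N1 N2 : (N2 <= k)%N); lra.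
Qed.

Lemma rho_range n x : lev n (rho n x).
Proof.
apply: lev_closed => r r0; have [m [y [ym xy]]] := lev_dense x r0.
have [Z _ Zy] := lev_le (leq_addr n m) ym.
exists (rho n y); first by rewrite -Zy rho_phi; exists (downs Z).
by rewrite -rhoB; apply: le_lt_trans (rho_le _ _) xy.
Qed.
End Uhf.

(** * C*-algebras of bounded sequences *)

Lemma seq_complete_cauchy_cvg (R : realType) (V : normedModType R[i]) :
  (forall u : nat -> V, (forall e : R, 0 < e -> exists N, forall m n, (N <= m)%N -> (N <= n)%N ->
       rnorm (u m - u n) < e) ->
    exists l, forall e : R, 0 < e -> exists N, forall n, (N <= n)%N -> rnorm (l - u n) < e) ->
  forall F : set_system V, ProperFilter F -> cauchy F -> cvg F.
Proof.
move=> h F FF Fc.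
have rC n : 0 < (rate R n)%:C :> R[i] by rewrite ltcR rate_gt0.
have /choice[u hu] : forall n, exists x, F (ball x (rate R n)%:C).
  by move=> n; have /cauchyP /(_ _ (rC n)) := Fc.
have ballE (x y : V) (r : R) : ball x r%:C y = (rnorm (x - y) < r).
  by rewrite -ball_normE /= rnormE ltcR.
have close m n : rnorm (u m - u n) < rate R m + rate R n.
  have [y [ym yn]] := filter_ex (filterI (hu m) (hu n)).
  move: ym yn; rewrite !ballE => ym yn.
  rewrite -(subrKA y); apply: le_lt_trans (rnormD _ _) _; rewrite [X in _ + X]rnormB; lra.
have [|l hl] := h u.
  move=> e e0; have [|N hN] := @rate_small R (e / 2); first by rewrite divr_gt0.
  exists N => m n /(rate_le R) Nm /(rate_le R) Nn.
  by apply: lt_le_trans (close m n) _; lra.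
apply/cvg_ex; exists l; apply/cvg_ballP => e e0.
have ee : e = (complex.Re e)%:C by apply: nneg_realE; apply: ltW.
have r0 : 0 < complex.Re e by rewrite -ltcR -ee.
have [|N hN] := hl (complex.Re e / 2); first by rewrite divr_gt0.
have [|N' hN'] := @rate_small R (complex.Re e / 2); first by rewrite divr_gt0.
pose n := (N + N')%N; apply: filterS (hu n) => y.
rewrite ee !ballE => un; rewrite -(subrKA (u n)).
apply: le_lt_trans (rnormD _ _) _; have := hN n (leq_addr _ _).
have := rate_le R (leq_addl N N' : (N' <= n)%N); lra.
Qed.

Section SequenceAlgebras.
Variables (R : realType) (M : cstarAlgType R).

Definition bounded_seq (f : nat -> M) := exists c : R, forall n, rnorm (f n) <= c.

(** The norm-closed star subalgebras of the bounded sequences in M. *)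
Record seq_calg := SeqCalg {
  scar : set (nat -> M);
  scar0 : scar (fun=> 0);
  scar_lin : forall (a : R[i]) f g, scar f -> scar g -> scar (fun n => a *: f n + g n);
  scar_mul : forall f g, scar f -> scar g -> scar (fun n => f n ** g n);
  scar_star : forall f, scar f -> scar (fun n => star (f n));
  scar_bounded : forall f, scar f -> bounded_seq f;
  scar_closed : forall f, (forall e : R, 0 < e -> exists2 g, scar g & forall n, rnorm (f n - g n) <= e) ->
    scar f
}.

Variable S : seq_calg.

Definition sqalg : Type := {f : nat -> M | scar S f}.
Definition coord (x : sqalg) : nat -> M := sval x.
Implicit Types x y z : sqalg.

Lemma coordP x : scar S (coord x). Proof. exact: svalP. Qed.

Lemma sqalg_eq x y : (forall n, coord x n = coord y n) -> x = y.
Proof.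
case: x y => [f fS] [g gS] /= h; have fg : f = g by apply: funext.
by move: fS gS; rewrite fg => fS gS; congr exist; apply: Prop_irrelevance.
Qed.

HB.instance Definition _ := gen_eqMixin sqalg.
HB.instance Definition _ := gen_choiceMixin sqalg.

Lemma scar_addr f g : scar S f -> scar S g -> scar S (fun n => f n + g n).
Proof.
move=> fS gS; have := scar_lin 1 fS gS; congr (scar S _).
by apply: funext => n; rewrite scale1r.
Qed.
Lemma scar_scale a f : scar S f -> scar S (fun n => a *: f n).
Proof.
move=> fS; have := scar_lin a fS (scar0 S); congr (scar S _).
by apply: funext => n; rewrite addr0.
Qed.
Lemma scar_opp f : scar S f -> scar S (fun n => - f n).
Proof.
move=> /(scar_scale (-1)); congr (scar S _).
by apply: funext => n; rewrite scaleN1r.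
Qed.

Definition sq_zero : sqalg := exist _ _ (scar0 S).
Definition sq_add x y : sqalg := exist _ _ (scar_addr (coordP x) (coordP y)).
Definition sq_opp x : sqalg := exist _ _ (scar_opp (coordP x)).
Definition sq_scale a x : sqalg := exist _ _ (scar_scale a (coordP x)).
Definition sq_mul x y : sqalg := exist _ _ (scar_mul (coordP x) (coordP y)).
Definition sq_star x : sqalg := exist _ _ (scar_star (coordP x)).

Lemma sq_addA : associative sq_add.
Proof. by move=> x y z; apply: sqalg_eq => n; apply: addrA. Qed.
Lemma sq_addC : commutative sq_add.
Proof. by move=> x y; apply: sqalg_eq => n; apply: addrC. Qed.
Lemma sq_add0 : left_id sq_zero sq_add.
Proof. by move=> x; apply: sqalg_eq => n; apply: add0r. Qed.
Lemma sq_addN : left_inverse sq_zero sq_opp sq_add.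
Proof. by move=> x; apply: sqalg_eq => n; apply: addNr. Qed.
HB.instance Definition _ := GRing.isZmodule.Build sqalg sq_addA sq_addC sq_add0 sq_addN.

Lemma sq_scaleA a b x : sq_scale a (sq_scale b x) = sq_scale (a * b) x.
Proof. by apply: sqalg_eq => n; apply: scalerA. Qed.
Lemma sq_scale1 : left_id 1 sq_scale.
Proof. by move=> x; apply: sqalg_eq => n; apply: scale1r. Qed.
Lemma sq_scaleDr : right_distributive sq_scale +%R.
Proof. by move=> a x y; apply: sqalg_eq => n; apply: scalerDr. Qed.
Lemma sq_scaleDl x : {morph sq_scale^~ x : a b / a + b}.
Proof. by move=> a b; apply: sqalg_eq => n; apply: scalerDl. Qed.
HB.instance Definition _ := GRing.Zmodule_isLmodule.Build R[i] sqalg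
  sq_scaleA sq_scale1 sq_scaleDr sq_scaleDl.

Lemma sq_mulA : associative sq_mul.
Proof. by move=> x y z; apply: sqalg_eq => n; apply: smulA. Qed.
Lemma sq_mulDl : left_distributive sq_mul +%R.
Proof. by move=> x y z; apply: sqalg_eq => n; apply: smulDl. Qed.
Lemma sq_mulDr : right_distributive sq_mul +%R.
Proof. by move=> x y z; apply: sqalg_eq => n; apply: smulDr. Qed.
Lemma sq_mulZl (a : R[i]) x y : sq_mul (a *: x) y = a *: sq_mul x y.
Proof. by apply: sqalg_eq => n; apply: smulZl. Qed.
Lemma sq_mulZr (a : R[i]) x y : sq_mul x (a *: y) = a *: sq_mul x y.
Proof. by apply: sqalg_eq => n; apply: smulZr. Qed.
Lemma sq_starK : involutive sq_star.
Proof. by move=> x; apply: sqalg_eq => n; apply: starK. Qed.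
Lemma sq_starD : {morph sq_star : x y / x + y}.
Proof. by move=> x y; apply: sqalg_eq => n; apply: starD. Qed.
Lemma sq_starZ (a : R[i]) x : sq_star (a *: x) = Num.conj a *: sq_star x.
Proof. by apply: sqalg_eq => n; apply: starZ. Qed.
Lemma sq_starM x y : sq_star (sq_mul x y) = sq_mul (sq_star y) (sq_star x).
Proof. by apply: sqalg_eq => n; apply: starM. Qed.
HB.instance Definition _ := @Lmodule_isStarAlgebra.Build R sqalg
  sq_mul sq_star sq_mulA sq_mulDl sq_mulDr sq_mulZl sq_mulZr
  sq_starK sq_starD sq_starZ sq_starM.

Let P := rnorm_csn M.

Lemma coord_star_hom n : star_hom (coord^~ n).
Proof. by []. Qed.

Definition sup_norm : sqalg -> R := csn_sup (fun n x => rnorm (coord x n)).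

Lemma coord_csn n : cstar_seminorm (fun x => rnorm (coord x n)).
Proof. exact: csn_comp (coord_star_hom n) P. Qed.

Lemma coord_bounded x : exists c : R, forall n, rnorm (coord x n) <= c.
Proof. exact: scar_bounded (coordP x). Qed.

Lemma le_sup_norm x n : rnorm (coord x n) <= sup_norm x.
Proof. exact: (le_csn_sup coord_bounded x n). Qed.

Lemma sup_norm_le x (c : R) : (forall n, rnorm (coord x n) <= c) -> sup_norm x <= c.
Proof. exact: (csn_sup_le 0%N). Qed.

Lemma sup_norm_csn : cstar_seminorm sup_norm.
Proof. exact: (@csn_supP _ _ _ 0%N (fun n x => rnorm (coord x n)) coord_csn coord_bounded). Qed.

Lemma sup_norm_eq0 x : sup_norm x = 0 -> x = 0.
Proof.
move=> x0; apply: sqalg_eq => n; apply: rnorm0_eq0.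
exact: (@csn_sup_eq0 _ _ _ (fun n x => rnorm (coord x n)) coord_csn coord_bounded x x0 n).
Qed.

Let N : is_cstar_norm (fun x => (sup_norm x)%:C) := csn_csn_norm sup_norm_csn sup_norm_eq0.

HB.instance Definition _ := Lmodule_isNormed.Build R[i] sqalg
  (cstar_normD N) (cstar_normZ N) (cstar_norm_eq0 N).

Lemma rnorm_sqalg x : rnorm x = sup_norm x. Proof. by []. Qed.

Lemma sqalg_seq_complete (u : nat -> sqalg) :
  (forall e : R, 0 < e -> exists N, forall m n, (N <= m)%N -> (N <= n)%N -> rnorm (u m - u n) < e) ->
  exists l, forall e : R, 0 < e -> exists N, forall n, (N <= n)%N -> rnorm (l - u n) < e.
Proof.
move=> hu.
have cu e : 0 < e -> exists N, forall m n k, (N <= m)%N -> (N <= n)%N ->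
    rnorm (coord (u m) k - coord (u n) k) < e.
  move=> /hu[K hK]; exists K => m n k Km Kn.
  exact: le_lt_trans (le_sup_norm (u m - u n) k) (hK _ _ Km Kn).
have /choice[l hl] : forall k, exists l, forall e : R, 0 < e ->
    exists N, forall n, (N <= n)%N -> rnorm (l - coord (u n) k) < e.
  move=> k; apply: (@complete_seq R M (fun n => coord (u n) k)) => e /cu[K hK].
  by exists K => m n Km Kn; apply: hK.
have ul e : 0 < e -> exists N, forall n, (N <= n)%N -> forall k, rnorm (l k - coord (u n) k) <= e.
  move=> /cu[K hK]; exists K => n Kn k; apply: ltr_eps => r /(hl k)[K' hK'].
  rewrite -(subrKA (coord (u (K + K')%N) k)); apply: le_trans (rnormD _ _) _.
  have := hK' (K + K')%N (leq_addl _ _); have := hK _ _ k (leq_addr K' K) Kn; lra.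
have lS : scar S l.
  apply: scar_closed => e /ul[K hK]; exists (coord (u K)); first exact: coordP.
  exact: hK.
exists (exist _ l lS) => e e0; have [|K hK] := ul (e / 2); first by rewrite divr_gt0.
exists K => n Kn; rewrite rnorm_sqalg; apply: le_lt_trans (_ : e / 2 < e); last by lra.
by apply: sup_norm_le => k; apply: hK.
Qed.

HB.instance Definition _ := Uniform_isComplete.Build sqalg
  (seq_complete_cauchy_cvg sqalg_seq_complete).

HB.instance Definition _ := StarAlgebra_isCStar.Build R sqalg
  (cstar_normM N) (cstar_norm_starM N).

End SequenceAlgebras.

(** * Kronecker products *)

Notation "A *t B" := (tensmx A B)
  (at level 40, left associativity, format "A  *t  B") : ring_scope.

(** Entries indexed by natural numbers and equal to 0 outside the matrix. They
    are insensitive to casts, and turn statements about block matrices and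
    Kronecker products into arithmetic of quotients and remainders. *)
Definition ent (R : realType) m (A : 'M[R[i]]_m) (i j : nat) : R[i] :=
  if insub i is Some a then if insub j is Some b then A a b else 0 else 0.

Lemma entE (R : realType) m (A : 'M[R[i]]_m) (a b : 'I_m) : ent A a b = A a b.
Proof. by rewrite /ent !valK. Qed.

Lemma ent_inj (R : realType) m (A B : 'M[R[i]]_m) :
  (forall i j, ent A i j = ent B i j) -> A = B.
Proof. by move=> h; apply/matrixP => i j; rewrite -!entE h. Qed.

Lemma ent_out (R : realType) m (A : 'M[R[i]]_m) (i j : nat) :
  (m <= i)%N || (m <= j)%N -> ent A i j = 0.
Proof.
rewrite /ent => /orP[mi|mj]; first by rewrite insubF// ltnNge mi.
by case: insub => // a; rewrite insubF// ltnNge mj.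
Qed.

Lemma ent_in (R : realType) m (A : 'M[R[i]]_m) (i j : nat) (hi : (i < m)%N) (hj : (j < m)%N) :
  ent A i j = A (Ordinal hi) (Ordinal hj).
Proof. exact: (entE A (Ordinal hi) (Ordinal hj)). Qed.

Lemma ent_cast (R : realType) m N (e : m = N) (A : 'M[R[i]]_m) i j :
  ent (castmx (e, e) A) i j = ent A i j.
Proof. by case: _ / e; rewrite castmx_id. Qed.

Lemma ent_block (R : realType) m (A : 'M[R[i]]_m) i j :
  ent (block_mx A 0 0 A) i j =
  if (i < m)%N then if (j < m)%N then ent A i j else 0
  else if (j < m)%N then 0 else ent A (i - m) (j - m).
Proof.
have [imm|mmi] := ltnP i (m + m); last first.
  rewrite ent_out ?mmi// ltnNge (leq_trans (leq_addr m m) mmi) /=.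
  by case: ifP => // _; rewrite ent_out// leq_subRL ?mmi// (leq_trans (leq_addr m m) mmi).
have [jmm|mmj] := ltnP j (m + m); last first.
  rewrite ent_out ?mmj ?orbT// [(j < m)%N]ltnNge (leq_trans (leq_addr m m) mmj) /=.
  by case: ifP => // _; rewrite ent_out// orbC leq_subRL ?mmj// (leq_trans (leq_addr m m) mmj).
rewrite (ent_in _ imm jmm) mxE; case: splitP => a /= ia; rewrite mxE; case: splitP => b /= jb.
- by rewrite ia jb !ltn_ord entE.
- by rewrite ia jb ltn_ord ltnNge leq_addr mxE.
- by rewrite ia jb ltn_ord ltnNge leq_addr mxE.
- by rewrite ia jb ![(m + _ < m)%N]ltnNge !leq_addr !addKn entE.
Qed.

Lemma ent_tens (R : realType) m k (A : 'M[R[i]]_m) (B : 'M[R[i]]_k) i j : (0 < k)%N ->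
  ent (A *t B) i j = ent A (i %/ k) (j %/ k) * ent B (i %% k) (j %% k).
Proof.
move=> k0.
have [imk|mki] := ltnP i (m * k); last first.
  by rewrite ent_out ?mki// (ent_out A) ?mul0r// leq_divRL// mki.
have [jmk|mkj] := ltnP j (m * k); last first.
  by rewrite ent_out ?mkj ?orbT// (ent_out A) ?mul0r// orbC leq_divRL// mkj.
by rewrite (ent_in _ imk jmk) mxE -!entE.
Qed.

Lemma ent_ulsub (R : realType) m (Z : 'M[R[i]]_(m + m)) i j :
  ent (ulsubmx Z) i j = if (i < m)%N && (j < m)%N then ent Z i j else 0.
Proof.
have [im|mi] := ltnP i m; last by rewrite ent_out// mi.
have [jm|mj] := ltnP j m; last by rewrite ent_out// mj orbT.
by rewrite (ent_in _ im jm) !mxE -entE.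
Qed.

Section Tensor.
Variables (R : realType) (m k N : nat) (e : (m * k)%N = N).
Implicit Types (Z : 'M[R[i]]_m) (B : 'M[R[i]]_k).

Definition tens Z B : 'M[R[i]]_N := castmx (e, e) (Z *t B).

Lemma tensM Z Z' B B' : tens (Z ** Z') (B ** B') = tens Z B ** tens Z' B'.
Proof. by rewrite /tens; case: _ / e; rewrite !castmx_id /smul /= tensmx_mul. Qed.

Lemma tens_star Z B : star (tens Z B) = tens (star Z) (star B).
Proof.
rewrite /tens; case: _ / e; rewrite !castmx_id; apply/matrixP => i j.
by rewrite star_mx !mxE rmorphM.
Qed.

Lemma tens_linearl (a : R[i]) Z Z' B : tens (a *: Z + Z') B = a *: tens Z B + tens Z' B.
Proof.
rewrite /tens; case: _ / e; rewrite !castmx_id; apply/matrixP => i j.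
by rewrite !mxE mulrDl mulrA.
Qed.

Lemma tens_inj1 Z : (0 < k)%N -> tens Z 1%:M = 0 -> Z = 0.
Proof.
rewrite /tens => k0; case: _ / e; rewrite castmx_id => h.
apply/matrixP => i j; have := tensmxE Z 1%:M i (Ordinal k0) j (Ordinal k0).
by rewrite h !mxE eqxx mulr1.
Qed.
End Tensor.

Lemma tens_dbl (R : realType) m k L N N' (eN : (m + m)%N = N) (e : (N * k)%N = N')
    (eL : (m * k)%N = L) (eN' : (L + L)%N = N') (Z : 'M[R[i]]_m) (B : 'M[R[i]]_k) :
  (0 < k)%N -> tens e (dbl eN Z) B = dbl eN' (tens eL Z B).
Proof.
move=> k0; apply: ent_inj => i j.
rewrite /tens /dbl !ent_cast ent_tens// ent_cast !ent_block !ent_cast !ent_tens//.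
rewrite !ltn_divLR// eL.
case: ltnP => iL; case: ltnP => jL; rewrite ?mul0r//.
have sub x : (L <= x)%N -> ((x - L) %/ k = x %/ k - m /\ (x - L) %% k = x %% k)%N.
  by rewrite -eL => h; rewrite -{2 4}(subnKC h) divnMDl// addKn modnMDl.
by have [[-> ->] [-> ->]] := (sub _ iL, sub _ jL).
Qed.

Lemma tens_down (R : realType) m k L N N' (eN : (m + m)%N = N) (e : (N * k)%N = N')
    (eL : (m * k)%N = L) (eN' : (L + L)%N = N') (Z : 'M[R[i]]_N) (B : 'M[R[i]]_k) :
  (0 < k)%N -> down eN' (tens e Z B) = tens eL (down eN Z) B.
Proof.
move=> k0; apply: ent_inj => i j.
rewrite /tens /down ent_ulsub !ent_cast !ent_tens// ent_ulsub ent_cast !ltn_divLR// eL.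
by case: ifP => // _; rewrite mul0r.
Qed.

Lemma tens11 (R : realType) k N (e : (1 * k)%N = N) (e' : k = N) (B : 'M[R[i]]_k) :
  (0 < k)%N -> tens e 1%:M B = castmx (e', e') B.
Proof.
move=> k0; apply: ent_inj => i j; rewrite /tens !ent_cast ent_tens//.
have [ik|ki] := ltnP i k; last first.
  by rewrite [RHS]ent_out ?ki// ent_out ?mul0r// divn_gt0// ki.
have [jk|kj] := ltnP j k; last first.
  by rewrite [RHS]ent_out ?kj ?orbT// ent_out ?mul0r// orbC divn_gt0// kj.
by rewrite !divn_small// !modn_small// (entE _ ord0 ord0) mxE mul1r.
Qed.

(** * The shift endomorphisms *)

Section Shift.
Variables (R : realType) (M : cstarAlgType R).
Variable phi : forall n, 'M[R[i]]_(2 ^ n.+1) -> M.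
Arguments phi : clear implicits.
Hypothesis hM : is_uhf2 phi.
Variable q : nat.
Let P := rnorm_csn M.

Lemma expn_shift p : (2 ^ p.+1 * 2 ^ q.+1)%N = (2 ^ (p + q.+1).+1)%N.
Proof. by rewrite -expnD. Qed.

Let k0 : (0 < 2 ^ q.+1)%N. Proof. by rewrite expn_gt0. Qed.

(** The index of a Kronecker product splits into leading binary digits, on
    which Z acts, and q + 1 trailing digits, on which B acts. Block doubling
    adds a leading digit, hence commutes with this construction. *)
Definition tau p (Z : 'M[R[i]]_(2 ^ p.+1)) (B : 'M[R[i]]_(2 ^ q.+1)) : M :=
  phi (p + q.+1)%N (tens (expn_shift p) Z B).

Lemma tau_dbl p (Z : 'M[R[i]]_(2 ^ p.+1)) B :
  tau (dbl (expn2SD p.+1) Z : 'M[R[i]]_(2 ^ p.+2)) B = tau Z B.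
Proof.
rewrite /tau (tens_dbl _ _ (expn_shift p) (expn2SD (p + q.+1).+1))//.
exact: phi_dbl hM _ _.
Qed.

Lemma tau1 p B : tau (1%:M : 'M[R[i]]_(2 ^ p.+1)) B = phi q B.
Proof.
have dbl1 n : dbl (expn2SD n) 1%:M = 1%:M :> 'M[R[i]]_(2 ^ n.+1).
  by rewrite /dbl; case: _ / (expn2SD n); rewrite castmx_id -scalar_mx_block.
elim: p => [|p IH]; last by rewrite -dbl1 tau_dbl.
rewrite -dbl1 /tau (tens_dbl _ _ (mul1n _) (expn2SD q.+1))//.
by rewrite (tens11 _ erefl)// castmx_id; apply: phi_dbl hM _ _.
Qed.

Lemma tauM p (Z Z' : 'M[R[i]]_(2 ^ p.+1)) B B' : tau (Z ** Z') (B ** B') = tau Z B ** tau Z' B'.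
Proof. by rewrite /tau tensM (phiM hM). Qed.

Lemma tau_star p (Z : 'M[R[i]]_(2 ^ p.+1)) B : star (tau Z B) = tau (star Z) (star B).
Proof. by rewrite /tau -(phi_star hM) tens_star. Qed.

Lemma tau_linear p B : linear (fun Z : 'M[R[i]]_(2 ^ p.+1) => tau Z B).
Proof. by move=> a Z Z'; rewrite /tau tens_linearl (phi_linear hM). Qed.

Lemma mx1_star n : star (1%:M : 'M[R[i]]_n) = 1%:M.
Proof.
apply/matrixP => i j; rewrite star_mx !mxE eq_sym.
by case: eqP => _; rewrite /= ?conjC1 ?conjC0.
Qed.

Lemma mx1l n (B : 'M[R[i]]_n) : 1%:M ** B = B. Proof. exact: mul1mx. Qed.
Lemma mx1r n (B : 'M[R[i]]_n) : B ** 1%:M = B. Proof. exact: mulmx1. Qed.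

Lemma tau1_star_hom p : star_hom (fun Z : 'M[R[i]]_(2 ^ p.+1) => tau Z 1%:M).
Proof.
split; [exact: tau_linear|move=> Z Z'|move=> Z].
  by rewrite -tauM mx1l.
by rewrite tau_star mx1_star.
Qed.

Lemma tau_norm p (Z : 'M[R[i]]_(2 ^ p.+1)) : rnorm (tau Z 1%:M) = rnorm (phi p Z).
Proof.
apply: (csn_mx_eq (p := fun Z => rnorm (tau Z 1%:M)) (q := fun Z => rnorm (phi p Z))).
- exact: csn_comp (tau1_star_hom p) P.
- exact: phi_csn hM p.
- by move=> B /(phi_csn0 hM) /tens_inj1; apply.
- exact: phi_csn0 hM p.
Qed.

Definition shift_rel (x y : M) := exists p (Z : 'M[R[i]]_(2 ^ p.+1)), x = phi p Z /\ y = tau Z 1%:M.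

Lemma shift_lift p p' (Z : 'M[R[i]]_(2 ^ p.+1)) : (p <= p')%N ->
  exists Z' : 'M[R[i]]_(2 ^ p'.+1), phi p' Z' = phi p Z /\ forall B, tau Z' B = tau Z B.
Proof.
move=> /subnK <-; elim: (p' - p)%N => [|j [Z' [h1 h2]]]; first by exists Z.
exists (dbl (expn2SD (j + p).+1) Z'); split=> [|B]; first by rewrite -h1; apply: phi_dbl hM _ _.
by rewrite -h2; apply: tau_dbl.
Qed.

Lemma shift_rel_common x y x' y' : shift_rel x y -> shift_rel x' y' ->
  exists p (Z Z' : 'M[R[i]]_(2 ^ p.+1)), [/\ x = phi p Z, y = tau Z 1%:M, x' = phi p Z' & y' = tau Z' 1%:M].
Proof.
move=> [p [Z [-> ->]]] [p' [Z' [-> ->]]]; exists (p + p')%N.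
have [Z1 [<- h1]] := shift_lift Z (leq_addr p' p).
have [Z2 [<- h2]] := shift_lift Z' (leq_addl p p').
by exists Z1, Z2; rewrite h1 h2.
Qed.

Lemma shift_star_rel : star_rel shift_rel.
Proof.
split.
- move=> a x y x' y' h h'; have [p [Z [Z' [-> -> -> ->]]]] := shift_rel_common h h'.
  by exists p, (a *: Z + Z'); rewrite (tau_linear 1%:M) (phi_linear hM).
- move=> x y x' y' h h'; have [p [Z [Z' [-> -> -> ->]]]] := shift_rel_common h h'.
  by exists p, (Z ** Z'); rewrite (phiM hM) -tauM mx1l.
- move=> x y [p [Z [-> ->]]]; exists p, (star Z).
  by rewrite (phi_star hM) tau_star mx1_star.
Qed.

(** The shift inserts q + 1 trailing binary digits on which it acts trivially;
    level q lives on precisely these digits, so it commutes with the range of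
    the shift. *)
Lemma shift_exists : exists s : M -> M, star_hom s /\ forall x y, rel_closure shift_rel x y <-> s x = y.
Proof.
apply: (extend_star_hom shift_star_rel) => [x y [p [Z [-> ->]]]|].
  by rewrite tau_norm.
rewrite -subTset => x _; apply/closureE => r r0.
have [p [y [[Z _ Zy] xy]]] := lev_dense hM x r0; exists y => //.
by exists (tau Z 1%:M); apply: sub_rel_closure; exists p, Z.
Qed.

Definition shift : M -> M := projT1 (cid shift_exists).

Lemma shift_star_hom : star_hom shift.
Proof. by rewrite /shift; case: cid => s []. Qed.

Lemma shift_phi p Z : shift (phi p Z) = tau Z 1%:M.
Proof.
rewrite /shift; case: cid => s /= [_ hs]; apply/hs/sub_rel_closure.
by exists p, Z.
Qed.

Lemma shiftB x y : shift (x - y) = shift x - shift y.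
Proof. by have [ls _ _] := shift_star_hom; have [] := linear_mapE ls. Qed.

Lemma shift_le x : rnorm (shift x) <= rnorm x.
Proof. exact: star_hom_contractive shift_star_hom x. Qed.

Lemma shift_norm x : rnorm (shift x) = rnorm x.
Proof.
apply/eqP; rewrite eq_le shift_le /=; apply: ltr_eps => r r0.
have [|p [y [[Z _ Zy] xy]]] := lev_dense hM x (_ : 0 < r / 2); first by rewrite divr_gt0.
have yE : rnorm (shift y) = rnorm y by rewrite -Zy shift_phi tau_norm.
have := rnormD (x - y) y; rewrite subrK.
have := rnormD (shift y - shift x) (shift x); rewrite subrK yE -shiftB.
have := shift_le (y - x); rewrite (rnormB y); lra.
Qed.

Lemma lev_ext (f g : M -> M) (c : R) : linear f -> linear g ->
  (forall x, rnorm (f x) <= c * rnorm x) -> (forall x, rnorm (g x) <= c * rnorm x) ->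
  (forall p Z, f (phi p Z) = g (phi p Z)) -> f =1 g.
Proof.
move=> lf lg fc gc h x; apply/subr0_eq/rnorm_eq0_eps => r r0.
have c1 : 0 < `|c| + 1 by rewrite ltr_wpDl.
have [|p [y [[Z _ Zy] xy]]] := lev_dense hM x (_ : 0 < r / (2 * (`|c| + 1))).
  by rewrite divr_gt0// mulr_gt0.
have [_ _ _ fB] := linear_mapE lf; have [_ _ _ gB] := linear_mapE lg.
have -> : f x - g x = f (x - y) - g (x - y).
  by rewrite fB gB -Zy h; linear_identity.
apply: le_trans (csnB P _ _) _.
move: xy; rewrite ltr_pdivlMr ?mulr_gt0//.
have := fc (x - y); have := gc (x - y); have := rnorm_ge0 (x - y); have := ler_norm c.
nra.
Qed.

Lemma phi_shift p Z B : phi q B ** shift (phi p Z) = tau Z B.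
Proof. by rewrite -(tau1 p) shift_phi -tauM mx1l mx1r. Qed.

Lemma shift_comm B x : shift x ** phi q B = phi q B ** shift x.
Proof.
have [ls _ _] := shift_star_hom.
have := rnorm_ge0 (phi q B) => b0.
apply: (@lev_ext (fun x => shift x ** phi q B) (fun x => phi q B ** shift x) (rnorm (phi q B))).
- by move=> a y z; rewrite ls smulDl smulZl.
- by move=> a y z; rewrite ls smulDr smulZr.
- move=> y; apply: le_trans (csnM P _ _) _; rewrite mulrC.
  by rewrite ler_wpM2l// shift_le.
- move=> y; apply: le_trans (csnM P _ _) _.
  by rewrite ler_wpM2l// shift_le.
- by move=> p Z; rewrite phi_shift shift_phi -(tau1 p) -tauM mx1l mx1r.
Qed.

Lemma rho_down N N' (Y : 'M[R[i]]_(2 ^ N'.+2)) : (N <= N')%N ->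
  rho hM N (phi N'.+1 Y) = rho hM N (phi N' (down (expn2SD N'.+1) Y)).
Proof.
move=> NN; have [j NE] : exists j, N' = (j + N)%N by exists (N' - N)%N; rewrite subnK.
subst N'.
by rewrite [RHS]rho_phi; apply: (@rho_phi _ _ _ hM N j.+1 Y).
Qed.

Lemma rho_tau n k (Z : 'M[R[i]]_(2 ^ (k + n).+1)) B :
  rho hM (n + q.+1) (tau Z B) = tau (downs (k := k) Z) B.
Proof.
elim: k Z => [|k IH] Z; first by apply: rho_lev; exists (tens (expn_shift n) Z B).
have le : (n + q.+1 <= k + n + q.+1)%N by rewrite -addnA leq_addl.
have := rho_down (tens (expn_shift (k + n).+1) Z B) le.
rewrite (tens_down (expn2SD (k + n).+1) _ (expn_shift (k + n)))// => E.
exact: etrans E (IH _).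
Qed.

(** Corners are cut out by leading digits, whereas phi q B acts on trailing
    digits. *)
Lemma rho_phi_shift n B x :
  rho hM (n + q.+1) (phi q B ** shift x) = phi q B ** shift (rho hM n x).
Proof.
have [ls _ _] := shift_star_hom.
apply: (@lev_ext (fun x => rho hM (n + q.+1) (phi q B ** shift x))
  (fun x => phi q B ** shift (rho hM n x)) (rnorm (phi q B))).
- by move=> a y z; rewrite ls smulDr smulZr rho_linear.
- by move=> a y z; rewrite rho_linear ls smulDr smulZr.
- move=> y; apply: le_trans (rho_le _ _ _) _; apply: le_trans (csnM P _ _) _.
  by rewrite ler_wpM2l ?rnorm_ge0// shift_le.
- move=> y; apply: le_trans (csnM P _ _) _.
  by rewrite ler_wpM2l ?rnorm_ge0//; apply: le_trans (shift_le _) (rho_le _ _ _).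
- move=> p Z; have [Z' _ <-] : lev phi (p + n)%N (phi p Z).
    by apply: (lev_le hM (leq_addr n p)); exists Z.
  by rewrite rho_phi !phi_shift rho_tau.
Qed.
End Shift.

(** * Matrix amplifications of the UHF algebra *)

Section Amplification.
Variables (R : realType) (M : cstarAlgType R).
Variable phi : forall n, 'M[R[i]]_(2 ^ n.+1) -> M.
Arguments phi : clear implicits.
Hypothesis hM : is_uhf2 phi.
Variable k : nat.
Let P := rnorm_csn M.
Let s := shift hM k.

Lemma le_expn_self : (k <= 2 ^ k.+1)%N.
Proof. by apply/ltnW; apply: leq_trans (ltn_expl k.+1 (ltnSn 1)). Qed.

Definition wid (a : 'I_k) : 'I_(2 ^ k.+1) := widen_ord le_expn_self a.

Lemma wid_eq a b : (wid a == wid b) = (a == b).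
Proof. by []. Qed.

Definition munit (i j : 'I_(2 ^ k.+1)) : M := phi k (delta_mx i j).

Lemma munitM i j l m : munit i j ** munit l m = if j == l then munit i m else 0.
Proof. by rewrite -(phiM hM) delta_mul; case: ifP => // _; apply: phi0. Qed.

Lemma munit_star i j : star (munit i j) = munit j i.
Proof. by rewrite -(phi_star hM) star_delta. Qed.

Lemma munit_comm i j x : s x ** munit i j = munit i j ** s x.
Proof. exact: shift_comm. Qed.

(** Level k contains a system of k by k matrix units commuting with the range
    of the shift, so matrices over M embed into M itself. This provides the
    C*-norms of matrices over M and of matrices over algebras of sequences. *)
Definition Psi (X : matrix_over k M) : M := \sum_a \sum_b munit (wid a) (wid b) ** s (X a b).

Lemma shift_sum (I : finType) (F : I -> M) : s (\sum_i F i) = \sum_i s (F i).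
Proof.
have [ls _ _] := shift_star_hom hM k; have [sD _ _ _] := linear_mapE ls.
by apply: big_morph; [exact: sD|exact: linear_map0 ls].
Qed.

Lemma Psi_star_hom : star_hom Psi.
Proof.
have [ls sM sS] := shift_star_hom hM k.
split.
- move=> c X Y; rewrite scaler_sumr -big_split; apply: eq_bigr => a _.
  rewrite scaler_sumr -big_split; apply: eq_bigr => b _ /=.
  have -> : (c *: X + Y) a b = c *: X a b + Y a b by rewrite !mxE.
  by rewrite /s ls smulDr smulZr.
- move=> X Y; rewrite smul_suml; apply: eq_bigr => a _.
  have XYE d : munit (wid a) (wid d) ** s ((X ** Y) a d) =
      \sum_b munit (wid a) (wid d) ** s (X a b ** Y b d).
    by rewrite mxE shift_sum smul_sumr.
  under eq_bigr => d _ do rewrite XYE.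
  rewrite exchange_big smul_suml; apply: eq_bigr => b _ /=.
  rewrite /Psi smul_sumr [RHS](bigD1 b)//= [X in _ = _ + X]big1 => [|c cb].
    rewrite addr0 smul_sumr; apply: eq_bigr => d _.
    rewrite -smulA [s _ ** _]smulA munit_comm -smulA smulA munitM eqxx.
    by rewrite /s sM.
  rewrite smul_sumr big1// => d _.
  rewrite -smulA [s _ ** _]smulA munit_comm -smulA smulA munitM wid_eq.
  by rewrite eq_sym (negPf cb) smul0l.
- move=> X; rewrite star_sum /Psi exchange_big; apply: eq_bigr => a _ /=.
  rewrite star_sum; apply: eq_bigr => b _.
  have sS' x : star (s x) = s (star x) by rewrite /s sS.
  by rewrite starM munit_star sS' munit_comm mxE.
Qed.

Lemma Psi_corner X i j a b : munit i (wid a) ** Psi X ** munit (wid b) j = munit i j ** s (X a b).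
Proof.
rewrite /Psi smul_sumr smul_suml (bigD1 a)//= [X in _ + X]big1 => [|c ca]; last first.
  rewrite smul_sumr smul_suml big1// => d _.
  by rewrite smulA munitM wid_eq eq_sym (negPf ca) !smul0l.
rewrite addr0 smul_sumr smul_suml (bigD1 b)//= [X in _ + X]big1 => [|d db]; last first.
  rewrite smulA munitM eqxx -smulA munit_comm smulA munitM wid_eq (negPf db).
  by rewrite smul0l.
by rewrite addr0 smulA munitM eqxx -smulA munit_comm smulA munitM eqxx.
Qed.

Lemma Psi_eq0 X : Psi X = 0 -> X = 0.
Proof.
move=> X0; apply/matrixP => a b; rewrite [RHS]mxE; apply: rnorm0_eq0.
rewrite -(shift_norm hM k) -/s.
suff -> : s (X a b) = 0 by apply: rnorm0.
rewrite -(unit1l hM (s _)) -(phi1 hM k).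
have -> : 1%:M = \sum_i delta_mx i i :> 'M[R[i]]_(2 ^ k.+1).
  by rewrite mx1_sum_delta.
have -> : phi k (\sum_i delta_mx i i) = \sum_i munit i i.
  by apply: (big_morph (phi k)); [exact: phiD hM k|exact: phi0 hM k].
by rewrite smul_suml big1// => i _; rewrite -(Psi_corner X i i a b) X0 smul0r smul0l.
Qed.

Lemma Psi_csn : cstar_seminorm (fun X => rnorm (Psi X)).
Proof. exact: csn_comp Psi_star_hom P. Qed.

(** This reduces the comparison of matrix norms under the compressions to the
    case of a single element of M. *)
Lemma Psi_rho n X : Psi (map_mx (rho hM n) X) = rho hM (n + k.+1) (Psi X).
Proof.
have rD := rho_linear hM (n + k.+1); have [rA _ _ _] := linear_mapE rD.
rewrite /Psi (big_morph _ rA (linear_map0 rD)); apply: eq_bigr => a _.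
rewrite (big_morph _ rA (linear_map0 rD)); apply: eq_bigr => b _.
by rewrite rho_phi_shift mxE.
Qed.
End Amplification.

Section Generation.
Variables (R : realType) (M : cstarAlgType R).
Variable phi : forall n, 'M[R[i]]_(2 ^ n.+1) -> M.
Arguments phi : clear implicits.
Hypothesis hM : is_uhf2 phi.
Let A := tuhf2 phi.

Lemma ulev_generates (S : set M) n : S 0 -> (forall (a : R[i]) x y, S x -> S y -> S (a *: x + y)) ->
  (forall x, S x -> S (star x)) -> ulev phi n `<=` S -> lev phi n `<=` S.
Proof.
move=> S0 Sl Ss uS x [B _ <-].
have Sd i j : S (phi n (delta_mx i j)).
  have [ij|/ltnW ji] := leqP i j; first by apply: uS; exists (delta_mx i j) => //; apply: upper_delta.
  rewrite -star_delta (phi_star hM); apply/Ss/uS.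
  by exists (delta_mx j i) => //; apply: upper_delta.
rewrite [B]matrix_sum_delta; apply: (big_ind (fun C => S (phi n C))).
- by rewrite (phi0 hM).
- by move=> C D SC SD; rewrite -[C]scale1r (phi_linear hM); apply: Sl.
move=> i _; apply: (big_ind (fun C => S (phi n C))).
- by rewrite (phi0 hM).
- by move=> C D SC SD; rewrite -[C]scale1r (phi_linear hM); apply: Sl.
by move=> j _; rewrite -[_ *: _]addr0 (phi_linear hM) (phi0 hM); apply: Sl.
Qed.

Lemma tuhf_cover_id : cstar_cover A (@id M).
Proof.
split.
- by split.
- move=> k; exists (fun X => (rnorm (Psi hM X))%:C), (fun X => (rnorm (Psi hM X))%:C).
  have N : is_cstar_norm (fun X : matrix_over k M => (rnorm (Psi hM X))%:C).
    by apply: csn_csn_norm (Psi_csn hM k) _ => X /rnorm0_eq0 /Psi_eq0.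
  split=> // X _; congr (rnorm (Psi _ _))%:C.
  by apply/matrixP => i j; rewrite mxE.
- rewrite -subTset => x _ S [[S0 Sl SM Ss cS] AS].
  have AS' y : A y -> S y by move=> Ay; apply: AS; exists y.
  move/closedP: cS; apply => r r0.
  have [n [y [yn xy]]] := lev_dense hM x r0; exists y => //.
  apply: (@ulev_generates S n) yn => // z zn; apply: AS'.
  exact: ulev_tuhf zn.
Qed.
End Generation.

(** * RFD covers from tails of compressions *)

Section GeneratedSeqAlgebra.
Variables (R : realType) (M : cstarAlgType R) (L : seq_calg M) (X : set (nat -> M)).

(** The ambient algebra L guarantees boundedness. *)
Definition gen_car : set (nat -> M) :=
  [set f | scar L f /\ forall T : seq_calg M, X `<=` scar T -> scar T f].

Definition gen_calg : seq_calg M.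
Proof.
refine (@SeqCalg R M gen_car _ _ _ _ _ _).
- by split=> [|T _]; apply: scar0.
- by move=> a f g [Lf Tf] [Lg Tg]; split=> [|T XT]; apply: scar_lin; auto.
- by move=> f g [Lf Tf] [Lg Tg]; split=> [|T XT]; apply: scar_mul; auto.
- by move=> f [Lf Tf]; split=> [|T XT]; apply: scar_star; auto.
- by move=> f [Lf _]; apply: scar_bounded Lf.
- move=> f h; split=> [|T XT]; apply: scar_closed => e /h[g [Lg Tg] fg]; exists g => //.
  exact: Tg.
Defined.

Hypothesis XL : X `<=` scar L.

Lemma gen_calg_sub f : X f -> scar gen_calg f.
Proof. by move=> Xf; split=> [|T]; [apply: XL|apply]. Qed.

(** A C*-subalgebra S of the new algebra is again a C*-algebra of sequences, so
    minimality of [gen_calg] applies to it. *)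
Lemma gen_calg_smallest (S : set (sqalg gen_calg)) :
  cstar_subalgebra S -> (forall x, X (coord x) -> S x) -> S = setT.
Proof.
move=> [S0 Sl SM Ss /closedP cS] XS.
have mk f : scar gen_calg f -> exists x : sqalg gen_calg, coord x = f.
  by move=> fG; exists (exist _ f fG).
pose C : set (nat -> M) := [set f | exists2 x, S x & coord x = f].
have C0 : C (fun=> 0) by exists 0.
have Cl (a : R[i]) f g : C f -> C g -> C (fun n => a *: f n + g n).
  by move=> [x Sx <-] [y Sy <-]; exists (a *: x + y) => //; apply: Sl.
have CM f g : C f -> C g -> C (fun n => f n ** g n).
  by move=> [x Sx <-] [y Sy <-]; exists (x ** y) => //; apply: SM.
have Cs f : C f -> C (fun n => star (f n)).
  by move=> [x Sx <-]; exists (star x) => //; apply: Ss.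
have Cb f : C f -> bounded_seq f by move=> [x Sx <-]; apply: scar_bounded (coordP x).
have Cc f : (forall e : R, 0 < e -> exists2 g, C g & forall n, rnorm (f n - g n) <= e) -> C f.
  move=> h; have [x xf] : exists x : sqalg gen_calg, coord x = f.
    apply: mk; apply: scar_closed => e /h[_ [y _ <-] fy].
    by exists (coord y) => //; apply: coordP.
  exists x => //; apply: cS => e e0.
  have [|_ [y Sy <-] fy] := h (e / 2); first by rewrite divr_gt0.
  exists y => //; apply: le_lt_trans (_ : e / 2 < e); last by lra.
  by apply: sup_norm_le => n; rewrite -[coord _ n]/(coord x n - coord y n) xf.
pose T := SeqCalg C0 Cl CM Cs Cb Cc.
rewrite -subTset => x _; have [_ /(_ T)[f Xf|y Sy /= yx]] := coordP x.
  have [y yf] := mk f (gen_calg_sub Xf); exists y => //.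
  by apply: XS; rewrite yf.
by rewrite (_ : x = y)//; apply: sqalg_eq => n; rewrite yx.
Qed.
End GeneratedSeqAlgebra.

Section RfdCovers.
Variables (R : realType) (M : cstarAlgType R).
Variable phi : forall n, 'M[R[i]]_(2 ^ n.+1) -> M.
Arguments phi : clear implicits.
Hypothesis hM : is_uhf2 phi.
Variable m : nat.
Let A := tuhf2 phi.
Let P := rnorm_csn M.

Definition level_calg : seq_calg M.
Proof.
refine (@SeqCalg R M [set f | bounded_seq f /\ forall n, lev phi (n + m) (f n)] _ _ _ _ _ _).
- split=> [|n]; first by exists 0 => n; rewrite rnorm0.
  by exists 0 => //; apply: phi0 hM _.
- move=> a f g [[c hc] fl] [[d hd] gl]; split=> [|n]; last exact: lev_lin.
  exists (cabs a * c + d) => n; apply: le_trans (rnormD _ _) _.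
  by rewrite rnormZ; apply: lerD => //; rewrite ler_wpM2l ?cabs_ge0.
- move=> f g [[c hc] fl] [[d hd] gl]; split=> [|n]; last exact: lev_mul.
  exists (c * d) => n; apply: le_trans (csnM P _ _) _.
  by apply: ler_pM; rewrite ?rnorm_ge0.
- move=> f [[c hc] fl]; split=> [|n]; last exact: lev_star.
  by exists c => n; rewrite (csn_star P).
- by move=> f [].
- move=> f h; split=> [|n].
    have [g [[c hc] _] fg] := h 1 ltr01; exists (1 + c) => n.
    by rewrite -(subrK (g n) (f n)); apply: le_trans (rnormD _ _) _; apply: lerD.
  apply: lev_closed => // r r0; have [|g [_ gl] fg] := h (r / 2); first by rewrite divr_gt0.
  by exists (g n); [exact: gl|apply: le_lt_trans (fg n) _; lra].
Defined.

Definition comp_seq (x : M) : nat -> M := fun n => rho hM (n + m) x.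

Definition comp_calg : seq_calg M := gen_calg level_calg (comp_seq @` A).

Lemma comp_seq_level : comp_seq @` A `<=` scar level_calg.
Proof.
move=> _ [x _ <-]; split=> [|n]; last exact: rho_range.
by exists (rnorm x) => n; apply: rho_le.
Qed.

Lemma comp_seq_calg x : A x -> scar comp_calg (comp_seq x).
Proof. by move=> Ax; apply: gen_calg_sub; [exact: comp_seq_level|exists x]. Qed.

Definition comp_alg : cstarAlgType R := sqalg comp_calg.

Definition comp_emb (x : M) : comp_alg :=
  if pselect (scar comp_calg (comp_seq x)) is left h then exist _ _ h else 0.

Lemma coord_emb x n : A x -> coord (comp_emb x) n = rho hM (n + m) x.
Proof. by move=> /comp_seq_calg h; rewrite /comp_emb; case: pselect. Qed.

Lemma coord_lev (y : comp_alg) n : lev phi (n + m) (coord y n).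
Proof. by have [[_ h] _] := coordP y; apply: h. Qed.

Lemma Psi_coord_star_hom k n :
  star_hom (fun Y : matrix_over k comp_alg => Psi hM (map_mx (fun y => coord y n) Y)).
Proof.
have [pl pM pS] := Psi_star_hom hM k.
have cs (I : finType) (F : I -> comp_alg) : coord (\sum_i F i) n = \sum_i coord (F i) n.
  by apply: (big_morph (fun y : comp_alg => coord y n)).
split=> [a X Y|X Y|X].
- rewrite -pl; congr Psi; apply/matrixP => a' b'.
  have -> : map_mx (fun y : comp_alg => coord y n) (a *: X + Y) a' b' =
    coord ((a *: X + Y) a' b') n by rewrite mxE.
  by rewrite !mxE.
- rewrite -pM; congr Psi; apply/matrixP => a' b'.
  by rewrite !mxE cs; apply: eq_bigr => c _; rewrite !mxE.
- rewrite -pS; congr Psi; apply/matrixP => a' b'.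
  by rewrite !mxE.
Qed.

(** The compressions of Psi X are contractions of Psi X and converge to it, so
    the supremum of their norms is the norm of Psi X; hence the embedding is
    isometric on matrices of every size. *)
Lemma comp_cover : cstar_cover A comp_emb.
Proof.
split.
- split=> [a x y Ax Ay|x y Ax Ay]; apply: sqalg_eq => n.
    rewrite coord_emb; last exact: tuhf_lin.
    by rewrite rho_linear -!coord_emb.
  rewrite coord_emb; last exact: tuhf_mul.
  by rewrite rho_mul// -!coord_emb.
- move=> k.
  pose p n (Y : matrix_over k comp_alg) : R := rnorm (Psi hM (map_mx (fun y => coord y n) Y)).
  have pP n : cstar_seminorm (p n) by apply: csn_comp (Psi_coord_star_hom k n) P.
  have pb Y : exists c : R, forall n, p n Y <= c.
    exists (\sum_a \sum_b rnorm (munit phi (wid a) (wid b)) * rnorm (Y a b)) => n.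
    apply: le_trans (csn_sum _ P) _; apply: ler_sum => a _.
    apply: le_trans (csn_sum _ P) _; apply: ler_sum => b _.
    apply: le_trans (csnM P _ _) _; rewrite mxE ler_wpM2l ?rnorm_ge0//.
    by rewrite shift_norm; apply: le_sup_norm.
  exists (fun X => (rnorm (Psi hM X))%:C), (fun Y => (csn_sup p Y)%:C); split.
  + by apply: csn_csn_norm (Psi_csn hM k) _ => X /rnorm0_eq0 /Psi_eq0.
  + apply: csn_csn_norm (csn_supP 0%N pP pb) _ => Y /(csn_sup_eq0 pP pb) Y0.
    apply/matrixP => a b; rewrite [RHS]mxE; apply: sqalg_eq => n.
    have /rnorm0_eq0 /Psi_eq0 /matrixP /(_ a b) := Y0 n.
    by rewrite !mxE.
  + move=> X AX; congr (_%:C).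
    have pE n : p n (map_mx comp_emb X) = rnorm (rho hM (n + m + k.+1) (Psi hM X)).
      rewrite -Psi_rho; congr (rnorm (Psi _ _)).
      by apply/matrixP => a b; rewrite !mxE coord_emb.
    apply/eqP; rewrite eq_le; apply/andP; split.
      by apply: (csn_sup_le 0%N) => n; rewrite pE rho_le.
    apply: ltr_eps => r r0; have [N hN] := rho_cvg hM (Psi hM X) r0.
    have := le_csn_sup pb (map_mx comp_emb X) N; rewrite pE.
    have := rnormD (Psi hM X - rho hM (N + m + k.+1) (Psi hM X)) (rho hM (N + m + k.+1) (Psi hM X)).
    rewrite subrK; have := hN (N + m + k.+1)%N.
    rewrite -addnA leq_addr => /(_ isT); lra.
- rewrite -subTset => x _ S [cS jS].
  suff -> : S = setT by [].
  apply: (gen_calg_smallest comp_seq_level cS) => y [a Aa ay].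
  apply: jS; exists a => //; apply: sqalg_eq => n.
  by rewrite coord_emb// -ay.
Qed.

Lemma comp_rfd : rfd comp_alg.
Proof.
have ex (y : comp_alg) n : exists B, phi (n + m) B = coord y n.
  by have [B _ By] := coord_lev y n; exists B.
pose f y n := projT1 (cid (ex y n)).
have fE y n : phi (n + m) (f y n) = coord y n by rewrite /f; case: cid.
exists nat, (fun n => 2 ^ (n + m).+1)%N, f.
split.
- by move=> n; rewrite expn_gt0.
- exists (fun n B => (rnorm (phi (n + m) B))%:C); split.
    by move=> n; apply: csn_csn_norm (phi_csn hM _) (@phi_csn0 _ _ _ hM _).
  by move=> y; exists (rnorm y)%:C => n; rewrite fE lecR; apply: le_sup_norm.
- move=> n; split=> [a x y|x y|x]; apply: (uhf2_inj hM (n := n + m)).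
  + by rewrite (phi_linear hM) !fE.
  + by rewrite (phiM hM) !fE.
  + by rewrite (phi_star hM) !fE.
- move=> x y xy; apply: sqalg_eq => n; rewrite -!fE.
  by have /(congr1 (fun g : forall l, _ => g n)) := xy => ->.
Qed.

Lemma comp_rfd_cover : rfd_cover A comp_emb.
Proof. by split; [exact: comp_cover|exact: comp_rfd]. Qed.

(** Level m is fixed by the compressions to higher levels. Hence the upper
    triangular matrix units of level m give constant sequences in the tail
    algebra; there they are genuine matrix units, and their adjoints supply the
    rest of the matrix algebra. *)
Lemma const_calg x : lev phi m x -> scar comp_calg (fun=> x).
Proof.
apply: (@ulev_generates _ _ _ hM [set x | scar comp_calg (fun=> x)] m).
- exact: scar0.
- by move=> a y z; apply: (@scar_lin _ _ comp_calg a (fun=> y) (fun=> z)).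
- by move=> y; apply: (@scar_star _ _ comp_calg (fun=> y)).
move=> y ym /=; have Ay : A y by apply: ulev_tuhf ym.
rewrite (_ : (fun=> y) = comp_seq y); first exact: comp_seq_calg.
apply: funext => n; apply/esym/rho_lev/(lev_le hM (leq_addl n m)).
exact: ulev_lev ym.
Qed.

Definition const_emb (B : 'M[R[i]]_(2 ^ m.+1)) : comp_alg :=
  exist _ _ (const_calg (ex_intro2 _ _ B I erefl : lev phi m (phi m B))).

Lemma const_emb_star_hom : star_hom const_emb.
Proof.
split=> [a B C|B C|B]; apply: sqalg_eq => n.
- exact: phi_linear hM _ _ _ _.
- exact: phiM hM _ _ _.
- exact: phi_star hM _ _.
Qed.

Lemma const_emb_upper B : upper_triangular B -> const_emb B = comp_emb (phi m B).
Proof.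
move=> BT; apply: sqalg_eq => n; rewrite coord_emb; last by apply: (@ulev_tuhf _ _ _ m); exists B.
apply/esym/rho_lev/(lev_le hM (leq_addl n m)).
by exists B.
Qed.
End RfdCovers.

(** * Norms in covers and RFD representations *)

(** With a = T^* T and b = T - a one has b^* b = a^2 - a, and a^2 <= a since
    T^* is a contraction; therefore b = 0. *)
Lemma contractive_idempotent_sa (R : realType) n (T : 'M[R[i]]_n) : T ** T = T ->
  (forall x, nrm (star T *m x) <= nrm x) -> star T = T.
Proof.
move=> TT Sc; pose a := star T ** T; pose b := T - a.
have as_ : star a = a by rewrite starM starK.
have SS : star T ** star T = star T by rewrite -starM TT.
have bb : star b ** b = a ** a - a.
  have Ta : star T ** a = a by rewrite /a smulA SS.
  have aT : a ** T = a by rewrite /a -smulA TT.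
  by rewrite /b starB as_ !smulE Ta aT -/a; linear_identity.
have b0 (x : 'cV_n) : b *m x = 0.
  apply: nrm2_eq0; apply/eqP; rewrite eq_le nrm2_ge0 andbT.
  have -> : nrm2 (b *m x) = nrm2 (a *m x) - nrm2 (T *m x).
    apply: complexI; rewrite -dotpp dotp_adj mulmxA -[_ *m b]/(star b ** b) bb mulmxBl.
    rewrite dotpDr dotpNr -[a ** a *m x]mulmxA -{1}as_ -dotp_adj.
    rewrite -[a *m x in X in _ - X]mulmxA -dotp_adj !dotpp.
    by rewrite -[RHS]/((real_complex R) (nrm2 (a *m x) - nrm2 (T *m x))) rmorphB.
  have := Sc (T *m x); rewrite mulmxA -[star T *m T]/a.
  rewrite -(@ler_pXn2r _ 2)// ?nnegrE ?nrm_ge0// !nrm_sqr; lra.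
have bE : b = 0.
  apply/matrixP => i j; have /matrixP /(_ i 0) : col j b = 0 by rewrite colE b0.
  by rewrite [LHS]mxE [RHS]mxE => ->; rewrite mxE.
have TE : T = a by apply: subr0_eq.
by rewrite {1}TE as_ -TE.
Qed.

Section CoverIsometric.
Variables (R : realType) (M B : cstarAlgType R) (A : set M) (iota : M -> B).

Lemma const_mx_star_hom (D : cstarAlgType R) :
  star_hom (fun x : D => const_mx x : matrix_over 1 D).
Proof.
split=> [a x y|x y|x]; apply/matrixP => i j; rewrite !mxE//.
by rewrite big_ord1 !mxE.
Qed.

Lemma csn_const_mx (D : cstarAlgType R) (N : matrix_over 1 D -> R[i]) (x : D) :
  is_cstar_norm N -> N (const_mx x) = (rnorm x)%:C.
Proof.
move=> NP; rewrite is_cstar_norm_real//; congr (_%:C).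
have pP := csn_comp (const_mx_star_hom D) (is_cstar_norm_csn NP).
apply: (cstar_norm_unique pP) => y /= y0.
have /(cstar_norm_eq0 NP) /matrixP /(_ 0 0) : N (const_mx y) = 0.
  by rewrite is_cstar_norm_real// y0.
by rewrite !mxE.
Qed.

(** The given norms on 1 by 1 matrices are C*-norms on M and B, hence the
    norms of M and B by [cstar_norm_unique]. *)
Lemma cover_isometric x : cstar_cover A iota -> A x -> rnorm (iota x) = rnorm x.
Proof.
move=> [_ ci _] Ax; have [NM [NB [NMP NBP h]]] := ci 1%N.
have := h (const_mx x); rewrite map_const_mx !csn_const_mx// => hx.
by apply: complexI; apply: hx => i j; rewrite mxE.
Qed.
End CoverIsometric.

Section RfdNorm.
Variables (R : realType) (D : cstarAlgType R) (L : Type) (r : L -> nat).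
Variables (pi : D -> forall l, 'M[R[i]]_(r l)) (N : forall l, 'M[R[i]]_(r l) -> R[i]).
Hypothesis NP : forall l, is_cstar_norm (N (l := l)).
Hypothesis Nb : forall b, exists c : R[i], forall l, N (pi b l) <= c.
Hypothesis pih : forall l, star_hom (fun b => pi b l).
Hypothesis pi_inj : injective pi.

Lemma rep_contractive l d x : nrm (pi d l *m x) <= rnorm d * nrm x.
Proof.
have nP := is_cstar_norm_csn (NP l).
apply: le_trans (csn_mx_nrm _ _ nP _) _.
  by move=> C C0; apply: (cstar_norm_eq0 (NP l)); rewrite is_cstar_norm_real// C0.
by rewrite ler_wpM2r ?nrm_ge0//; apply: (csn_contractive (csn_comp (pih l) nP)).
Qed.

Lemma rep_separates d : (forall l, pi d l = 0) -> d = 0.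
Proof.
move=> d0; apply: pi_inj; apply: functional_extensionality_dep => l.
by rewrite d0; have [lp _ _] := pih l; rewrite (linear_map0 lp).
Qed.

(** The supremum of the norms in the representations is a C*-norm on D, hence
    the norm of D by [cstar_norm_unique]. *)
Lemma rep_norming d (c : R) : 0 <= c -> c < rnorm d ->
  exists l (x : 'cV_(r l)), nrm x = 1 /\ c < nrm (pi d l *m x).
Proof.
move=> c0 cd.
have [l0 _] : exists l, pi d l != 0.
  apply: contrapT => h; have d0 : d = 0.
    by apply: rep_separates => l; apply: contrapT => /eqP ?; apply: h; exists l.
  by move: cd; rewrite d0 rnorm0 ltNge c0.
pose p l b := complex.Re (N (pi b l)).
have pP l : cstar_seminorm (p l) by apply: csn_comp (pih l) (is_cstar_norm_csn (NP l)).
have pb b : exists c : R, forall l, p l b <= c.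
  have [c' hc] := Nb b; exists (complex.Re c') => l.
  by have := hc l; rewrite lecE => /andP[].
have q0 b : csn_sup p b = 0 -> b = 0.
  move=> /(csn_sup_eq0 pP pb) b0; apply: rep_separates => l.
  by apply: (cstar_norm_eq0 (NP l)); rewrite is_cstar_norm_real//; have := b0 l; rewrite /p => ->.
apply: contrapT => h.
have : rnorm d <= c.
  rewrite -(cstar_norm_unique (csn_supP l0 pP pb) q0); apply: (csn_sup_le l0) => l.
  apply: nrm_csn_le (is_cstar_norm_csn (NP l)) c0 _ => x.
  have [x0|x0] := eqVneq (nrm x) 0.
    have -> : x = 0 by apply: nrm2_eq0; rewrite -nrm_sqr x0 expr0n.
    by rewrite mulmx0 nrm0 mulr0.
  have xp : 0 < nrm x by rewrite lt_def x0 nrm_ge0.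
  have cE : cabs ((nrm x)^-1)%:C = (nrm x)^-1 by rewrite cabs_real ger0_norm// invr_ge0 ltW.
  rewrite leNgt; apply/negP => hx; apply: h; exists l, (((nrm x)^-1)%:C *: x).
  rewrite -scalemxAr !nrmZ cE mulVf//; split=> //.
  by rewrite mulrC ltr_pdivlMr.
by rewrite leNgt cd.
Qed.
End RfdNorm.

(** * Almost matrix units in RFD covers *)

Section LowerBound.
Variables (R : realType) (M : cstarAlgType R).
Variable phi : forall n, 'M[R[i]]_(2 ^ n.+1) -> M.
Arguments phi : clear implicits.
Hypothesis hM : is_uhf2 phi.
Let A := tuhf2 phi.
Variables (D : cstarAlgType R) (iota : M -> D).
Hypothesis hc : cstar_cover A iota.

Let iota_lin (a : R[i]) x y : A x -> A y -> iota (a *: x + y) = a *: iota x + iota y.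
Proof. by case: hc => [[h _] _ _]; apply: h. Qed.
Let iotaM x y : A x -> A y -> iota (x ** y) = iota x ** iota y.
Proof. by case: hc => [[_ h] _ _]; apply: h. Qed.
Let iota_norm x : A x -> rnorm (iota x) = rnorm x.
Proof. exact: cover_isometric. Qed.

Section Level.
Variables (L : Type) (r : L -> nat) (pi : D -> forall l, 'M[R[i]]_(r l)).
Hypothesis pih : forall l, star_hom (fun b => pi b l).
Hypothesis pic : forall l d x, nrm (pi d l *m x) <= rnorm d * nrm x.
Hypothesis pin : forall d (c : R), 0 <= c -> c < rnorm d ->
  exists l (x : 'cV_(r l)), nrm x = 1 /\ c < nrm (pi d l *m x).
Variable n : nat.
Local Notation Q := (2 ^ n.+1)%N.

Definition ue (i j : 'I_Q) : D := iota (phi n (delta_mx i j)).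

Lemma ueA (i j : 'I_Q) : (i <= j)%N -> A (phi n (delta_mx i j)).
Proof. by move=> ij; apply: (@ulev_tuhf _ _ _ n); exists (delta_mx i j) => //; apply: upper_delta. Qed.

Lemma ueM (i j k l : 'I_Q) : (i <= j)%N -> (k <= l)%N -> ue i j ** ue k l = if j == k then ue i l else 0.
Proof.
move=> ij kl; rewrite -iotaM; try exact: ueA.
rewrite -(phiM hM) delta_mul; case: eqP => // _; rewrite (phi0 hM).
apply: rnorm0_eq0; rewrite iota_norm ?rnorm0//.
by rewrite -(phi0 hM n); apply: (@ulev_tuhf _ _ _ n); exists 0 => // i' j' _; rewrite mxE.
Qed.

Lemma delta_norm (i j : 'I_Q) : rnorm (phi n (delta_mx i j)) = 1.
Proof.
have P := rnorm_csn M.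
have pp k : rnorm (phi n (delta_mx k k)) = 1.
  have h : rnorm (phi n (delta_mx k k)) = rnorm (phi n (delta_mx k k)) ^+ 2.
    by rewrite -(csnC P) -(phi_star hM) -(phiM hM) star_delta delta_mul eqxx.
  have : rnorm (phi n (delta_mx k k)) * (1 - rnorm (phi n (delta_mx k k))) = 0.
    by rewrite mulrBr mulr1 -expr2 -h subrr.
  move/eqP; rewrite mulf_eq0 => /orP[/eqP/(phi_csn0 hM)/matrixP/(_ k k)|].
    by rewrite !mxE !eqxx => /eqP; rewrite oner_eq0.
  by rewrite subr_eq0 => /eqP.
have := csnC P (phi n (delta_mx i j)).
rewrite -(phi_star hM) -(phiM hM) star_delta delta_mul eqxx pp => /esym/eqP.
by rewrite sqrf_eq1 => /orP[/eqP //|/eqP h]; have := rnorm_ge0 (phi n (delta_mx i j)); rewrite h; lra.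
Qed.

Lemma ue_norm (i j : 'I_Q) : (i <= j)%N -> rnorm (ue i j) = 1.
Proof. by move=> ij; rewrite iota_norm ?delta_norm//; apply: ueA. Qed.

Definition fst_ix : 'I_Q := Ordinal (expn_gt0_succ n).

Lemma pred_ix_subproof : (Q.-1 < Q)%N.
Proof. by rewrite ltn_predL expn_gt0. Qed.

Definition lst_ix : 'I_Q := Ordinal pred_ix_subproof.

Lemma le_lst (i : 'I_Q) : (i <= lst_ix)%N.
Proof. by rewrite /= -ltnS prednK ?expn_gt0. Qed.

(** The vectors [eta] transform under the images of the matrix units like the
    standard basis of C^Q, exactly under upper triangular ones and up to [d]
    under their adjoints. *)
Record good (l : L) (eta : 'I_Q -> 'cV[R[i]]_(r l)) (d : R) : Prop := {
  good_le1 : forall k, nrm (eta k) <= 1;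
  good_ge : 1 - d <= nrm (eta fst_ix);
  good_ue : forall i j : 'I_Q, (i <= j)%N -> forall k,
    pi (ue i j) l *m eta k = if j == k then eta i else 0;
  good_star : forall i j : 'I_Q, (i <= j)%N -> forall k,
    nrm (pi (star (ue i j)) l *m eta k - (if i == k then eta j else 0)) <= d
}.

(** The matrix unit in the upper right corner has norm 1, so its image nearly
    preserves the norm of some unit vector xi. It factors through every other
    matrix unit. Hence all the vectors eta i, the images of xi under the last
    column of matrix units, have norm nearly 1. A contraction that nearly
    preserves the norm of a vector is nearly inverted on it by its adjoint.
    The diagonal matrix units are self-adjoint by [contractive_idempotent_sa],
    which gives the exact orthogonality relations. *)
Lemma good_exists (d : R) : 0 < d -> d < 1 -> exists l eta, @good l eta d.
Proof.
(* with this c both 1 - d <= c and 2 (1 - c^2) <= d^2 hold *)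
move=> d0 d1; pose c := 1 - d ^+ 2 / 4.
have c0 : 0 <= c by rewrite /c; nra.
have c1 : c < 1 by rewrite /c; nra.
have [|l [xi [xi1 hxi]]] := @pin (ue fst_ix lst_ix) c c0.
  by rewrite ue_norm.
have pM a b : pi (a ** b) l = pi a l ** pi b l by have [_ ->] := pih l.
have pS a : pi (star a) l = star (pi a l) by have [_ _ ->] := pih l.
have p0 : pi 0 l = 0 by have [lp _ _] := pih l; apply: linear_map0 lp.
pose eta k := pi (ue k lst_ix) l *m xi.
have pMv a b (x : 'cV_(r l)) : pi a l *m (pi b l *m x) = pi (a ** b) l *m x by rewrite mulmxA pM.
have le1 k : nrm (eta k) <= 1.
  by rewrite /eta; apply: le_trans (pic _ _) _; rewrite ue_norm ?le_lst// xi1 mulr1.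
have ueE (i j : 'I_Q) : (i <= j)%N -> forall k, pi (ue i j) l *m eta k = if j == k then eta i else 0.
  move=> ij k; rewrite pMv ueM ?le_lst//; case: eqP => // _.
  by rewrite p0 mul0mx.
have ge k : c < nrm (eta k).
  apply: lt_le_trans hxi _; rewrite -[pi _ _ *m _]/(eta fst_ix).
  have := ueE fst_ix k (leq0n _) k; rewrite eqxx => <-.
  by apply: le_trans (pic _ _) _; rewrite ue_norm ?mul1r.
exists l, eta; split=> //.
- have := ge fst_ix; rewrite /c; nra.
- move=> i j ij k.
  have usa : star (pi (ue i i) l) = pi (ue i i) l.
    apply: contractive_idempotent_sa; first by rewrite -pM ueM ?leqnn// eqxx.
    move=> x; rewrite -pS; apply: le_trans (pic _ _) _.
    by rewrite (csn_star (rnorm_csn D)) ue_norm ?mul1r// leqnn.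
  have uiE : star (ue i j) = star (ue i j) ** star (ue i i).
    by rewrite -starM ueM ?leqnn// eqxx.
  have [ik|ik] := eqVneq i k; last first.
    rewrite subr0 uiE -pMv [pi (star (ue i i)) l]pS usa ueE// (negPf ik) mulmx0 nrm0.
    exact: ltW.
  subst k; set T := pi (star (ue i j)) l.
  have : nrm2 (T *m eta i - eta j) <= d ^+ 2.
    rewrite nrm2B /T pS dotp_adj starK ueE// eqxx dotpp [complex.Re _]/= -pS.
    have h1 : nrm2 (pi (star (ue i j)) l *m eta i) <= 1.
      rewrite -nrm_sqr -[X in _ <= X](expr1n _ 2) ler_pXn2r ?nnegrE ?nrm_ge0//.
      apply: le_trans (pic _ _) _.
      by rewrite (csn_star (rnorm_csn D)) ue_norm// mul1r.
    have h2 : nrm2 (eta j) <= 1.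
      by rewrite -nrm_sqr -[X in _ <= X](expr1n _ 2) ler_pXn2r ?nnegrE ?nrm_ge0.
    have h3 : c ^+ 2 <= nrm2 (eta i).
      by rewrite -nrm_sqr !expr2; apply: ler_pM; [exact: c0|exact: c0|exact/ltW/ge|exact/ltW/ge].
    have h4 : 1 - d ^+ 2 / 2 <= c ^+ 2 by rewrite /c; have := sqr_ge0 (d ^+ 2); nra.
    move: h1 h2 h3 h4; move: (nrm2 _) (nrm2 _) (nrm2 _) (c ^+ 2) (d ^+ 2) => *; lra.
  by rewrite -nrm_sqr ler_pXn2r ?nnegrE ?nrm_ge0// ltW.
Qed.

(** The element d acts on good vectors like the matrix C, up to an error
    controlled by a constant that does not depend on the representation. *)
Definition acts (C : 'M[R[i]]_Q) (d : D) : Prop :=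
  exists2 K : R, 0 <= K & forall l eta e, 0 < e -> @good l eta e ->
    forall k, nrm (pi d l *m eta k - \sum_i C i k *: eta i) <= K * e.

Lemma acts_linear (a : R[i]) C C' d d' : acts C d -> acts C' d' -> acts (a *: C + C') (a *: d + d').
Proof.
move=> [K K0 h] [K' K0' h']; exists (cabs a * K + K'); first by rewrite addr_ge0// mulr_ge0// cabs_ge0.
move=> l eta e e0 g k; have [lp _ _] := pih l; rewrite lp.
have -> : \sum_i (a *: C + C') i k *: eta i = a *: (\sum_i C i k *: eta i) + \sum_i C' i k *: eta i.
  rewrite scaler_sumr -big_split; apply: eq_bigr => i _.
  by rewrite !mxE scalerDl scalerA.
rewrite mulmxDl -scalemxAl.
set u := pi d l *m _; set v := pi d' l *m _; set x := \sum_i _; set y := \sum_i _.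
have -> : a *: u + v - (a *: x + y) = a *: (u - x) + (v - y) by linear_identity.
apply: le_trans (nrmD _ _) _; rewrite nrmZ mulrDl -mulrA; apply: lerD; last exact: h'.
by rewrite ler_wpM2l ?cabs_ge0//; apply: h.
Qed.

Lemma nrm_sum r' (I : finType) (F : I -> 'cV[R[i]]_r') : nrm (\sum_i F i) <= \sum_i nrm (F i).
Proof.
elim/big_ind2: _ => [|x a y b xa yb|//]; first by rewrite nrm0.
by apply: le_trans (nrmD _ _) _; apply: lerD.
Qed.

Lemma acts_mul C C' d d' : acts C d -> acts C' d' -> acts (C ** C') (d ** d').
Proof.
move=> [K K0 h] [K' K0' h'].
pose c := \sum_k \sum_j cabs (C' j k).
have c0 : 0 <= c by apply: sumr_ge0 => k _; apply: sumr_ge0 => j _; apply: cabs_ge0.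
exists (rnorm d * K' + c * K); first by rewrite addr_ge0// mulr_ge0// rnorm_ge0.
move=> l eta e e0 g k; have [_ pM _] := pih l.
pose v := \sum_j C' j k *: eta j.
have -> : pi (d ** d') l *m eta k - \sum_i (C ** C') i k *: eta i =
   pi d l *m (pi d' l *m eta k - v) + \sum_j C' j k *: (pi d l *m eta j - \sum_i C i j *: eta i).
  rewrite pM /smul /= -mulmxA mulmxBr -addrA; congr (_ + _).
  under [X in _ = _ + X]eq_bigr => j _ do rewrite scalerBr.
  rewrite sumrB /v mulmx_sumr addrA.
  under [X in _ = - X + _ - _]eq_bigr => j _ do rewrite -scalemxAr.
  rewrite addNr sub0r; congr (- _).
  under [RHS]eq_bigr => j _ do rewrite scaler_sumr.
  rewrite exchange_big; apply: eq_bigr => i _.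
  rewrite mxE scaler_suml; apply: eq_bigr => j _.
  by rewrite scalerA mulrC.
apply: le_trans (nrmD _ _) _; rewrite mulrDl; apply: lerD.
  apply: le_trans (pic _ _) _; rewrite -mulrA ler_wpM2l ?rnorm_ge0//.
  exact: h'.
apply: le_trans (nrm_sum _) _.
have -> : c * K * e = c * (K * e) by rewrite mulrA.
apply: (@le_trans _ _ ((\sum_j cabs (C' j k)) * (K * e))).
  rewrite mulr_suml; apply: ler_sum => j _; rewrite nrmZ ler_wpM2l ?cabs_ge0//.
  exact: h.
apply: ler_wpM2r; first by rewrite mulr_ge0// ltW.
rewrite /c [leRHS](bigD1 k)//= lerDl; apply: sumr_ge0 => i _; apply: sumr_ge0 => j _.
exact: cabs_ge0.
Qed.

Lemma acts0 : acts 0 0.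
Proof.
exists 0 => // l eta e e0 g k; have [lp _ _] := pih l.
rewrite (linear_map0 lp) mul0mx big1 => [|i _]; first by rewrite subr0 nrm0 mul0r.
by rewrite mxE scale0r.
Qed.

Lemma sum_delta (W : lmodType R[i]) (eta : 'I_Q -> W) (i j k : 'I_Q) :
  \sum_a (delta_mx i j : 'M[R[i]]_Q) a k *: eta a = if j == k then eta i else 0.
Proof.
rewrite (bigD1 i)//= big1 => [|a ai]; last by rewrite mxE (negPf ai) scale0r.
by rewrite addr0 mxE eqxx eq_sym; case: eqP => _; rewrite /= ?scale1r ?scale0r.
Qed.

Lemma acts_delta (i j : 'I_Q) : (i <= j)%N ->
  acts (delta_mx i j) (ue i j) /\ acts (star (delta_mx i j)) (star (ue i j)).
Proof.
move=> ij; split.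
  exists 0 => // l eta e e0 g k; rewrite sum_delta (good_ue g ij).
  by rewrite subrr nrm0 mul0r.
rewrite star_delta; exists 1 => // l eta e e0 g k; rewrite sum_delta mul1r.
exact: (good_star g ij).
Qed.

Lemma iota0 : iota 0 = 0.
Proof.
have A0 : A 0.
  by rewrite -(phi0 hM n); apply: (@ulev_tuhf _ _ _ n); exists 0 => // i' j' _; rewrite mxE.
by apply: rnorm0_eq0; rewrite iota_norm ?rnorm0.
Qed.

Lemma acts_upper (T : 'M[R[i]]_Q) : upper_triangular T ->
  acts T (iota (phi n T)) /\ acts (star T) (star (iota (phi n T))).
Proof.
move=> TT.
pose S := [set C : 'M[R[i]]_Q | upper_triangular C /\
  (acts C (iota (phi n C)) /\ acts (star C) (star (iota (phi n C))))].
have UA (C : 'M[R[i]]_Q) : upper_triangular C -> A (phi n C).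
  by move=> CT; apply: (@ulev_tuhf _ _ _ n); exists C.
have S0 : S 0.
  split; first by move=> i j _; rewrite mxE.
  by rewrite (phi0 hM) iota0 !star0; split; apply: acts0.
have Sl (a : R[i]) C C' : S C -> S C' -> S (a *: C + C').
  move=> [CT [h1 h2]] [CT' [h1' h2']]; split; first exact: upper_linear.
  rewrite (phi_linear hM) iota_lin; try exact: UA.
  by rewrite !starD !starZ; split; apply: acts_linear.
have SD C C' : S C -> S C' -> S (C + C') by rewrite -{2}[C]scale1r; apply: Sl.
suff [] : S T by [].
rewrite [T]matrix_sum_delta; apply: (big_ind S); [exact: S0|exact: SD|move=> i _].
apply: (big_ind S); [exact: S0|exact: SD|move=> j _].
rewrite -[_ *: _]addr0.
have [ij|ji] := leqP i j; last by rewrite TT// scale0r addr0.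
by apply: Sl => //; split; [apply: upper_delta|apply: acts_delta].
Qed.

(** Multiplication by matrix units from both sides moves the entry to the
    upper right corner, where it can be read off from the length of one
    vector. *)
Lemma acts_entry C d i j : acts C d -> cabs (C i j) <= rnorm d.
Proof.
move=> Cd.
pose a := ue fst_ix i; pose b := ue j lst_ix.
have [ai _] : acts (delta_mx fst_ix i) a /\ _ := acts_delta (leq0n i : (fst_ix <= i)%N).
have [bj _] : acts (delta_mx j lst_ix) b /\ _ := acts_delta (le_lst j).
have := acts_mul (acts_mul ai Cd) bj; rewrite delta_corner => -[K K0 h].
set t := cabs (C i j).
have dn : rnorm (a ** d ** b) <= rnorm d.
  have P := rnorm_csn D.
  apply: le_trans (csnM P _ _) _; rewrite [rnorm b]ue_norm ?le_lst// mulr1.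
  by apply: le_trans (csnM P _ _) _; rewrite [rnorm a]ue_norm ?mul1r.
have t0 : 0 <= t by apply: cabs_ge0.
apply: ltr_eps => e e0.
pose s := Num.min 2^-1 (e / (t + K + 1)).
have m0 : 0 < t + K + 1 by lra.
have s0 : 0 < s by rewrite lt_min invr_gt0 ltr0n divr_gt0.
have s1 : s < 1 by rewrite gt_min; apply/orP; left; lra.
have se : s * (t + K + 1) <= e by rewrite -ler_pdivlMr// ge_min lexx orbT.
have [l [eta g]] := good_exists s0 s1.
have := h l eta s s0 g lst_ix.
have -> : \sum_i0 (C i j *: delta_mx fst_ix lst_ix : 'M[R[i]]_Q) i0 lst_ix *: eta i0 = C i j *: eta fst_ix.
  under eq_bigr => k _ do rewrite mxE -scalerA.
  by rewrite -scaler_sumr sum_delta eqxx.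
move=> h1.
have h2 : nrm (pi (a ** d ** b) l *m eta lst_ix) <= rnorm d.
  apply: le_trans (pic _ _) _; apply: le_trans (_ : rnorm (a ** d ** b) * 1 <= _).
    by rewrite ler_wpM2l ?rnorm_ge0// (good_le1 g).
  by rewrite mulr1.
have h3 : t * nrm (eta fst_ix) <= rnorm d + K * s.
  rewrite -nrmZ -[_ *: eta _](subrK (pi (a ** d ** b) l *m eta lst_ix)) addrC.
  apply: le_trans (nrmD _ _) _; apply: lerD => //.
  by rewrite -opprB nrmN.
have := good_ge g; nra.
Qed.

Lemma acts_norm C d : acts C d -> acts (star C) (star d) -> rnorm (phi n C) <= rnorm d.
Proof.
move=> h hs.
apply: (@csn_le_rel _ _ _ (fun C => rnorm (phi n C)) (@rnorm R D)
  (fun C d => acts C d /\ acts (star C) (star d)) (\sum_i \sum_j rnorm (phi n (delta_mx i j)))).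
- exact: phi_csn hM n.
- exact: rnorm_csn.
- move=> v w v' w' [h1 h2] [h1' h2']; split; first exact: acts_mul.
  by rewrite !starM; apply: acts_mul.
- by move=> v w [h1 h2]; rewrite !starK; split.
- move=> v w [h1 _]; apply: (@csn_mx_le_entries _ _ (fun C => rnorm (phi n C)) v (rnorm w)).
    exact: phi_csn hM n.
  by move=> i j; apply: acts_entry.
- by split.
Qed.
End Level.
End LowerBound.

(** * The meet of the RFD covers *)

Section RfdDominates.
Variables (R : realType) (M : cstarAlgType R).
Variable phi : forall n, 'M[R[i]]_(2 ^ n.+1) -> M.
Arguments phi : clear implicits.
Hypothesis hM : is_uhf2 phi.
Let A := tuhf2 phi.

Lemma coverB (D : cstarAlgType R) (iota : M -> D) : cstar_cover A iota ->
  forall x y, A x -> A y -> iota (x - y) = iota x - iota y.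
Proof.
move=> [[h _] _ _] x y Ax Ay; have := h (-1) y x Ay Ax.
by rewrite !scaleN1r addrC [- _ + _]addrC.
Qed.

Lemma tuhfB x y : A x -> A y -> A (x - y).
Proof. by move=> Ax Ay; have := @tuhf_lin _ _ _ hM (-1) _ _ Ay Ax; rewrite scaleN1r addrC. Qed.

(** The elements of D that act like a matrix, compatibly at all high levels,
    form a star algebra that contains the image of the triangular matrices. By
    [acts_norm] sending such an element to its matrix is a contraction to M,
    which extends to all of D. *)
Lemma rfd_cover_ge_id (D : cstarAlgType R) (iota : M -> D) :
  rfd_cover A iota -> cover_le A (@id M) iota.
Proof.
move=> [hc [L [r [pi [_ [N [NP Nb]] pih pi_inj]]]]].
have pic := rep_contractive NP pih; have pin := rep_norming NP Nb pih pi_inj.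
have iso x : A x -> rnorm (iota x) = rnorm x by apply: cover_isometric.
pose G (d : D) (x : M) := exists n, forall m, (n <= m)%N -> exists C,
  [/\ phi m C = x, acts phi iota pi C d & acts phi iota pi (star C) (star d)].
have GS : star_rel G.
  split.
  - move=> a d x d' x' [n hn] [n' hn']; exists (n + n')%N => m nm.
    have [C [<- h1 h2]] := hn m (leq_trans (leq_addr _ _) nm).
    have [C' [<- h1' h2']] := hn' m (leq_trans (leq_addl _ _) nm).
    exists (a *: C + C'); split; [exact: phi_linear hM _ _ _ _|exact: acts_linear|].
    by rewrite !starD !starZ; apply: acts_linear.
  - move=> d x d' x' [n hn] [n' hn']; exists (n + n')%N => m nm.
    have [C [<- h1 h2]] := hn m (leq_trans (leq_addr _ _) nm).
    have [C' [<- h1' h2']] := hn' m (leq_trans (leq_addl _ _) nm).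
    exists (C ** C'); split; [exact: phiM hM _ _ _|exact: acts_mul|].
    by rewrite !starM; apply: acts_mul.
  - move=> d x [n hn]; exists n => m /hn[C [<- h1 h2]]; exists (star C).
    by split; [exact: phi_star hM _ _|exact: h2|rewrite !starK].
have Gle d x : G d x -> rnorm x <= rnorm d.
  move=> [n /(_ n (leqnn n))[C [<- h1 h2]]]; exact: (acts_norm hM hc pih pic pin h1 h2).
have Gu n y : ulev phi n y -> G (iota y) y.
  move=> yn; exists n => m nm; have [T TT Ty] := ulev_le hM nm yn.
  by exists T; have [h1 h2] := acts_upper hM hc pih TT; rewrite -Ty.
have GA x : A x -> rel_closure G (iota x) x.
  move=> Ax e e0; have [n [y [yn xy]]] := ulev_dense Ax e0.
  exists (iota y), y; split=> //; first exact: Gu yn.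
  have Ay := ulev_tuhf yn.
  by rewrite -(coverB hc)// iso//; apply: tuhfB.
(* S is a C*-subalgebra containing the generators, hence everything *)
pose S := [set d : D | exists x, rel_closure G d x].
have lG := rel_closure_linear (star_rel_linear GS).
have dense : closure S = setT.
  rewrite -subTset => d _; apply: subset_closure; have [_ _ gen] := hc.
  have : smallest (@cstar_subalgebra R D) (iota @` A) d by rewrite gen.
  apply; split; last by move=> _ [x Ax <-]; exists x; apply: GA.
  split.
  - have Gx : G (iota (unit1 phi)) (unit1 phi) by apply: (Gu 0%N); apply: unit1_ulev.
    exists 0; have := lG (-1) _ _ _ _ (sub_rel_closure Gx) (sub_rel_closure Gx).
    by rewrite !scaleN1r !addNr.
  - by move=> a x y [x' hx] [y' hy]; exists (a *: x' + y'); apply: lG.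
  - by move=> x y [x' hx] [y' hy]; exists (x' ** y'); exact: (rel_closure_mul (star_rel_mul GS) hx hy).
  - by move=> x [x' hx]; exists (star x'); exact: (rel_closure_star (star_rel_star GS) hx).
  - apply/closedP => x h; apply: (rel_closure_closed (star_rel_linear GS) Gle) => e e0.
    by have [y [y' hy] xy] := h e e0; exists y, y'.
have [f [fh hf]] := extend_star_hom GS Gle dense.
by exists f; split=> // x Ax; apply/hf/GA.
Qed.
End RfdDominates.

Section Meet.
Variables (R : realType) (M : cstarAlgType R).
Variable phi : forall n, 'M[R[i]]_(2 ^ n.+1) -> M.
Arguments phi : clear implicits.
Hypothesis hM : is_uhf2 phi.
Let A := tuhf2 phi.

(** The adjoints of the upper triangular matrix units are the lower triangular
    ones. *)
Lemma star_hom_upper_ext (E : cstarAlgType R) n (f g : 'M[R[i]]_n -> E) : star_hom f -> star_hom g ->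
  (forall T, upper_triangular T -> f T = g T) -> f =1 g.
Proof.
move=> [lf _ fS] [lg _ gS] h B.
have [fD fZ _ _] := linear_mapE lf; have [gD gZ _ _] := linear_mapE lg.
have f0 := linear_map0 lf; have g0 := linear_map0 lg.
have d i j : f (delta_mx i j) = g (delta_mx i j).
  have [ij|/ltnW ji] := leqP i j; first exact/h/upper_delta.
  by rewrite -star_delta fS gS h//; apply: upper_delta.
rewrite [B]matrix_sum_delta !(big_morph f fD f0) !(big_morph g gD g0).
apply: eq_bigr => i _; rewrite (big_morph f fD f0) (big_morph g gD g0).
by apply: eq_bigr => j _; rewrite fZ gZ d.
Qed.

(** The constant sequences of level m in the m-th tail cover give a star
    homomorphism from the matrix algebra of level m to E that extends k on
    triangular matrices. These are compatible for varying m and contractive,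
    hence extend to M. *)
Lemma lower_bound_le_id (E : cstarAlgType R) (k : M -> E) : cstar_cover A k ->
  (forall m, cover_le A k (comp_emb hM m)) -> cover_le A k (@id M).
Proof.
move=> hk hle.
have iso x : A x -> rnorm (k x) = rnorm x by apply: cover_isometric.
pose th m := projT1 (cid (hle m)).
have thP m : star_hom (th m) /\ forall x, A x -> th m (comp_emb hM m x) = k x.
  by rewrite /th; case: cid.
pose kap m (B : 'M[R[i]]_(2 ^ m.+1)) : E := th m (const_emb hM B).
have kapH m : star_hom (kap m).
  have [cl cM cS] := const_emb_star_hom hM m; have [[tl tM tS] _] := thP m.
  by split=> [a B C|B C|B]; rewrite /kap ?cl ?tl// ?cM ?tM// cS tS.
have kapT m T : upper_triangular T -> kap m T = k (phi m T).
  move=> TT; rewrite /kap const_emb_upper//; have [_ ->//] := thP m.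
  by apply: (@ulev_tuhf _ _ _ m); exists T.
have kap_le m B : rnorm (kap m B) <= rnorm (phi m B).
  apply: (csn_mx_le (p := fun B => rnorm (kap m B)) (q := fun B => rnorm (phi m B))).
  - exact: csn_comp (kapH m) (rnorm_csn E).
  - exact: phi_csn hM m.
  - exact: phi_csn0 hM m.
have kapS m B : kap m.+1 (dbl (expn2SD m.+1) B) = kap m B.
  apply: (star_hom_upper_ext (f := fun B => kap m.+1 (dbl (expn2SD m.+1) B)) (g := kap m)) => //.
    have [lk kM kS] := kapH m.+1; split=> [a C C'|C C'|C].
    + by rewrite (dbl_linear hM) lk.
    + by rewrite (dblM hM) kM.
    + rewrite -kS; congr kap; apply: (uhf2_inj hM (n := m.+1)).
      by rewrite (phi_star hM) !(phi_dbl hM) (phi_star hM).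
  move=> T TT; rewrite !kapT//; last exact: dbl_upper.
  by rewrite (phi_dbl hM).
pose G (x : M) (e : E) := exists m B, x = phi m B /\ e = kap m B.
have lift m m' B : (m <= m')%N -> exists B', phi m' B' = phi m B /\ kap m' B' = kap m B.
  move=> /subnK <-; elim: (m' - m)%N => [|j [B' [h1 h2]]]; first by exists B.
  exists (dbl (expn2SD (j + m).+1) B'); split.
    by rewrite -h1; apply: phi_dbl hM _ _.
  by rewrite -h2; apply: kapS.
have GE x e x' e' : G x e -> G x' e' ->
    exists m B B', [/\ x = phi m B, e = kap m B, x' = phi m B' & e' = kap m B'].
  move=> [m [B [-> ->]]] [m' [B' [-> ->]]]; exists (m + m')%N.
  have [B1 [<- <-]] := lift _ _ B (leq_addr m' m).
  by have [B2 [<- <-]] := lift _ _ B' (leq_addl m m'); exists B1, B2.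
have GS : star_rel G.
  split.
  - move=> a x e x' e' h h'; have [m [B [B' [-> -> -> ->]]]] := GE _ _ _ _ h h'.
    by exists m, (a *: B + B'); have [lk _ _] := kapH m; rewrite lk (phi_linear hM).
  - move=> x e x' e' h h'; have [m [B [B' [-> -> -> ->]]]] := GE _ _ _ _ h h'.
    by exists m, (B ** B'); have [_ kM _] := kapH m; rewrite kM (phiM hM).
  - move=> x e [m [B [-> ->]]]; exists m, (star B).
    by have [_ _ kS] := kapH m; rewrite kS (phi_star hM).
have Gle x e : G x e -> rnorm e <= rnorm x by move=> [m [B [-> ->]]]; apply: kap_le.
have dense : closure [set x | exists e, rel_closure G x e] = setT.
  rewrite -subTset => x _; apply/closureE => e e0.
  have [m [y [[B _ By] xy]]] := lev_dense hM x e0; exists y => //.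
  by exists (kap m B); apply: sub_rel_closure; exists m, B.
have [f [fh hf]] := extend_star_hom GS Gle dense.
exists f; split=> // x Ax; apply/hf => e e0.
have [m [y [ym xy]]] := ulev_dense Ax e0; have Ay := ulev_tuhf ym.
have [T TT Ty] := ym; exists y, (k y); split=> //.
  by exists m, T; rewrite kapT// Ty.
by rewrite -(coverB hk)// iso//; apply: tuhfB.
Qed.

Theorem tuhf_meet : is_cover_meet A (@rfd_cover R M A) (@id M).
Proof.
split; [exact: tuhf_cover_id hM|exact: rfd_cover_ge_id hM|].
move=> E k hk hle; apply: lower_bound_le_id => // m.
exact/hle/comp_rfd_cover.
Qed.

(** If x is a vector with f(e_oo) x nonzero, the vectors f(e_io) x are
    linearly independent. *)
Lemma matrix_rep_size Q r (f : 'M[R[i]]_Q -> 'M[R[i]]_r) : star_hom f -> f 1%:M <> 0 -> (Q <= r)%N.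
Proof.
move=> [lf fM _] f1; have [fD fZ _ _] := linear_mapE lf; have f0 := linear_map0 lf.
rewrite leqNgt; apply/negP => rQ; have Q0 : (0 < Q)%N by apply: leq_ltn_trans rQ.
pose o : 'I_Q := Ordinal Q0.
have fd i j a b : f (delta_mx i j) *m f (delta_mx a b) = if j == a then f (delta_mx i b) else 0.
  by rewrite -[LHS]fM delta_mul; case: ifP.
have [a [b ab]] : exists a b, f (delta_mx o o) a b != 0.
  apply: contrapT => h; apply: f1.
  have oo : f (delta_mx o o) = 0.
    apply/matrixP => a b; rewrite mxE; apply: contrapT => /eqP ab.
    by apply: h; exists a, b.
  rewrite mx1_sum_delta (big_morph f fD f0) big1// => i _.
  have := fd i o o i; rewrite eqxx => <-.
  by have := fd i o o o; rewrite eqxx oo mulmx0 => <-; rewrite mul0mx.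
pose x : 'cV[R[i]]_r := delta_mx b 0.
pose H : 'M[R[i]]_(Q, r) := \matrix_(i, c) (f (delta_mx i o) *m x) c 0.
have : kermx H != 0.
  rewrite kermx_eq0 -row_leq_rank -ltnNge; apply: leq_ltn_trans rQ.
  exact: rank_leq_col.
case/rowV0Pn => v /sub_kermxP vH /eqP; apply.
have vs : \sum_i v 0 i *: (f (delta_mx i o) *m x) = 0.
  apply/matrixP => c d; rewrite ord1 summxE.
  transitivity ((v *m H) 0 c); last by rewrite vH !mxE.
  by rewrite [RHS]mxE; apply: eq_bigr => i _; rewrite [LHS]mxE [H _ _]mxE.
apply/matrixP => j i; rewrite ord1 [RHS]mxE.
have : f (delta_mx o i) *m (\sum_i v 0 i *: (f (delta_mx i o) *m x)) = v 0 i *: (f (delta_mx o o) *m x).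
  rewrite mulmx_sumr (bigD1 i)//= big1 => [|c ci].
    by rewrite addr0 -scalemxAr mulmxA fd eqxx.
  by rewrite -scalemxAr mulmxA fd eq_sym (negPf ci) mul0mx scaler0.
rewrite vs mulmx0 => /matrixP /(_ a 0); rewrite -colE !mxE => /esym/eqP.
by rewrite mulf_eq0 (negPf ab) orbF => /eqP.
Qed.

(** By [tuhf_meet] a least RFD cover would receive a homomorphism from M.
    Composing with a finite-dimensional representation that does not kill the
    unit represents matrix algebras of arbitrary size on a space of fixed
    dimension. *)
Theorem tuhf_no_minimum : ~ (exists (B0 : cstarAlgType R) (upsilon : M -> B0),
  rfd_cover A upsilon /\
  forall (B : cstarAlgType R) (iota : M -> B), rfd_cover A iota -> cover_le A upsilon iota).
Proof.
move=> [B0 [ups [[hc hr] hmin]]].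
have [_ _ glb] := tuhf_meet; have [th [[tl tM tS] tA]] := glb B0 ups hc hmin.
have [L [r [pi [_ _ pih pi_inj]]]] := hr.
have A1 : A (unit1 phi) by apply: (ulev_tuhf (n := 0)); apply: unit1_ulev.
have u0 : ups (unit1 phi) <> 0.
  move=> u0; have := cover_isometric hc A1; rewrite u0 rnorm0 => /esym/rnorm0_eq0.
  exact: (unit1_neq0 hM).
have [l ul] : exists l, pi (ups (unit1 phi)) l <> 0.
  apply: contrapT => h; apply: u0; apply: (rep_separates pih pi_inj) => l.
  by apply: contrapT => ?; apply: h; exists l.
have : (2 ^ (r l).+1 <= r l)%N.
  have [pl pM pS] := pih l.
  apply: (@matrix_rep_size _ _ (fun B => pi (th (phi (r l) B)) l)).
    split=> [a B C|B C|B].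
    - by rewrite (phi_linear hM) tl pl.
    - by rewrite (phiM hM) tM pM.
    - by rewrite (phi_star hM) tS pS.
  by rewrite (phi1 hM) tA.
by rewrite leqNgt (ltn_trans (ltnSn _) (ltn_expl _ (ltnSn 1))).
Qed.
End Meet.

Theorem theorem5p2 (R : realType) (M : cstarAlgType R)
    (phi : forall n : nat, 'M[R[i]]_(2 ^ n.+1) -> M) (hM : is_uhf2 phi) :
  is_cover_meet (tuhf2 phi) (@rfd_cover R M (tuhf2 phi)) (@id M)
  /\
  ~ (exists (B0 : cstarAlgType R) (upsilon : M -> B0),
       rfd_cover (tuhf2 phi) upsilon /\
       forall (B : cstarAlgType R) (iota : M -> B),
         rfd_cover (tuhf2 phi) iota -> cover_le (tuhf2 phi) upsilon iota).
Proof. by split; [apply: tuhf_meet|apply: tuhf_no_minimum]. Qed.
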